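(* Let $W$ be a graded $\mathbf{k}$-space, and let $(T^c(W),d_C)$ and $(T(W),d_A)$ be an almost cofree dg coalgebra cogenerated by $W$ and an almost free dg algebra generated by $W$. Let $(s^{-1}\mathfrak E(W),\{d_m\})$ and $(s^{-1}\mathfrak E'(W),\{d'_m\})$ be the corresponding deformations of the endomorphism and co-endomorphism $\mathcal B_\infty$-algebras of $W$. Let $s^{-1}B$ be a $\mathcal B_\infty$-algebra. Then there is a bijection between the set of actions of $s^{-1}B$ on the dg coalgebra $(T^c(W),d_C)$ and the set of $\mathcal B_\infty$-morphisms $s^{-1}B\to(s^{-1}\mathfrak E(W),\{d_m\})$. Similarly, there is a bijection between the set of actions of $s^{-1}B$ on the dg algebra $(T(W),d_A)$ and the set of $\mathcal B_\infty$-morphisms $s^{-1}B\to(s^{-1}\mathfrak E'(W),\{d'_m\})$.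
   Context: $\mathbf{k}$ is a field of characteristic $0$; spaces are $\mathbb{Z}$-graded, differentials raise degree by $1$, $s^{-1}$ is desuspension. In an exponent of $-1$ a homogeneous element stands for its degree. $T^c(V)=\bigoplus_{n>0}V^{\otimes n}$ is the cofree coassociative coalgebra (deconcatenation), $T(V)$ the free associative algebra on $V$ (without unit). Almost (co)free means (co)free after forgetting the differential. **$\mathcal B_\infty$-algebra.** A $\mathcal B_\infty$-structure on $s^{-1}B$ is a set of linear maps $b_{m,n}:B^{\otimes(m+n)}\to B$ of degree $0$ ($m,n\ge0$) and $d_m:B^{\otimes m}\to B$ of degree $1$ ($m>0$), with $b_{0,1}=b_{1,0}=\mathrm{Id}_B$, $b_{0,m}=b_{m,0}=0$ for $m\ne1$, such that the coderivation $\sum_p\widehat d_p$ of $T^c(B)$, $\widehat d_p(v_1,\dots,v_n)=\sum_i(-1)^{v_1+\dots+v_i}v_1\otimes\dots\otimes d_p(v_{i+1},\dots,v_{i+p})\otimes\dots\otimes v_n$, squares to zero and, with $$b_p(u_1,\dots,u_m;v_1,\dots,v_n):=\sum\pm\bigotimes_{1\le q\le p}b_{i_q,j_q}(u_{\bar i_{q-1}+1},\dots,u_{\bar i_q},v_{\bar j_{q-1}+1},\dots,v_{\bar j_q})$$ (sum over $i_q,j_q\ge0$, $\sum i_q=m$, $\sum j_q=n$; $\bar i_q=\sum_{r\le q}i_r$, $\bar j_q=\sum_{r\le q}j_r$; Koszul sign), the product $(u_1,\dots,u_m)\cdot(v_1,\dots,v_n)=\sum_{p>0}b_p(u_1,\dots,u_m;v_1,\dots,v_n)$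 on $T^c(B)$ is associative and $\sum_p\widehat d_p$ is a graded derivation of it. Thus $T^c(B)$ (with unit and counit adjoined) is a dg Hopf algebra. **$\mathcal B_\infty$-morphism** $s^{-1}B\to s^{-1}B'$: linear maps $\mu_m:B^{\otimes m}\to B'$, $m>0$, of degree $0$ such that the coalgebra map $T^c(B)\to T^c(B')$ they cogenerate is a morphism of dg Hopf algebras. **Module over $s^{-1}B$.** A module structure on a dg space $(M,d_M)$ is a set of degree $0$ linear maps $\beta_m:B^{\otimes(m-1)}\otimes M\to M$, $m>1$, with $$\sum_{p>1}\beta_p(b_{p-1}(u_1,\dots,u_m;v_1,\dots,v_n),w)=\beta_{m+1}(u_1,\dots,u_m,\beta_{n+1}(v_1,\dots,v_n,w)),$$ $$d_M(\beta_m(v_1,\dots,v_{m-1},w))=\sum_{p=1}^{m-1}\beta_{m-p+1}(\widehat d_p(v_1,\dots,v_{m-1}),w)+(-1)^{v_1+\dots+v_{m-1}}\beta_m(v_1,\dots,v_{m-1},d_M(w)).$$ **Action on a dg associative algebra** $A$: a module structure on $A$ such that, with $\beta_1=\mathrm{Id}$, $$\beta_m(v_1,\dots,v_{m-1},a_1a_2)=\sum_{i=0}^{m-1}(-1)^{a_1(v_{i+1}+\dots+v_{m-1})}\beta_{i+1}(v_1,\dots,v_i,a_1)\cdot\beta_{m-i}(v_{i+1},\dots,v_{m-1},a_2).$$ **Action on a dg coassociative coalgebra** $(C,\Delta)$: a module structure on $C$ such that, with $\beta_1=\mathrm{Id}$ and $\Delta(c)=\sum c_1\otimes c_2$, $$\Delta(\beta_m(v_1,\dots,v_{m-1},c))=\sum\sum_{i=0}^{m-1}(-1)^{c_1(v_{i+1}+\dots+v_{m-1})}\beta_{i+1}(v_1,\dots,v_i,c_1)\otimes\beta_{m-i}(v_{i+1},\dots,v_{m-1},c_2).$$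 **Endomorphism and co-endomorphism $\mathcal B_\infty$-algebras.** $\mathfrak E(W)=\mathrm{Hom}(\bigoplus_{m>0}W^{\otimes m},W)$ (coderivations of $T^c(W)$) and $\mathfrak E'(W)=\mathrm{Hom}(W,\bigoplus_{m>0}W^{\otimes m})$ (derivations of $T(W)$). On $s^{-1}\mathfrak E(W)$ and $s^{-1}\mathfrak E'(W)$ all $d_m$ are zero and the $b_{m,n}$ are given by all possible compositions of maps: on $\mathfrak E(W)$, $b_{1,n}(e_0,e_1,\dots,e_n)$ is the sum (Koszul signs) over all ways of inserting $e_1,\dots,e_n$, in this order, at disjoint places among the inputs of $e_0$, and $b_{m,n}=0$ for $m>1,n\ge1$; on $\mathfrak E'(W)$, $b_{m,1}(e_1,\dots,e_m,e_0)$ is the sum (Koszul signs) over all ways of applying $e_1,\dots,e_m$, in this order, to distinct tensor factors of the output of $e_0$, and $b_{m,n}=0$ for $n>1,m\ge1$. **Deformations.** If $b_0$ is a degree $1$ element with $d_1(b_0)+b_{1,1}(b_0,b_0)=0$, the deformation of a $\mathcal B_\infty$-algebra by $b_0$ keeps $\{b_{m,n}\}$ and replaces $d_m$ by $$d^{b_0}_m(b_1,\dots,b_m)=d_m(b_1,\dots,b_m)+b_{1,m}(b_0,b_1,\dots,b_m)+(-1)^{b_1+\dots+b_m+1}b_{m,1}(b_1,\dots,b_m,b_0).$$ The deformation of $s^{-1}\mathfrak E(W)$ corresponding to $(T^c(W),d_C)$ is the one by the element $e_0\in\mathfrak E(W)$ cogenerating $d_C$; the deformation of $s^{-1}\mathfrak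 E'(W)$ corresponding to $(T(W),d_A)$ is the one by the element $e'_0\in\mathfrak E'(W)$ generating $d_A$. *)

(* Defs.v *)
From HB Require Import structures.
From mathcomp Require Import all_boot all_order all_algebra.
From mathcomp Require Import ring_quotient.
From mathcomp Require Import boolp classical_sets functions.
From mathcomp Require Import zify ring.
From mathcomp.multinomials Require Import freeg.

Set Implicit Arguments.
Unset Strict Implicit.
Unset Printing Implicit Defensive.

Import GRing.Theory.
Local Open Scope ring_scope.

Local Notation free R K := (FreegDefs.type_of (Phant R) (Phant K)).
Local Notation gen x := (Freeg [:: (1, x)]).

(* A function on sequences that is linear in every letter: its restriction to
   sequences of length n is a linear map V^{⊗n} -> M, so such an [f] encodes a
   family of linear maps indexed by n >= 0. *)
Definition multilinear (k : fieldType) (V M : lmodType k) (f : seq V -> M) : Prop :=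
  forall s t a x y,
    f (s ++ (a *: x + y) :: t) = a *: f (s ++ x :: t) + f (s ++ y :: t).

Section FreeLift.
Variables (k : fieldType) (K : choiceType) (M : lmodType k) (f : K -> M).

Lemma fglift_linear : linear (fglift f : free k K -> M).
Proof.
have fB := @lift_is_additive _ _ _ f.
have fD x y : fglift f (x + y : free k K) = fglift f x + fglift f y.
  have f0 : fglift f (0 : free k K) = 0 by rewrite -[X in fglift f X](subrr 0) fB subrr.
  by rewrite -[y in LHS]opprK fB -[- y]add0r fB f0 sub0r opprK.
have f0 : fglift f (0 : free k K) = 0 by rewrite -[X in fglift f X](subrr 0) fB subrr.
move=> a x y; rewrite fD; congr (_ + _).
rewrite -[x in RHS]freeg_sumE.
have -> : a *: x = \sum_(z <- dom x) Freeg [:: (a * coeff z x, z)] by [].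
rewrite !(big_morph _ fD f0) scaler_sumr; apply: eq_bigr => z _ /=.
by rewrite !liftU scalerA.
Qed.

End FreeLift.

Section Tensor.
Variables (k : fieldType) (V : lmodType k).

(* [tens V] is T(V) = ⊕_{n>0} V^{⊗n}: the free module on words in V modulo
   multilinearity in each letter; the empty word is killed as well, because
   there is no n = 0 summand.  V ⊗ V is the span of the two-letter words. *)
Inductive tnull : free k (seq V) -> Prop :=
| tnull0 : tnull 0
| tnull_nil : tnull (gen [::])
| tnull_lin s t a x y :
    tnull (gen (s ++ (a *: x + y) :: t)
           - (a *: gen (s ++ x :: t) + gen (s ++ y :: t)))
| tnull_comb a x y : tnull x -> tnull y -> tnull (a *: x + y).

Definition tnullb : {pred free k (seq V)} := fun x => `[< tnull x >].

Fact tnull_submod : submod_closed tnullb.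
Proof.
split; first exact/asboolP/tnull0.
by move=> a x y /asboolP hx /asboolP hy; apply/asboolP/tnull_comb.
Qed.

HB.instance Definition _ :=
  GRing.isSubmodClosed.Build k (free k (seq V)) tnullb tnull_submod.

Definition tens : Type := Quotient.quot tnullb.
HB.instance Definition _ := GRing.Zmodule.on tens.

Definition tclass (x : free k (seq V)) : tens := (\pi_(Quotient.quot tnullb) x)%qT.

Fact tclassB : zmod_morphism tclass.
Proof. by move=> x y; rewrite /tclass -[LHS]/(\pi_(Quotient.quot tnullb)%qT _) raddfB. Qed.

Fact tclass0 : tclass 0 = 0.
Proof. by rewrite -[X in tclass X](subrr 0) tclassB subrr. Qed.

Fact tclassP x y : reflect (tnull (x - y)) (tclass x == tclass y).
Proof.
rewrite /tclass -Quotient.idealrBE; exact: asboolP.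
Qed.

Definition trepr (x : tens) : free k (seq V) := generic_quotient.repr (x : Quotient.quot tnullb).
Fact treprK x : tclass (trepr x) = x.
Proof. exact: generic_quotient.reprK. Qed.

Definition tscale (a : k) (x : tens) : tens := tclass (a *: trepr x).

Fact tscaleE a x : tscale a (tclass x) = tclass (a *: x).
Proof.
apply/eqP/tclassP; rewrite -scalerBr -[X in tnull X]addr0.
by apply: tnull_comb tnull0; apply/tclassP; rewrite treprK.
Qed.

Fact tclassD x y : tclass x + tclass y = tclass (x + y).
Proof.
pose T := HB.pack_for {additive (free k (seq V)) -> tens} tclass
   (GRing.isZmodMorphism.Build _ _ tclass tclassB).
by rewrite -(raddfD T).
Qed.

Fact tscaleA a b x : tscale a (tscale b x) = tscale (a * b) x.
Proof. by rewrite -[x]treprK !tscaleE scalerA. Qed.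
Fact tscale1 : left_id 1 tscale.
Proof. by move=> x; rewrite -[x]treprK !tscaleE scale1r. Qed.
Fact tscaleDr : right_distributive tscale +%R.
Proof. by move=> a x y; rewrite -[x]treprK -[y]treprK tclassD !tscaleE tclassD scalerDr. Qed.
Fact tscaleDl x : {morph tscale^~ x : a b / a + b}.
Proof. by move=> a b; rewrite -[x]treprK !tscaleE tclassD scalerDl. Qed.

HB.instance Definition _ := GRing.Zmodule_isLmodule.Build k tens
  tscaleA tscale1 tscaleDr tscaleDl.

Fact tclass_linear : linear tclass.
Proof. by move=> a x y; rewrite -tclassD -tscaleE. Qed.

Definition word (s : seq V) : tens := tclass (gen s).

Lemma word_multilinear : multilinear word.
Proof.
move=> s t a x y; rewrite /word -tclass_linear; apply/eqP/tclassP.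
exact: tnull_lin.
Qed.

Lemma word0 : word [::] = 0.
Proof.
rewrite -tclass0.
by apply/eqP/tclassP; rewrite subr0; exact: tnull_nil.
Qed.

Section Lift.
Variables (M : lmodType k) (f : seq V -> M).

(* The linear map with [word s |-> f s] for nonempty s, provided f is
   multilinear: see [tlift_linear] and [tlift_word]. *)
Definition tlift (x : tens) : M :=
  fglift (fun s => if s is [::] then 0 else f s) (trepr x).

Hypothesis fM : multilinear f.
Let g s := if s is [::] then 0 else f s.

Let gnull x : tnull x -> fglift g x = 0.
Proof.
have L0 : fglift g (0 : free k (seq V)) = 0.
  by have := fglift_linear g (-1) 0 0; rewrite !scaleN1r oppr0 addr0 addNr.
have LZ a z : fglift g (a *: z : free k (seq V)) = a *: fglift g z.
  by rewrite -[a *: z]addr0 fglift_linear L0 addr0.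
have LD z y : fglift g (z + y : free k (seq V)) = fglift g z + fglift g y.
  by rewrite -[z]scale1r fglift_linear !scale1r.
elim=> {x} [||s t a x y|a x y _ hx _ hy] //.
- by rewrite liftU scaler0.
- rewrite -scaleN1r LD LZ fglift_linear !liftU !scale1r scaleN1r.
  have gE z : g (s ++ z :: t) = f (s ++ z :: t) by case: (s).
  by rewrite !gE fM subrr.
- by rewrite fglift_linear hx hy scaler0 addr0.
Qed.

Fact tliftC x : tlift (tclass x) = fglift g x.
Proof.
rewrite /tlift -/g; apply/eqP; rewrite -subr_eq0; apply/eqP.
have : tnull (trepr (tclass x) - x) by apply/tclassP; rewrite treprK.
by move/gnull; rewrite addrC -scaleN1r fglift_linear scaleN1r addrC.
Qed.

Lemma tlift_linear : linear tlift.
Proof.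
move=> a x y; rewrite -[x]treprK -[y]treprK -tclass_linear !tliftC.
exact: fglift_linear.
Qed.

Lemma tlift_word s : s != [::] -> tlift (word s) = f s.
Proof. by rewrite tliftC liftU scale1r /g; case: s. Qed.

End Lift.

Lemma tens_ind (P : tens -> Prop) :
  P 0 -> (forall a s x, s != [::] -> P x -> P (a *: word s + x)) -> forall x, P x.
Proof.
move=> P0 PD x; rewrite -[x]treprK.
elim/freeg_ind_dom0: (trepr x) => [|c s D _ _ IH].
  by rewrite tclass0.
have E : Freeg [:: (c, s)] = c *: gen s :> free k (seq V).
  apply/eqP/freeg_eqP => z.
  by rewrite coeffZ !coeffU mul1r.
rewrite E tclass_linear -/(word s).
case: (eqVneq s [::]) => [->|s0]; last exact: PD.
by rewrite word0 scaler0 add0r.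
Qed.
End Tensor.

(* Z-graded space V = ⊕_i V_i, with V_i = [ghom i]; [ghom_direct] says that the
   sum of the V_i is direct (the degrees of the summands may be repeated). *)
Record gspace (k : fieldType) := GSpace {
  gcar :> lmodType k;
  ghom : int -> gcar -> Prop;
  ghom_comb : forall i a x y, ghom i x -> ghom i y -> ghom i (a *: x + y);
  ghom0 : forall i, ghom i 0;
  ghom_span : forall x, exists2 s : seq (int * gcar),
    (forall p, p \in s -> ghom p.1 p.2) & x = \sum_(p <- s) p.2;
  ghom_direct : forall s : seq (int * gcar),
    (forall p, p \in s -> ghom p.1 p.2) -> \sum_(p <- s) p.2 = 0 ->
    forall i, \sum_(p <- s | p.1 == i) p.2 = 0 }.

Arguments ghom {k g} i x : simpl never.

(* Words of homogeneous elements, each letter tagged by its degree; the tags are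
   meaningful under [hwf]. *)
Notation hword V := (seq (int * gcar V)).

Section HWords.
Variables (k : fieldType) (V : gspace k).
Implicit Types (w : hword V) (s : seq V).

Definition hwf w : Prop := forall p, p \in w -> ghom p.1 p.2.
Definition deg w : int := \sum_(p <- w) p.1.
Definition vals w : seq V := map snd w.

Definition gdec (x : V) : hword V := s2val (cid2 (ghom_span x)).

Lemma gdec_wf x : hwf (gdec x).
Proof. by rewrite /gdec; case: cid2. Qed.
Lemma gdec_sum x : \sum_(p <- gdec x) p.2 = x.
Proof. by rewrite /gdec; case: cid2. Qed.

Lemma ghomD i x y : ghom i x -> ghom i y -> ghom i (x + y : V).
Proof. by move=> hx hy; rewrite -[x]scale1r; apply: ghom_comb. Qed.
Lemma ghomZ i a x : ghom i x -> ghom i (a *: x : V).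
Proof. by move=> hx; rewrite -[_ *: _]addr0; apply: ghom_comb => //; apply: ghom0. Qed.
Lemma ghom_sum i (I : Type) (r : seq I) (P : pred I) (F : I -> V) :
  (forall j, P j -> ghom i (F j)) -> ghom i (\sum_(j <- r | P j) F j).
Proof. by move=> h; elim/big_ind: _ => //; [exact: ghom0|move=> *; exact: ghomD]. Qed.

(* Multilinear extension to all sequences of a formula F given on words of
   homogeneous elements: decompose every letter into homogeneous components.
   See [hsum_multilinear] and [hsum_vals]. *)
Fixpoint hsum (M : lmodType k) (F : hword V -> M) (s : seq V) : M :=
  if s is x :: s' then \sum_(p <- gdec x) hsum (fun t => F (p :: t)) s' else F [::].

(* The linear map on T(V) given by F on words of homogeneous elements. *)
Definition tlin (M : lmodType k) (F : hword V -> M) : tens V -> M :=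
  tlift (hsum F).

Definition hmultilinear (M : lmodType k) (F : hword V -> M) : Prop :=
  forall w1 w2 i a x y, F (w1 ++ (i, a *: x + y) :: w2) =
    a *: F (w1 ++ (i, x) :: w2) + F (w1 ++ (i, y) :: w2).

Lemma hwf_cons p w : hwf (p :: w) <-> ghom p.1 p.2 /\ hwf w.
Proof.
split=> [h|[hp h] q].
  by split=> [|q hq]; apply: h; rewrite ?mem_head // inE hq orbT.
by rewrite inE => /orP[/eqP->|/h].
Qed.

Lemma hwf_cat w1 w2 : hwf (w1 ++ w2) <-> hwf w1 /\ hwf w2.
Proof.
elim: w1 => [|p w1 IH] /=; first by split=> // -[].
by rewrite !hwf_cons IH; tauto.
Qed.

Lemma deg_cat w1 w2 : deg (w1 ++ w2) = deg w1 + deg w2.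
Proof. by rewrite /deg big_cat. Qed.
Lemma deg_cons p w : deg (p :: w) = p.1 + deg w.
Proof. by rewrite /deg big_cons. Qed.

Section DecIndep.
Variables (M : lmodType k) (G : int * V -> M).
Hypothesis GL : forall i, linear (fun x => G (i, x)).

Let G0 i : G (i, 0) = 0.
Proof. by have := GL i (-1) 0 0; rewrite !scaleN1r oppr0 addr0 addNr. Qed.
Let GD i x y : G (i, x + y) = G (i, x) + G (i, y).
Proof. by rewrite -[x in LHS]scale1r GL scale1r. Qed.

Lemma dec0 w : hwf w -> \sum_(p <- w) p.2 = 0 -> \sum_(p <- w) G p = 0.
Proof.
move=> hw /(ghom_direct hw) h.
have hG i (r : hword V) : \sum_(p <- r | p.1 == i) G p = G (i, \sum_(p <- r | p.1 == i) p.2).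
  elim: r => [|p r IH]; first by rewrite !big_nil G0.
  by rewrite !big_cons; case: p => j y /=; case: eqP => // ->; rewrite GD IH.
rewrite (eq_big_seq (fun p => \sum_(i <- undup (map fst w) | i == p.1) G p)); last first.
  move=> p pw; rewrite -big_filter.
  have -> : [seq i <- undup (map fst w) | i == p.1] = [:: p.1].
    apply: perm_small_eq => //; apply: uniq_perm; rewrite ?filter_uniq ?undup_uniq //.
    move=> i; rewrite mem_filter mem_undup inE andb_idr // => /eqP ->.
    exact: map_f.
  by rewrite big_seq1.
rewrite (exchange_big_dep xpredT) //= big1 // => i _.
rewrite (eq_bigl (fun p => p.1 == i)) => [|p]; last exact: eq_sym.
by rewrite hG h G0.
Qed.

Lemma dec_sum w (x : V) : hwf w -> \sum_(p <- w) p.2 = x ->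
  \sum_(p <- gdec x) G p = \sum_(p <- w) G p.
Proof.
move=> hw hx; apply/eqP; rewrite -subr_eq0; apply/eqP.
have GN i y : G (i, - y) = - G (i, y).
  by apply/eqP; rewrite -addr_eq0 -GD addNr G0.
have -> : \sum_(p <- w) G p = - \sum_(p <- [seq (p.1, - p.2) | p <- w]) G p.
  by rewrite big_map -sumrN; apply: eq_bigr => [[i y]] _ /=; rewrite GN opprK.
rewrite opprK -big_cat; apply: dec0; last first.
  by rewrite big_cat big_map /= gdec_sum sumrN hx subrr.
apply/hwf_cat; split; first exact: gdec_wf.
move=> p /mapP[q qw ->] /=; rewrite -scaleN1r; apply: ghomZ; exact: hw.
Qed.

Lemma dec_linear : linear (fun x => \sum_(p <- gdec x) G p).
Proof.
move=> a x y /=.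
rewrite (@dec_sum ([seq (p.1, a *: p.2) | p <- gdec x] ++ gdec y)).
- rewrite big_cat big_map /=; congr (_ + _); rewrite scaler_sumr; apply: eq_bigr => p _.
  by case: p => i z /=; have := GL i a z 0; rewrite addr0 G0 addr0.
- apply/hwf_cat; split; last exact: gdec_wf.
  by move=> p /mapP[q qw ->] /=; apply: ghomZ; exact: (gdec_wf (x := x)).
- by rewrite big_cat big_map /= gdec_sum -scaler_sumr gdec_sum.
Qed.
End DecIndep.

Section HSum.
Variable M : lmodType k.
Implicit Types F : hword V -> M.

Lemma hsum_comb a F1 F2 s :
  hsum (fun w => a *: F1 w + F2 w) s = a *: hsum F1 s + hsum F2 s.
Proof.
elim: s F1 F2 => [|x s IH] F1 F2 //=.
rewrite scaler_sumr -big_split; apply: eq_bigr => p _; exact: IH.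
Qed.

Lemma eq_hsum F1 F2 s : F1 =1 F2 -> hsum F1 s = hsum F2 s.
Proof.
elim: s F1 F2 => [|x s IH] F1 F2 h //=; apply: eq_bigr => p _; exact: IH.
Qed.

Lemma hml_cons F p : hmultilinear F -> hmultilinear (fun w => F (p :: w)).
Proof. by move=> h w1 w2; apply: (h (p :: w1)). Qed.

Lemma hml_headE F s i : hmultilinear F ->
  linear (fun x => hsum (fun t => F ((i, x) :: t)) s).
Proof.
move=> h a x y; rewrite -hsum_comb; apply: eq_hsum => w; exact: (h [::]).
Qed.

Lemma hsum_multilinear F : hmultilinear F -> multilinear (hsum F).
Proof.
move=> h s; elim: s F h => [|z s IH] F h t a x y /=.
  by apply: (@dec_linear _ (fun p => hsum (fun w => F (p :: w)) t)) => i; exact: hml_headE.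
rewrite scaler_sumr -big_split; apply: eq_bigr => p _ /=.
by apply: (IH (fun w => F (p :: w))); exact: hml_cons.
Qed.

Lemma hsum_vals F w : hmultilinear F -> hwf w -> hsum F (vals w) = F w.
Proof.
elim: w F => [|[i x] w IH] F h //= /hwf_cons[/= hx hw].
rewrite (@dec_sum _ (fun p => hsum (fun w => F (p :: w)) (vals w)) _ [:: (i, x)]).
- by rewrite big_seq1 IH //; exact: hml_cons.
- by move=> j; apply: hml_headE.
- by apply/hwf_cons; split.
- by rewrite big_seq1.
Qed.

Lemma tlin_linear F : hmultilinear F -> linear (tlin F).
Proof. by move=> h; apply/tlift_linear/hsum_multilinear. Qed.

Lemma tlin_word F w : hmultilinear F -> hwf w -> w != [::] ->
  tlin F (word (vals w)) = F w.
Proof.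
move=> h hw w0; rewrite /tlin tlift_word ?hsum_vals //; first exact: hsum_multilinear.
by case: w w0 {hw}.
Qed.
End HSum.

Lemma hml_vals (M : lmodType k) (f : seq V -> M) :
  multilinear f -> hmultilinear (fun w => f (vals w)).
Proof. by move=> h w1 w2 i a x y; rewrite /vals !map_cat /= h. Qed.

Lemma mlin_sum (M : lmodType k) (f : seq V -> M) s t (I : Type) (r : seq I) (F : I -> V) :
  multilinear f -> f (s ++ (\sum_(i <- r) F i) :: t) = \sum_(i <- r) f (s ++ F i :: t).
Proof.
move=> h.
have f0 : f (s ++ 0 :: t) = 0.
  by have := h s t (-1) 0 0; rewrite !scaleN1r oppr0 addr0 addNr.
elim: r => [|i r IH]; first by rewrite !big_nil.
by rewrite !big_cons -[F i in LHS]scale1r h scale1r IH.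
Qed.

Lemma hsum_valsE (M : lmodType k) (f : seq V -> M) s :
  multilinear f -> hsum (fun w => f (vals w)) s = f s.
Proof.
elim: s f => [|x s IH] f fM //=.
rewrite (eq_bigr (fun p : int * V => f (p.2 :: s))) => [|p _]; last first.
  by apply: (IH (fun t => f (p.2 :: t))) => s0; exact: (fM (p.2 :: s0)).
by have /= <- := @mlin_sum _ f [::] s _ (gdec x) snd fM; rewrite gdec_sum.
Qed.
End HWords.

Section LinearFacts.
Variables (k : fieldType) (U V : lmodType k) (f : U -> V).
Hypothesis fL : linear f.
Lemma lin0 : f 0 = 0.
Proof. by have := fL (-1) 0 0; rewrite !scaleN1r oppr0 addr0 addNr. Qed.
Lemma linD x y : f (x + y) = f x + f y.
Proof. by rewrite -[x in LHS]scale1r fL scale1r. Qed.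
Lemma linZ a x : f (a *: x) = a *: f x.
Proof. by rewrite -[a *: x]addr0 fL lin0 addr0. Qed.
Lemma lin_sum (I : Type) (r : seq I) (P : pred I) (F : I -> U) :
  f (\sum_(i <- r | P i) F i) = \sum_(i <- r | P i) f (F i).
Proof. exact: (big_morph _ linD lin0). Qed.
End LinearFacts.

Section TensorGrading.
Variables (k : fieldType) (V : gspace k).

Definition thom (n : int) (x : tens V) : Prop :=
  exists2 ws : seq (hword V), (forall w, w \in ws -> hwf w /\ deg w = n)
    & x = \sum_(w <- ws) word (vals w).

Fact thom_comb i a x y : thom i x -> thom i y -> thom i (a *: x + y).
Proof.
move=> [ws hws ->] [vs hvs ->].
pose sc (w : hword V) := if w is p :: t then (p.1, a *: p.2) :: t else [::].
exists (map sc ws ++ vs).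
  move=> w; rewrite mem_cat => /orP[/mapP[v /hws[vwf vd] ->]|/hvs //].
  case: v vwf vd => [|p v] //= /hwf_cons[hp hv]; rewrite !deg_cons => <- /=; split=> //.
  by apply/hwf_cons; split=> //=; apply: ghomZ.
rewrite big_cat big_map /= scaler_sumr; congr (_ + _); apply: eq_bigr => w _.
case: w => [|p w] /=; first by rewrite word0 scaler0.
have := @word_multilinear _ V [::] (vals w) a p.2 0.
have := @word_multilinear _ V [::] (vals w) (-1) 0 0.
by rewrite /= !scaleN1r oppr0 addr0 addNr => ->; rewrite !addr0.
Qed.

Fact thom0 i : thom i 0.
Proof. by exists [::]; rewrite ?big_nil. Qed.

Fact thom_word w : hwf w -> thom (deg w) (word (vals w)).
Proof.
by move=> hw; exists [:: w]; rewrite ?big_seq1 // => v; rewrite inE => /eqP->.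
Qed.

Fact hsum_list (M : lmodType k) (s : seq V) : exists2 ws : seq (hword V),
  (forall w, w \in ws -> hwf w) & forall F : hword V -> M, hsum F s = \sum_(w <- ws) F w.
Proof.
elim: s => [|x s [ws hws IH]].
  by exists [:: [::]] => [w|F]; rewrite ?inE ?big_seq1 // => /eqP-> p.
exists [seq p :: w | p <- gdec x, w <- ws].
  move=> w /allpairsP[[p v] /= [hp hv ->]]; apply/hwf_cons; split; last exact: hws.
  exact: (gdec_wf (x := x)).
by move=> F /=; rewrite big_allpairs_dep; apply: eq_bigr => p _; rewrite IH.
Qed.

Fact thom_span x : exists2 s : seq (int * tens V),
  (forall p, p \in s -> thom p.1 p.2) & x = \sum_(p <- s) p.2.
Proof.
elim/tens_ind: x => [|a s x _ [r hr ->]]; first by exists [::]; rewrite ?big_nil.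
have [ws hws E] := hsum_list (tens V) s.
exists ([seq (deg w, a *: word (vals w)) | w <- ws] ++ r).
  move=> p; rewrite mem_cat => /orP[/mapP[w /hws hw ->] /=|/hr //].
  by rewrite -[_ *: _]addr0; apply: thom_comb (thom_word hw) (thom0 _).
rewrite big_cat big_map /= -scaler_sumr -E hsum_valsE //.
exact: word_multilinear.
Qed.

Fact thom_direct (s : seq (int * tens V)) :
  (forall p, p \in s -> thom p.1 p.2) -> \sum_(p <- s) p.2 = 0 ->
  forall i, \sum_(p <- s | p.1 == i) p.2 = 0.
Proof.
move=> hs s0 i.
pose F (w : hword V) : tens V := if deg w == i then word (vals w) else 0.
have FM : hmultilinear F.
  move=> w1 w2 j a x y; rewrite /F !deg_cat !deg_cons /=; case: ifP => _.
    by rewrite /vals !map_cat /= word_multilinear.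
  by rewrite scaler0 addr0.
have hF x j : thom j x -> tlin F x = if j == i then x else 0.
  case=> ws hws ->; rewrite (lin_sum (tlin_linear FM)).
  transitivity (\sum_(w <- ws) if j == i then word (vals w) else 0); last first.
    by case: ifP => // _; rewrite big1.
  apply: eq_big_seq => w /hws[hw dw]; case: (eqVneq w [::]) => [->|w0].
    by rewrite /= word0 if_same (lin0 (tlin_linear FM)).
  by rewrite tlin_word // /F dw.
have := lin0 (tlin_linear FM); rewrite -{1}s0 (lin_sum (tlin_linear FM)).
by rewrite (eq_big_seq _ (fun p ps => hF _ _ (hs p ps))) -big_mkcond.
Qed.

Definition tensor : gspace k :=
  GSpace thom_comb thom0 thom_span thom_direct.
End TensorGrading.

Section TensorOps.
Variables (k : fieldType) (V : lmodType k).

Definition tmul (x y : tens V) : tens V :=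
  tlift (fun s => tlift (fun t => word (s ++ t)) y) x.

Definition tprod (s : seq (tens V)) : tens V :=
  if s is x :: s' then foldl tmul x s' else 0.

(* T(V) without unit, so the coproduct has no terms 1 ⊗ x or x ⊗ 1. *)
Definition deconc : tens V -> tens (tens V) :=
  tlift (fun s => \sum_(1 <= i < size s) word [:: word (take i s); word (drop i s)]).

(* Projection of T^c(V) onto its cogenerators V. *)
Definition cogenpart : tens V -> V :=
  tlift (fun s => if s is [:: x] then x else 0).

Lemma word_cat_mlin (s : seq V) : multilinear (fun t => word (s ++ t)).
Proof. by move=> t1 t2 a x y; rewrite !catA word_multilinear. Qed.

Lemma tmul_mlin y : multilinear (fun s => tlift (fun t => word (s ++ t)) y : tens V).
Proof.
move=> s1 s2 a x z; elim/tens_ind: y => [|b t y t0 IH].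
  by rewrite !(lin0 (tlift_linear (@word_cat_mlin _))) scaler0 addr0.
rewrite !(tlift_linear (@word_cat_mlin _)) IH !tlift_word //; try exact: word_cat_mlin.
rewrite -!catA /= word_multilinear !scalerDr !scalerA !addrA [b * a]mulrC.
by congr (_ + _); rewrite -!addrA; congr (_ + _); rewrite addrC.
Qed.

Lemma tmul_linear_l y : linear (tmul^~ y).
Proof. exact/tlift_linear/tmul_mlin. Qed.

Lemma tmul_word s t : s != [::] -> t != [::] -> tmul (word s) (word t) = word (s ++ t).
Proof.
move=> s0 t0; rewrite /tmul tlift_word //; last exact: tmul_mlin.
by rewrite tlift_word //; exact: word_cat_mlin.
Qed.

Lemma tmul_linear_r x : linear (tmul x).
Proof.
move=> a y z; elim/tens_ind: x => [|b s x s0 IH].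
  by rewrite !(lin0 (tmul_linear_l _)) scaler0 addr0.
have E u : tmul (word s) u = tlift (fun t => word (s ++ t)) u.
  by rewrite /tmul tlift_word //; exact: tmul_mlin.
rewrite !tmul_linear_l IH !E (tlift_linear (@word_cat_mlin _)).
rewrite !scalerDr !scalerA !addrA [b * a]mulrC.
by congr (_ + _); rewrite -!addrA; congr (_ + _); rewrite addrC.
Qed.

Lemma deconc_mlin : multilinear (fun s : seq V =>
  \sum_(1 <= i < size s) word [:: word (take i s); word (drop i s)]).
Proof.
move=> s t a x y; rewrite !size_cat /= scaler_sumr -big_split.
apply: eq_bigr => i _ /=; rewrite !take_cat !drop_cat.
case: ltnP => h.
  rewrite word_multilinear.
  exact: (@word_multilinear _ _ [:: word (take i s)] [::]).
case: (i - size s)%N => [|j] /=.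
  have /= -> := @word_multilinear _ V [::] t a x y.
  exact: (@word_multilinear _ _ [:: word (s ++ [::])] [::]).
rewrite word_multilinear.
exact: (@word_multilinear _ _ [::] [:: word (drop j t)]).
Qed.

Lemma deconc_linear : linear deconc.
Proof. exact: tlift_linear deconc_mlin. Qed.

Lemma deconc_word s : deconc (word s) =
  \sum_(1 <= i < size s) word [:: word (take i s); word (drop i s)].
Proof.
case: (eqVneq s [::]) => [->|s0]; last by rewrite /deconc tlift_word //; exact: deconc_mlin.
by rewrite word0 (lin0 deconc_linear) big_nil.
Qed.

Lemma cogenpart_mlin : multilinear (fun s : seq V => if s is [:: x] then x else 0).
Proof.
by move=> s t a x y; case: s => [|z [|z1 s]]; case: t => [|z' t] //=;
  rewrite scaler0 addr0.
Qed.

Lemma cogenpart_linear : linear cogenpart.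
Proof. exact: tlift_linear cogenpart_mlin. Qed.

Lemma cogenpart_word s : cogenpart (word s) = if s is [:: x] then x else 0.
Proof.
case: (eqVneq s [::]) => [->|s0]; last by rewrite /cogenpart tlift_word //; exact: cogenpart_mlin.
by rewrite word0 (lin0 cogenpart_linear).
Qed.

End TensorOps.

Definition linear_deg (k : fieldType) (U V : gspace k) (n : int) (f : U -> V) : Prop :=
  linear f /\ forall i x, ghom i x -> ghom (i + n) (f x).

Definition multilinear_deg (k : fieldType) (U V : gspace k) (n : int)
    (f : seq U -> V) : Prop :=
  multilinear f /\ forall w : hword U, hwf w -> ghom (deg w + n) (f (vals w)).

Definition differential (k : fieldType) (M : gspace k) (dM : M -> M) : Prop :=
  linear_deg 1 dM /\ forall x, dM (dM x) = 0.

Record dg_algebra (k : fieldType) (A : gspace k) (mul : A -> A -> A) (dA : A -> A) :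
    Prop := DgAlgebra {
  dga_linl : forall y, linear (mul^~ y);
  dga_linr : forall x, linear (mul x);
  dga_deg : forall i j x y, ghom i x -> ghom j y -> ghom (i + j) (mul x y);
  dga_assoc : associative mul;
  dga_diff : differential dA;
  dga_leibniz : forall i x y, ghom i x ->
    dA (mul x y) = mul (dA x) y + (-1) ^ i *: mul x (dA y) }.

(* [sweedler Delta c s]: Delta(c) = Σ c_1 ⊗ c_2 with c_1, c_2 homogeneous, the
   pairs ((|c_1|, c_1), (|c_2|, c_2)) being listed in s.  C ⊗ C is the span of
   the two-letter words of T(C). *)
Definition sweedler (k : fieldType) (C : gspace k) (Delta : C -> tensor C) (c : C)
    (s : seq ((int * C) * (int * C))) : Prop :=
  (forall p, p \in s -> ghom p.1.1 p.1.2 /\ ghom p.2.1 p.2.2) /\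
  Delta c = \sum_(p <- s) word [:: p.1.2; p.2.2].

Record dg_coalgebra (k : fieldType) (C : gspace k) (Delta : C -> tensor C)
    (dC : C -> C) : Prop := DgCoalgebra {
  dgc_deg : linear_deg 0 Delta;
  dgc_sweedler : forall c, exists s, sweedler Delta c s;
  (* in T(C), (Delta ⊗ 1)(c_1 ⊗ c_2) is the product of Delta(c_1) and c_2 *)
  dgc_coassoc : forall c s, sweedler Delta c s ->
    \sum_(p <- s) tmul (Delta p.1.2) (word [:: p.2.2]) =
    \sum_(p <- s) tmul (word [:: p.1.2]) (Delta p.2.2);
  dgc_diff : differential dC;
  dgc_leibniz : forall c s, sweedler Delta c s ->
    Delta (dC c) = \sum_(p <- s) (word [:: dC p.1.2; p.2.2]
                                  + (-1) ^ p.1.1 *: word [:: p.1.2; dC p.2.2]) }.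

Section Bar.
Variables (k : fieldType) (B : gspace k).

(* A linear map out of T^c(B) is described below by its values F on words of
   homogeneous elements, and the operations of T^c(B) act on such F by pullback:
     [dhat d F v]    = F(D v) for the coderivation D = Σ_p \hat d_p,
     [bprod b F u v] = F(u . v) for the product of T^c(B),
     [cogen mu F v]  = F(\hat mu(v)) for the coalgebra map cogenerated by mu.
   With F = [wordh] these are the elements D v, u . v and \hat mu(v) themselves. *)
Definition wordh (w : hword B) : tensor B := word (vals w).

Definition dhat (d : seq B -> B) (M : lmodType k) (F : hword B -> M) (v : hword B) : M :=
  \sum_(0 <= i < size v) \sum_(1 <= p < (size v - i).+1)
    let blk := take p (drop i v) in
    (-1) ^ deg (take i v) *:
      F (take i v ++ (deg blk + 1, d (vals blk)) :: drop (i + p) v).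

(* The component b_p of the product: the first block takes i letters of u and j
   letters of v, and its letters of v move past the remaining letters of u. *)
Fixpoint bprodp (b : seq B -> seq B -> B) (p : nat) (M : lmodType k)
    (F : hword B -> M) (u v : hword B) : M :=
  if p is p'.+1 then
    \sum_(0 <= i < (size u).+1) \sum_(0 <= j < (size v).+1)
      let blk := (deg (take i u) + deg (take j v), b (vals (take i u)) (vals (take j v))) in
      (-1) ^ (deg (drop i u) * deg (take j v)) *:
        bprodp b p' (fun t => F (blk :: t)) (drop i u) (drop j v)
  else if nilp u && nilp v then F [::] else 0.

Definition bprod b (M : lmodType k) (F : hword B -> M) (u v : hword B) : M :=
  \sum_(1 <= p < (size u + size v).+1) bprodp b p F u v.

(* [b u v] is b_{m,n}(u; v) with m = size u and n = size v, and [d v] is d_m(v)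
   with m = size v; [d [::] = 0] since d_m is given for m > 0 only.  The axioms
   on T^c(B) are checked on words of homogeneous elements, which span it. *)
Record binf_algebra (b : seq B -> seq B -> B) (d : seq B -> B) : Prop := BinfAlgebra {
  binf_mlinl : forall v, multilinear (b^~ v);
  binf_mlinr : forall u, multilinear (b u);
  binf_deg : forall u v : hword B, hwf u -> hwf v ->
    ghom (deg u + deg v) (b (vals u) (vals v));
  binf_01 : forall x, b [::] [:: x] = x;
  binf_10 : forall x, b [:: x] [::] = x;
  binf_0n : forall v, size v != 1%N -> b [::] v = 0;
  binf_n0 : forall u, size u != 1%N -> b u [::] = 0;
  binf_d : multilinear_deg 1 d;
  binf_d0 : d [::] = 0;
  binf_dd : forall v, hwf v -> dhat d (dhat d wordh) v = 0;
  binf_assoc : forall u v w, hwf u -> hwf v -> hwf w ->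
    u != [::] -> v != [::] -> w != [::] ->
    bprod b (fun t => bprod b wordh t w) u v = bprod b (fun t => bprod b wordh u t) v w;
  binf_deriv : forall u v, hwf u -> hwf v -> u != [::] -> v != [::] ->
    bprod b (dhat d wordh) u v =
      dhat d (fun t => bprod b wordh t v) u + (-1) ^ deg u *: dhat d (fun t => bprod b wordh u t) v }.

Definition deform (b : seq B -> seq B -> B) (d : seq B -> B) (b0 : B) : seq B -> B :=
  hsum (fun s => d (vals s) + b [:: b0] (vals s)
                 + (-1) ^ (deg s + 1) *: b (vals s) [:: b0]).

(* [beta v x] is beta_{m+1}(v, x) with m = size v, and beta_1 = Id. *)
Record binf_module (b : seq B -> seq B -> B) (d : seq B -> B)
    (M : gspace k) (dM : M -> M) (beta : seq B -> M -> M) : Prop := BinfModule {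
  bmod_lin : forall v, linear (beta v);
  bmod_mlin : forall x, multilinear (beta^~ x);
  bmod_deg : forall (v : hword B) i x, hwf v -> ghom i x ->
    ghom (deg v + i) (beta (vals v) x);
  bmod_1 : forall x, beta [::] x = x;
  bmod_assoc : forall u v x, hwf u -> hwf v -> u != [::] -> v != [::] ->
    bprod b (fun t => beta (vals t) x) u v = beta (vals u) (beta (vals v) x);
  bmod_diff : forall v x, hwf v -> v != [::] ->
    dM (beta (vals v) x) =
      dhat d (fun t => beta (vals t) x) v + (-1) ^ deg v *: beta (vals v) (dM x) }.

Definition action_on_algebra b d (A : gspace k) (mul : A -> A -> A) (dA : A -> A)
    (beta : seq B -> A -> A) : Prop :=
  binf_module b d dA beta /\
  forall (v : hword B) i a1 a2, hwf v -> ghom i a1 ->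
    beta (vals v) (mul a1 a2) =
    \sum_(0 <= j < (size v).+1) (-1) ^ (i * deg (drop j v)) *:
       mul (beta (vals (take j v)) a1) (beta (vals (drop j v)) a2).

Definition action_on_coalgebra b d (C : gspace k) (Delta : C -> tensor C) (dC : C -> C)
    (beta : seq B -> C -> C) : Prop :=
  binf_module b d dC beta /\
  forall (v : hword B) c s, hwf v -> sweedler Delta c s ->
    Delta (beta (vals v) c) =
    \sum_(p <- s) \sum_(0 <= j < (size v).+1) (-1) ^ (p.1.1 * deg (drop j v)) *:
       word [:: beta (vals (take j v)) p.1.2; beta (vals (drop j v)) p.2.2].
End Bar.

Section Cogen.
Variables (k : fieldType) (B B' : gspace k).

(* The part of \hat mu with p tensor factors. *)
Fixpoint cogenp (mu : seq B -> B') (p : nat) (M : lmodType k)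
    (F : hword B' -> M) (v : hword B) : M :=
  if p is p'.+1 then
    \sum_(1 <= i < (size v).+1)
      cogenp mu p' (fun t => F ((deg (take i v), mu (vals (take i v))) :: t)) (drop i v)
  else if nilp v then F [::] else 0.

Definition cogen mu (M : lmodType k) (F : hword B' -> M) (v : hword B) : M :=
  \sum_(1 <= p < (size v).+1) cogenp mu p F v.

(* [mu v] is mu_m(v), m = size v > 0.  Compatibility of the cogenerated map with
   coproducts, units and counits is automatic. *)
Record binf_morphism (b : seq B -> seq B -> B) (d : seq B -> B)
    (b' : seq B' -> seq B' -> B') (d' : seq B' -> B') (mu : seq B -> B') : Prop :=
  BinfMorphism {
  bmor_mlin : multilinear_deg 0 mu;
  bmor_0 : mu [::] = 0;
  bmor_diff : forall v, hwf v ->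
    dhat d (cogen mu (@wordh k B')) v = cogen mu (dhat d' (@wordh k B')) v;
  bmor_mul : forall u v, hwf u -> hwf v -> u != [::] -> v != [::] ->
    bprod b (cogen mu (@wordh k B')) u v =
    cogen mu (fun s => cogen mu (fun t => bprod b' (@wordh k B') s t) v) u }.
End Cogen.

(* A family of independent subspaces of U; [gsum_space] below is the graded space
   whose underlying space is their (direct) sum inside U. *)
Record grading (k : fieldType) (U : lmodType k) := Grading {
  gr : int -> U -> Prop;
  gr_comb : forall i a x y, gr i x -> gr i y -> gr i (a *: x + y);
  gr0 : forall i, gr i 0;
  gr_direct : forall s : seq (int * U),
    (forall p, p \in s -> gr p.1 p.2) -> \sum_(p <- s) p.2 = 0 ->
    forall i, \sum_(p <- s | p.1 == i) p.2 = 0 }.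

Section DirectSum.
Variables (k : fieldType) (U : lmodType k) (G : grading U).

Definition gsum_pred : {pred U} := fun x =>
  `[< exists2 s : seq (int * U), (forall p, p \in s -> gr G p.1 p.2)
      & x = \sum_(p <- s) p.2 >].

Fact gsum_submod : submod_closed gsum_pred.
Proof.
split; first by apply/asboolP; exists [::]; rewrite ?big_nil.
move=> a x y /asboolP[s hs ->] /asboolP[r hr ->]; apply/asboolP.
exists ([seq (p.1, a *: p.2) | p <- s] ++ r).
  move=> p; rewrite mem_cat => /orP[/mapP[q /hs hq -> /=]|/hr //].
  by rewrite -[_ *: _]addr0; apply: gr_comb hq (gr0 _ _).
by rewrite big_cat big_map scaler_sumr.
Qed.

HB.instance Definition _ := GRing.isSubmodClosed.Build k U gsum_pred gsum_submod.

Definition gsum : Type := {x : U | x \in gsum_pred}.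
HB.instance Definition _ := SubChoice.on gsum.
HB.instance Definition _ := [SubChoice_isSubLmodule of gsum by <:].

Lemma gsum_homog i x : gr G i x -> x \in gsum_pred.
Proof.
by move=> h; apply/asboolP; exists [:: (i, x)]; rewrite ?big_seq1 // => p;
  rewrite inE => /eqP->.
Qed.

Definition gsum_hom (i : int) (x : gsum) : Prop := gr G i (val x).

Lemma gsum_val_sum (I : Type) (r : seq I) (P : pred I) (F : I -> gsum) :
  val (\sum_(i <- r | P i) F i) = \sum_(i <- r | P i) val (F i).
Proof. exact: (big_morph (val : gsum -> U) (fun _ _ => erefl) erefl). Qed.

Fact gsum_comb i a x y : gsum_hom i x -> gsum_hom i y -> gsum_hom i (a *: x + y).
Proof. exact: gr_comb. Qed.

Fact gsum_0 i : gsum_hom i 0.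
Proof. exact: gr0. Qed.

Fact gsum_span x : exists2 s : seq (int * gsum),
  (forall p, p \in s -> gsum_hom p.1 p.2) & x = \sum_(p <- s) p.2.
Proof.
have /asboolP[s hs E] : val x \in gsum_pred by exact: valP.
suff [r hr Er] : exists2 r : seq (int * gsum),
    (forall p, p \in r -> gsum_hom p.1 p.2) &
    \sum_(p <- s) p.2 = \sum_(p <- r) val p.2.
  by exists r => //; apply: val_inj; rewrite gsum_val_sum E -Er.
elim: s hs {E x} => [|[i y] s IH] hs; first by exists [::]; rewrite ?big_nil.
have [|r hr Er] := IH; first by move=> p ps; apply: hs; rewrite inE ps orbT.
have hy : gr G i y by apply: (hs (i, y)); rewrite mem_head.
exists ((i, exist _ y (gsum_homog hy) : gsum) :: r); last by rewrite !big_cons Er.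
by move=> p; rewrite inE => /orP[/eqP->|/hr].
Qed.

Fact gsum_direct (s : seq (int * gsum)) :
  (forall p, p \in s -> gsum_hom p.1 p.2) -> \sum_(p <- s) p.2 = 0 ->
  forall i, \sum_(p <- s | p.1 == i) p.2 = 0.
Proof.
move=> hs s0 i; apply: val_inj; rewrite gsum_val_sum.
have := @gr_direct _ _ G [seq (p.1, val p.2) | p <- s] _ _ i.
rewrite !big_map /=; apply; first by move=> p /mapP[q /hs hq ->].
by rewrite -gsum_val_sum s0.
Qed.

Definition gsum_space : gspace k :=
  GSpace gsum_comb gsum_0 gsum_span gsum_direct.
End DirectSum.

Section HomogFacts.
Variables (k : fieldType) (V : gspace k).

Lemma take_hwf n (w : hword V) : hwf w -> hwf (take n w).
Proof. by rewrite -{1}(cat_take_drop n w) => /hwf_cat[]. Qed.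
Lemma drop_hwf n (w : hword V) : hwf w -> hwf (drop n w).
Proof. by rewrite -{1}(cat_take_drop n w) => /hwf_cat[]. Qed.
Lemma deg_take_drop n (w : hword V) : deg (take n w) + deg (drop n w) = deg w.
Proof. by rewrite -deg_cat cat_take_drop. Qed.

Lemma split3 (T : Type) (A B C : seq T) i p : size A = i -> size B = p ->
  (take i (A ++ B ++ C) = A) * (take p (drop i (A ++ B ++ C)) = B) *
  (drop (i + p) (A ++ B ++ C) = C) * (take (i + p) (A ++ B ++ C) = A ++ B).
Proof.
move=> sA sB; do !split.
- exact: take_size_cat.
- by rewrite drop_size_cat // take_size_cat.
- by rewrite catA drop_size_cat // size_cat sA sB.
- by rewrite catA take_size_cat // size_cat sA sB.
Qed.

Lemma mid_cases (T : Type) (w1 w2 : seq T) i p :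
  (i + p <= size w1 + (size w2).+1)%N ->
  [\/ exists A B C, [/\ w1 = A ++ B ++ C, size A = i & size B = p],
      exists A B C D, [/\ w1 = A ++ B, w2 = C ++ D, size A = i & (size B + (size C).+1)%N = p] |
      exists A B C, [/\ w2 = A ++ B ++ C, (size w1 + (size A).+1)%N = i & size B = p]].
Proof.
move=> h; case: (leqP (i + p) (size w1)) => h1.
  apply: Or31; exists (take i w1), (take p (drop i w1)), (drop (i + p) w1).
  rewrite addnC -drop_drop !cat_take_drop !size_take_min ?size_drop; split=> //; lia.
case: (leqP i (size w1)) => h2.
  apply: Or32; exists (take i w1), (drop i w1), (take (i + p - (size w1).+1) w2),
    (drop (i + p - (size w1).+1) w2).
  rewrite !cat_take_drop !size_take_min ?size_drop; split=> //; lia.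
apply: Or33; exists (take (i - (size w1).+1) w2), 
  (take p (drop (i - (size w1).+1) w2)), (drop (p + (i - (size w1).+1)) w2).
rewrite -drop_drop !cat_take_drop !size_take_min ?size_drop; split=> //; lia.
Qed.

Lemma linear_vals0 (M : lmodType k) (f : V -> M) : linear f ->
  (forall i x, ghom i x -> f x = 0) -> forall x, f x = 0.
Proof.
move=> fL h x; rewrite -(gdec_sum x) (lin_sum fL) big_seq big1 // => p hp.
exact: h (gdec_wf hp).
Qed.

Lemma mlin_vals0 (M : lmodType k) (f : seq V -> M) : multilinear f ->
  (forall w : hword V, hwf w -> f (vals w) = 0) -> forall s, f s = 0.
Proof.
move=> fM h s; rewrite -(hsum_valsE s fM).
have [ws hws ->] := hsum_list M s.
by rewrite big_seq big1 // => w /hws; exact: h.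
Qed.

Lemma vals_cat (w1 w2 : hword V) : vals (w1 ++ w2) = vals w1 ++ vals w2.
Proof. exact: map_cat. Qed.
End HomogFacts.

Section Endo.
Variables (k : fieldType) (W : gspace k).

(* Hom(⊕_{m>0} W^{⊗m}, W)_i; the value on the empty sequence is no data. *)
Definition endo_gr (i : int) (f : seq W -> W) : Prop :=
  multilinear_deg i f /\ f [::] = 0.

Fact endo_gr_comb i a (f g : seq W -> W) :
  endo_gr i f -> endo_gr i g -> endo_gr i (a *: f + g).
Proof.
move=> [[fM fd] f0] [[gM gd] g0].
have combE s : (a *: f + g) s = a *: f s + g s by [].
split; first split.
- move=> s t b x y; rewrite !combE fM gM !scalerDr !scalerA [b * a]mulrC -!addrA.
  by congr (_ + _); rewrite addrCA.
- by move=> w hw; rewrite combE; apply: ghom_comb; [exact: fd|exact: gd].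
- by rewrite combE f0 g0 scaler0 addr0.
Qed.

Fact endo_gr0 i : endo_gr i 0.
Proof.
split=> //; split; last by move=> w _; exact: ghom0.
move=> s t a x y; rewrite -![(0 : seq W -> W) _]/(0 : W).
by rewrite scaler0 addr0.
Qed.

Fact endo_gr_direct (s : seq (int * (seq W -> W))) :
  (forall p, p \in s -> endo_gr p.1 p.2) -> \sum_(p <- s) p.2 = 0 ->
  forall i, \sum_(p <- s | p.1 == i) p.2 = 0.
Proof.
move=> hs s0 i.
have sE (P : pred (int * (seq W -> W))) w :
    (\sum_(p <- s | P p) p.2) w = \sum_(p <- s | P p) p.2 w.
  by rewrite fct_sumE.
have [iM _] : endo_gr i (\sum_(p <- s | p.1 == i) p.2).
  rewrite big_seq_cond; elim/big_ind: _ => [|f g hf hg|p /andP[/hs hp /eqP<-] //].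
    exact: endo_gr0.
  by rewrite -[f]scale1r; exact: endo_gr_comb.
apply: funext => w; apply: (mlin_vals0 (f := \sum_(p <- s | p.1 == i) p.2)) (proj1 iM) _ w.
move=> {}w hw; rewrite sE.
pose r : hword W := [seq (deg w + p.1, p.2 (vals w)) | p <- s].
have rwf p : p \in r -> ghom p.1 p.2.
  by case/mapP=> q /hs[[_ qd] _] ->; exact: qd.
have r0 : \sum_(p <- r) p.2 = 0 by rewrite big_map -(sE predT) s0.
have := ghom_direct rwf r0 (deg w + i); rewrite big_map /=.
by rewrite (eq_bigl (fun p => p.1 == i)) // => p; rewrite (inj_eq (addrI _)).
Qed.

Definition endo : gspace k :=
  gsum_space (Grading endo_gr_comb endo_gr0 endo_gr_direct).

Definition endo_fun (e : endo) : seq W -> W := sval e.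

(* F applied to (e_1, ..., e_n) inserted in this order at disjoint places of the
   word ws: e_1 is applied to the p letters following the first i ones, and
   e_2, ..., e_n to the letters further right.  The sign is that of moving each
   e_r past the letters on the left of its place. *)
Fixpoint insertion (M : lmodType k) (F : hword W -> M) (es : hword endo)
    (ws : hword W) : M :=
  if es is e :: es' then
    \sum_(0 <= i < size ws) \sum_(1 <= p < (size ws - i).+1)
      let blk := take p (drop i ws) in
      (-1) ^ (e.1 * deg (take i ws) + deg es' * deg (take (i + p) ws)) *:
        insertion (fun t => F (take i ws ++ (e.1 + deg blk, endo_fun e.2 (vals blk)) :: t))
          es' (drop (i + p) ws)
  else F ws.

Definition endo_brace_fun (e0 : endo) (es : seq endo) : seq W -> W :=
  fun ws => hsum (fun eh => hsum (fun wh =>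
    insertion (fun t => endo_fun e0 (vals t)) eh wh) ws) es.

Lemma insertion_comb (M : lmodType k) a (F1 F2 : hword W -> M) es ws :
  insertion (fun t => a *: F1 t + F2 t) es ws =
  a *: insertion F1 es ws + insertion F2 es ws.
Proof.
elim: es F1 F2 ws => [|e es IH] F1 F2 ws //=.
rewrite scaler_sumr -big_split; apply: eq_bigr => i _ /=.
rewrite scaler_sumr -big_split; apply: eq_bigr => p _ /=.
by rewrite IH scalerDr !scalerA [a * _]mulrC.
Qed.

Lemma eq_insertion (M : lmodType k) (F1 F2 : hword W -> M) es ws :
  F1 =1 F2 -> insertion F1 es ws = insertion F2 es ws.
Proof.
elim: es F1 F2 ws => [|e es IH] F1 F2 ws h //=.
by apply: eq_bigr => i _; apply: eq_bigr => p _; congr (_ *: _); apply: IH.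
Qed.

Lemma endo_fun_mlin (e : endo) : multilinear (endo_fun e).
Proof.
rewrite /endo_fun; have /asboolP[s hs ->] := valP e; rewrite big_seq.
elim/big_ind: _ => [|f g fM gM|p /hs[[]]] //.
- exact: (proj1 (proj1 (endo_gr0 0))).
- move=> s1 t a x y; rewrite -![(f + g) _]/(f _ + g _) fM gM scalerDr -!addrA.
  by congr (_ + _); rewrite addrCA.
Qed.

Lemma endo_fun_nil (e : endo) : endo_fun e [::] = 0.
Proof.
rewrite /endo_fun; have /asboolP[s hs ->] := valP e; rewrite big_seq.
elim/big_ind: _ => [|f g fM gM|p /hs[]] //.
by rewrite -[(f + g) _]/(f _ + g _) fM gM addr0.
Qed.

Lemma insertion_hml (M : lmodType k) (F : hword W -> M) es :
  hmultilinear F -> hmultilinear (insertion F es).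
Proof.
elim: es F => [|e es IH] F FM //= w1 w2 l a x y.
rewrite !size_cat /= scaler_sumr -big_split; apply: eq_big_nat => i /= hi.
rewrite scaler_sumr -big_split; apply: eq_big_nat => p /= /andP[hp0 hp].
have scl (c : k) (X Y Z : M) : X = a *: Y + Z -> c *: X = a *: (c *: Y) + c *: Z.
  by move=> ->; rewrite scalerDr !scalerA mulrC.
have pre A q : hmultilinear (fun t => F (A ++ q :: t)).
  by move=> v1 v2 j b z t; have := FM (A ++ q :: v1) v2 j b z t; rewrite -!catA.
have [] := @mid_cases _ w1 w2 i p _.
- by rewrite -ltnS; move: hp hi; lia.
- case=> A [B [C [-> sA sB]]].
  by rewrite -!catA !(split3 _ sA sB) /=; apply/scl/IH/pre.
- case=> A [B [C [D [-> -> sA sB]]]].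
  have E z : (A ++ B) ++ z :: C ++ D = A ++ (B ++ z :: C) ++ D by rewrite -!catA.
  have sB' (z : int * W) : size (B ++ z :: C) = p by rewrite size_cat /= sB.
  rewrite !E !(split3 _ sA (sB' _)) !(deg_cat, deg_cons) /=.
  apply: scl; rewrite -insertion_comb; apply: eq_insertion => t.
  by rewrite !vals_cat /= endo_fun_mlin FM.
- case=> A [B [C [-> sA sB]]].
  have E z : w1 ++ z :: A ++ B ++ C = (w1 ++ z :: A) ++ B ++ C by rewrite -!catA.
  have sA' (z : int * W) : size (w1 ++ z :: A) = i by rewrite size_cat /= sA.
  rewrite !E !(split3 _ (sA' _) sB) !(deg_cat, deg_cons) /=.
  apply: scl; rewrite -insertion_comb; apply: eq_insertion => t.
  by rewrite -!catA /= FM.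
Qed.

Lemma insertion_hml_es (M : lmodType k) (F : hword W -> M) ws :
  hmultilinear F -> hmultilinear (fun es => insertion F es ws).
Proof.
move=> FM es1; elim: es1 F ws FM => [|e es1 IH] F ws FM es2 l a x y /=.
  rewrite scaler_sumr -big_split; apply: eq_bigr => i _ /=.
  rewrite scaler_sumr -big_split; apply: eq_bigr => p _ /=.
  rewrite scalerA [a * _]mulrC -scalerA -scalerDr -insertion_comb; congr (_ *: _).
  apply: eq_insertion => t; exact: FM.
rewrite scaler_sumr -big_split; apply: eq_bigr => i _ /=.
rewrite scaler_sumr -big_split; apply: eq_bigr => p _ /=.
rewrite IH; last first.
  move=> v1 v2 j b z t; set A := take _ _; set q := (_, endo_fun _ _).
  by have := FM (A ++ q :: v1) v2 j b z t; rewrite -!catA.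
by rewrite !(deg_cat, deg_cons) /= scalerDr !scalerA [a * _]mulrC.
Qed.

Lemma insertion_deg (M : gspace k) (F : hword W -> M) c (es : hword endo) ws :
  (forall w, hwf w -> ghom (deg w + c) (F w)) -> hwf es -> hwf ws ->
  ghom (deg es + deg ws + c) (insertion F es ws).
Proof.
elim: es F c ws => [|e es IH] F c ws hF; first by rewrite /deg big_nil add0r => _; exact: hF.
move=> /hwf_cons[he hes] hws /=.
apply: ghom_sum => i _; apply: ghom_sum => p _; apply: ghomZ.
set A := take i ws; set B := take p _; set C := drop _ ws.
have hA : hwf A by exact: take_hwf.
have hB : hwf B by apply: take_hwf; exact: drop_hwf.
have E : deg A + deg B + deg C = deg ws.
  by rewrite -(deg_take_drop i ws) -/A -(deg_take_drop p (drop i ws)) drop_drop addnC addrA.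
have := IH (fun t => F (A ++ (e.1 + deg B, endo_fun e.2 (vals B)) :: t))
  (deg A + e.1 + deg B + c) C.
rewrite deg_cons.
have -> : deg es + deg C + (deg A + e.1 + deg B + c) = e.1 + deg es + deg ws + c.
  by rewrite -E; ring.
apply=> //; last exact: drop_hwf.
move=> w hw.
have -> : deg w + (deg A + e.1 + deg B + c) = deg (A ++ (e.1 + deg B, endo_fun e.2 (vals B)) :: w) + c.
  by rewrite deg_cat deg_cons /=; ring.
apply: hF; apply/hwf_cat; split=> //; apply/hwf_cons; split=> //=.
rewrite addrC; exact: (proj2 (proj1 he)).
Qed.

Definition ins_map (eh : hword endo) (f : seq W -> W) : seq W -> W :=
  hsum (fun wh => insertion (fun t => f (vals t)) eh wh).

Fact ins_map_linear eh : linear (ins_map eh).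
Proof.
move=> a f g; apply: funext => ws.
rewrite -[RHS]/(a *: ins_map eh f ws + ins_map eh g ws) -hsum_comb.
by apply: eq_hsum => wh; rewrite -insertion_comb.
Qed.

Fact ins_map_gr eh i f : hwf eh -> endo_gr i f -> endo_gr (deg eh + i) (ins_map eh f).
Proof.
move=> heh [[fM fd] f0]; have hM := insertion_hml eh (hml_vals fM).
split; first split; first exact: hsum_multilinear.
  move=> w hw; rewrite /ins_map hsum_vals //.
  rewrite addrA [deg w + _]addrC; apply: insertion_deg => // v hv; exact: fd.
by rewrite /ins_map /=; case: (eh) => [|e t] /=; rewrite ?big_geq.
Qed.

Fact endo_brace_subproof e0 es :
  endo_brace_fun e0 es \in gsum_pred (Grading endo_gr_comb endo_gr0 endo_gr_direct).
Proof.
set G := Grading _ _ _; have [ehs ehwf E] := hsum_list W es.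
have /asboolP[s hs E0] := valP e0.
have -> : endo_brace_fun e0 es = \sum_(eh <- ehs) \sum_(p <- s) ins_map eh p.2.
  apply: funext => ws; rewrite fct_sumE /endo_brace_fun E; apply: eq_bigr => eh _.
  by rewrite -(lin_sum (ins_map_linear eh)) -E0.
rewrite big_seq rpred_sum // => eh /ehwf heh; rewrite big_seq rpred_sum // => p /hs hp.
exact: (gsum_homog (G := G) (ins_map_gr heh hp)).
Qed.

(* b_{1,n}(e0; es); see [endo_braceE] for its value on homogeneous elements. *)
Definition endo_brace (e0 : endo) (es : seq endo) : endo :=
  exist _ (endo_brace_fun e0 es) (endo_brace_subproof e0 es).

Definition endo_b (u v : seq endo) : endo :=
  match u, v with
  | [::], [:: e] => e
  | [:: e], [::] => e
  | [:: e0], _ => endo_brace e0 v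
  | _, _ => 0
  end.
End Endo.

Lemma endo_braceE (k : fieldType) (W : gspace k) (e0 : endo W)
    (es : hword (endo W)) (ws : hword W) : hwf es -> hwf ws ->
  endo_fun (endo_brace e0 (vals es)) (vals ws) =
    insertion (fun t => endo_fun e0 (vals t)) es ws.
Proof.
move=> hes hws; have hM := hml_vals (endo_fun_mlin e0).
rewrite -[LHS]/(endo_brace_fun e0 (vals es) (vals ws)) /endo_brace_fun.
transitivity (hsum (fun eh => insertion (fun t => endo_fun e0 (vals t)) eh ws) (vals es)).
  by apply: eq_hsum => eh; rewrite hsum_vals //; apply: insertion_hml.
by rewrite hsum_vals //; apply: insertion_hml_es.
Qed.

Section TensorDegree.
Variables (k : fieldType) (V : gspace k).

Lemma tens_homog_ind (P : tens V -> Prop) (i : int) :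
  P 0 -> (forall x y, P x -> P y -> P (x + y)) ->
  (forall w : hword V, hwf w -> w != [::] -> deg w = i -> P (word (vals w))) ->
  forall x, thom i x -> P x.
Proof.
move=> P0 PD Pw x [ws hws ->]; rewrite big_seq; elim/big_ind: _ => // w /hws[hw dw].
by case: (eqVneq w [::]) => [->|w0]; [rewrite word0|exact: Pw].
Qed.

Lemma tmul_deg i j (x y : tens V) : thom i x -> thom j y -> thom (i + j) (tmul x y).
Proof.
move=> hx hy; move: x hx; apply: tens_homog_ind => [|x1 x2 h1 h2|w hw w0 dw].
- by rewrite (lin0 (tmul_linear_l _)); exact: thom0.
- by rewrite (linD (tmul_linear_l _)); exact: (@ghomD _ (tensor V)).
move: y hy; apply: tens_homog_ind => [|x1 x2 h1 h2|v hv v0 dv].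
- by rewrite (lin0 (tmul_linear_r _)); exact: thom0.
- by rewrite (linD (tmul_linear_r _)); exact: (@ghomD _ (tensor V)).
have nv (u : hword V) : u != [::] -> vals u != [::] by case: u.
rewrite tmul_word ?nv // -vals_cat -dw -dv -deg_cat.
by apply: thom_word; apply/hwf_cat.
Qed.

Lemma foldl_tmul_linear (s : seq (tens V)) : linear (fun x => foldl (@tmul k V) x s).
Proof. by elim: s => [|z s IH] a x y //=; rewrite tmul_linear_l IH. Qed.

Lemma tprod_mlin : multilinear (@tprod k V).
Proof.
case=> [|z s] t a x y /=; first exact: foldl_tmul_linear.
by rewrite !foldl_cat /= tmul_linear_r foldl_tmul_linear.
Qed.

Lemma tprod_deg (w : hword (tensor V)) : hwf w -> thom (deg w) (tprod (vals w)).
Proof.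
case: w => [|p w] /=; first by move=> _; exact: thom0.
rewrite deg_cons => /hwf_cons[]; case: p => i x /=.
elim: w i x => [|q w IH] i x hx; first by rewrite /deg big_nil addr0.
move=> /hwf_cons[hq hw] /=; rewrite deg_cons addrA; apply: IH => //; exact: tmul_deg.
Qed.

Lemma tlin_deg (M : gspace k) (F : hword V -> M) c i x : hmultilinear F ->
  (forall w, hwf w -> ghom (deg w + c) (F w)) -> thom i x -> ghom (i + c) (tlin F x).
Proof.
move=> FM Fd; move: x; apply: tens_homog_ind => [|x y hx hy|w hw w0 <-].
- by rewrite (lin0 (tlin_linear FM)); exact: ghom0.
- by rewrite (linD (tlin_linear FM)); exact: ghomD.
- by rewrite tlin_word //; exact: Fd.
Qed.
End TensorDegree.

Section CoEndo.
Variables (k : fieldType) (W : gspace k).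

(* Hom(W, ⊕_{m>0} W^{⊗m})_i *)
Definition coendo_gr (i : int) (f : W -> tensor W) : Prop := linear_deg i f.

Fact coendo_gr_comb i a (f g : W -> tensor W) :
  coendo_gr i f -> coendo_gr i g -> coendo_gr i (a *: f + g).
Proof.
move=> [fL fd] [gL gd].
have combE s : (a *: f + g) s = a *: f s + g s by [].
split=> [b x y|j x hx]; last by rewrite combE; apply: ghom_comb; [exact: fd|exact: gd].
rewrite !combE fL gL !scalerDr !scalerA [b * a]mulrC -!addrA.
by congr (_ + _); rewrite addrCA.
Qed.

Fact coendo_gr0 i : coendo_gr i 0.
Proof.
split=> [a x y|j x _]; last exact: ghom0.
by rewrite -![(0 : W -> tensor W) _]/(0 : tensor W) scaler0 addr0.
Qed.

Fact coendo_gr_direct (s : seq (int * (W -> tensor W))) :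
  (forall p, p \in s -> coendo_gr p.1 p.2) -> \sum_(p <- s) p.2 = 0 ->
  forall i, \sum_(p <- s | p.1 == i) p.2 = 0.
Proof.
move=> hs s0 i.
have sE (P : pred (int * (W -> tensor W))) w :
    (\sum_(p <- s | P p) p.2) w = \sum_(p <- s | P p) p.2 w.
  by rewrite fct_sumE.
have [iL _] : coendo_gr i (\sum_(p <- s | p.1 == i) p.2).
  rewrite big_seq_cond; elim/big_ind: _ => [|f g hf hg|p /andP[/hs hp /eqP<-] //].
    exact: coendo_gr0.
  by rewrite -[f]scale1r; exact: coendo_gr_comb.
apply: funext => w; apply: (linear_vals0 (f := \sum_(p <- s | p.1 == i) p.2)) iL _ w.
move=> n {}w hw; rewrite sE.
pose r : hword (tensor W) := [seq (n + p.1, p.2 w) | p <- s].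
have rwf p : p \in r -> ghom p.1 p.2.
  by case/mapP=> q /hs[_ qd] ->; exact: qd.
have r0 : \sum_(p <- r) p.2 = 0 by rewrite big_map -(sE predT) s0.
have := ghom_direct rwf r0 (n + i); rewrite big_map /=.
by rewrite (eq_bigl (fun p => p.1 == i)) // => p; rewrite (inj_eq (addrI _)).
Qed.

Definition coendo : gspace k :=
  gsum_space (Grading coendo_gr_comb coendo_gr0 coendo_gr_direct).

Definition coendo_fun (e : coendo) : W -> tensor W := sval e.

Definition letter (p : int * W) : int * tensor W := (p.1, word [:: p.2]).

(* F applied to the word (of elements of T(W)) obtained from ws by applying
   (e_1, ..., e_m) in this order to distinct letters: e_1 to the letter of index
   j and e_2, ..., e_m to letters further right, with the Koszul sign. *)
Fixpoint application (M : lmodType k) (F : hword (tensor W) -> M) (es : hword coendo)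
    (ws : hword W) : M :=
  if es is e :: es' then
    \sum_(0 <= j < size ws)
      if drop j ws is x :: ws' then
        (-1) ^ (e.1 * deg (take j ws) + deg es' * deg (take j.+1 ws)) *:
          application
            (fun t => F (map letter (take j ws) ++ (e.1 + x.1, coendo_fun e.2 x.2) :: t))
            es' ws'
      else 0
  else F (map letter ws).

Definition coendo_brace_fun (es : seq coendo) (e0 : coendo) : W -> tensor W :=
  fun x => hsum (fun eh =>
    tlin (application (fun t => tprod (vals t)) eh) (coendo_fun e0 x)) es.

Lemma coendo_fun_linear (e : coendo) : linear (coendo_fun e).
Proof.
rewrite /coendo_fun; have /asboolP[s hs ->] := valP e; rewrite big_seq.
elim/big_ind: _ => [|f g fL gL|p /hs[]] //.
- exact: (proj1 (coendo_gr0 0)).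
- move=> a x y; rewrite -![(f + g) _]/(f _ + g _) fL gL scalerDr -!addrA.
  by congr (_ + _); rewrite addrCA.
Qed.

Lemma application_comb (M : lmodType k) a (F1 F2 : hword (tensor W) -> M) es ws :
  application (fun t => a *: F1 t + F2 t) es ws =
  a *: application F1 es ws + application F2 es ws.
Proof.
elim: es F1 F2 ws => [|e es IH] F1 F2 ws //=.
rewrite scaler_sumr -big_split; apply: eq_bigr => i _ /=.
case: drop => [|x r]; first by rewrite scaler0 addr0.
by rewrite IH scalerDr !scalerA [a * _]mulrC.
Qed.

Lemma eq_application (M : lmodType k) (F1 F2 : hword (tensor W) -> M) es ws :
  F1 =1 F2 -> application F1 es ws = application F2 es ws.
Proof.
elim: es F1 F2 ws => [|e es IH] F1 F2 ws h //=.
by apply: eq_bigr => i _; case: drop => [|x r] //; congr (_ *: _); apply: IH.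
Qed.

Lemma letter_hml (M : lmodType k) (F : hword (tensor W) -> M) :
  hmultilinear F -> hmultilinear (fun w => F (map letter w)).
Proof.
move=> FM w1 w2 i a x y; rewrite !map_cat /= /letter /=.
by have /= -> := @word_multilinear _ W [::] [::] a x y; rewrite FM.
Qed.

Lemma application_hml (M : lmodType k) (F : hword (tensor W) -> M) es :
  hmultilinear F -> hmultilinear (application F es).
Proof.
elim: es F => [|e es IH] F FM; first exact: letter_hml.
move=> w1 w2 l a x y /=.
rewrite !size_cat /= scaler_sumr -big_split; apply: eq_big_nat => j /= hj.
have scl (c : k) (X Y Z : M) : X = a *: Y + Z -> c *: X = a *: (c *: Y) + c *: Z.
  by move=> ->; rewrite scalerDr !scalerA mulrC.
have pre A q : hmultilinear (fun t => F (A ++ q :: t)).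
  by move=> v1 v2 n b z t; have := FM (A ++ q :: v1) v2 n b z t; rewrite -!catA.
have spl (A : hword W) z C : size A = j -> 
    (take j (A ++ z :: C) = A) * (drop j (A ++ z :: C) = z :: C) *
    (take j.+1 (A ++ z :: C) = rcons A z).
  move=> sA; do !split; [exact: take_size_cat|exact: drop_size_cat|].
  by rewrite -cat_rcons take_size_cat // size_rcons sA.
have [] := @mid_cases _ w1 w2 j 1 _.
- by rewrite addn1.
- case=> A [B [C [E12 sA sB]]]; case: B sB E12 => [|B [|? ?]] // _ ->.
  by rewrite -!catA /= !(spl _ _ _ sA); apply/scl/IH/pre.
- case=> A [B [C [D [-> -> sA sB]]]].
  have [/size0nil -> /size0nil ->] : size B = 0%N /\ size C = 0%N by split; lia.
  rewrite cats0 !(spl _ _ _ sA) -!cats1 !(deg_cat, deg_cons) /=.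
  apply: scl; rewrite -application_comb; apply: eq_application => t.
  by rewrite coendo_fun_linear FM.
- case=> A [B [C [E12 sA sB]]]; case: B sB E12 => [|B [|? ?]] // _ ->.
  have E z : w1 ++ z :: A ++ [:: B] ++ C = (w1 ++ z :: A) ++ B :: C by rewrite -!catA.
  have sA' (z : int * W) : size (w1 ++ z :: A) = j by rewrite size_cat /= sA.
  rewrite !E !(spl _ _ _ (sA' _)) -!cats1 !(deg_cat, deg_cons) /=.
  apply: scl; rewrite -application_comb; apply: eq_application => t.
  have := letter_hml (F := fun w => F (w ++ (e.1 + B.1, coendo_fun e.2 B.2) :: t)).
  apply; move=> v1 v2 n b z u; rewrite -!catA; exact: FM.
Qed.

Lemma application_hml_es (M : lmodType k) (F : hword (tensor W) -> M) ws :
  hmultilinear F -> hmultilinear (fun es => application F es ws).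
Proof.
move=> FM es1; elim: es1 F ws FM => [|e es1 IH] F ws FM es2 l a x y /=.
  rewrite scaler_sumr -big_split; apply: eq_bigr => i _ /=.
  case: drop => [|z r]; first by rewrite scaler0 addr0.
  rewrite scalerA [a * _]mulrC -scalerA -scalerDr -application_comb; congr (_ *: _).
  apply: eq_application => t; exact: FM.
rewrite scaler_sumr -big_split; apply: eq_bigr => i _ /=.
case: drop => [|z r]; first by rewrite scaler0 addr0.
rewrite IH; last first.
  move=> v1 v2 j b x' t; set A := map _ _; set q := (_, coendo_fun _ _).
  by have := FM (A ++ q :: v1) v2 j b x' t; rewrite -!catA.
by rewrite !(deg_cat, deg_cons) /= scalerDr !scalerA [a * _]mulrC.
Qed.

Lemma letter_hwf ws : hwf ws -> hwf (map letter ws).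
Proof.
move=> h p /mapP[q /h hq ->] /=.
have := @thom_word _ W [:: q]; rewrite deg_cons /deg big_nil addr0; apply.
by apply/hwf_cons.
Qed.

Lemma letter_deg ws : deg (map letter ws) = deg ws.
Proof. by rewrite /deg big_map. Qed.

Lemma application_deg (M : gspace k) (F : hword (tensor W) -> M) c (es : hword coendo) ws :
  (forall w, hwf w -> ghom (deg w + c) (F w)) -> hwf es -> hwf ws ->
  ghom (deg es + deg ws + c) (application F es ws).
Proof.
elim: es F c ws => [|e es IH] F c ws hF.
  move=> _ hws /=; rewrite {1}/deg big_nil add0r -letter_deg; apply: hF; exact: letter_hwf.
move=> /hwf_cons[he hes] hws /=.
apply: ghom_sum => j _; case E : (drop j ws) => [|x r]; first exact: ghom0.
apply: ghomZ; set A := take j ws.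
have hA : hwf A by exact: take_hwf.
have /hwf_cons[hx hr] : hwf (x :: r) by rewrite -E; exact: drop_hwf.
have Ed : deg A + (x.1 + deg r) = deg ws by rewrite -(deg_take_drop j ws) E deg_cons.
have := IH (fun t => F (map letter A ++ (e.1 + x.1, coendo_fun e.2 x.2) :: t))
  (deg A + e.1 + x.1 + c) r.
rewrite deg_cons.
have -> : deg es + deg r + (deg A + e.1 + x.1 + c) = e.1 + deg es + deg ws + c.
  by rewrite -Ed; ring.
apply=> // w hw.
have -> : deg w + (deg A + e.1 + x.1 + c) =
    deg (map letter A ++ (e.1 + x.1, coendo_fun e.2 x.2) :: w) + c.
  by rewrite deg_cat deg_cons /= letter_deg; ring.
apply: hF; apply/hwf_cat; split; first exact: letter_hwf.
by apply/hwf_cons; split=> //=; rewrite addrC; exact: (proj2 he).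
Qed.

Definition app_map (eh : hword coendo) : tens W -> tens W :=
  tlin (application (fun t : hword (tensor W) => tprod (vals t)) eh).

Fact app_map_linear eh : linear (app_map eh).
Proof. exact/tlin_linear/application_hml/hml_vals/tprod_mlin. Qed.

Fact app_map_gr eh i (f : W -> tensor W) : hwf eh -> coendo_gr i f ->
  coendo_gr (i + deg eh) (app_map eh \o f).
Proof.
move=> heh [fL fd]; split=> [a x y|j x hx] /=; first by rewrite fL app_map_linear.
rewrite addrA; apply: (@tlin_deg _ _ (tensor W)); last exact: fd.
  exact/application_hml/hml_vals/tprod_mlin.
move=> w hw; rewrite addrC -[_ + _]addr0; apply: application_deg => // v hv.
by rewrite addr0; exact: tprod_deg.
Qed.

Fact coendo_brace_subproof es e0 :
  coendo_brace_fun es e0 \in gsum_pred (Grading coendo_gr_comb coendo_gr0 coendo_gr_direct).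
Proof.
set G := Grading _ _ _; have [ehs ehwf E] := hsum_list (tensor W) es.
have /asboolP[s hs E0] := valP e0.
have -> : coendo_brace_fun es e0 = \sum_(eh <- ehs) \sum_(p <- s) (app_map eh \o p.2).
  apply: funext => x; rewrite fct_sumE /coendo_brace_fun E; apply: eq_bigr => eh _.
  by rewrite fct_sumE /= -(lin_sum (app_map_linear eh)) /coendo_fun E0 fct_sumE.
rewrite big_seq rpred_sum // => eh /ehwf heh; rewrite big_seq rpred_sum // => p /hs hp.
exact: (gsum_homog (G := G) (app_map_gr heh hp)).
Qed.

(* b_{m,1}(es; e0); see [coendo_braceE]. *)
Definition coendo_brace (es : seq coendo) (e0 : coendo) : coendo :=
  exist _ (coendo_brace_fun es e0) (coendo_brace_subproof es e0).

Definition coendo_b (u v : seq coendo) : coendo :=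
  match u, v with
  | [::], [:: e] => e
  | [:: e], [::] => e
  | _, [:: e0] => coendo_brace u e0
  | _, _ => 0
  end.
End CoEndo.

Lemma coendo_braceE (k : fieldType) (W : gspace k) (es : hword (coendo W)) (e0 : coendo W)
    (x : W) (ws : seq (hword W)) : hwf es ->
  (forall w, w \in ws -> w != [::] /\ hwf w) ->
  coendo_fun e0 x = \sum_(w <- ws) word (vals w) ->
  coendo_fun (coendo_brace (vals es) e0) x =
    \sum_(w <- ws) application (fun t => tprod (vals t)) es w.
Proof.
move=> hes hws E; 
have pM : hmultilinear (fun t : hword (tensor W) => tprod (vals t)).
  exact: (@hml_vals _ (tensor W) _ _ (@tprod_mlin _ W)).
rewrite -[LHS]/(coendo_brace_fun (vals es) e0 x) /coendo_brace_fun E.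
transitivity (hsum (fun eh => \sum_(w <- ws)
    application (fun t : hword (tensor W) => tprod (vals t)) eh w) (vals es)).
  apply: eq_hsum => eh; rewrite (lin_sum (tlin_linear (application_hml eh pM))).
  apply: eq_big_seq => w /hws[w0 hw]; rewrite tlin_word //; exact: application_hml.
rewrite hsum_vals // => v1 v2 i a y z.
rewrite scaler_sumr -big_split; apply: eq_bigr => w _ /=.
exact: (application_hml_es w pM).
Qed.

Definition cogenerates (k : fieldType) (W : gspace k) (e0 : endo W)
    (dC : tensor W -> tensor W) : Prop :=
  forall s : seq W, endo_fun e0 s = cogenpart (dC (word s)).

Definition generates (k : fieldType) (W : gspace k) (e0 : coendo W)
    (dA : tensor W -> tensor W) : Prop :=
  forall x : W, coendo_fun e0 x = dA (word [:: x]).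

(* Main.v *)
(* An action of B on T^c(W) is a coalgebra map T^c(B) ⊗ T^c(W) -> T^c(W), so it is
   determined by its corestriction to W, which is a family of maps B^{⊗m} -> E(W);
   conversely such a family mu gives the action v . x = \hat mu(v) . x, where
   T^c(E(W)) acts on T^c(W) by insertions.  Dually, an action on T(W) is determined
   by its restriction to the generators W.  Each axiom of a module is an equality of
   two maps which are both compatible with the (co)products, hence it holds as soon
   as it holds after projection to W (restriction to W).  The axioms of a morphism
   into T^c(E(W)) are likewise equivalent to their projections to the cogenerators
   E(W), and evaluated on W these are the same identities. *)
Require Import Defs.
From mathcomp Require Import all_boot all_order all_algebra.
From mathcomp Require Import boolp classical_sets functions.
From mathcomp Require Import zify ring.

Set Implicit Arguments.
Unset Strict Implicit.
Unset Printing Implicit Defensive.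

Import GRing.Theory.
Local Open Scope classical_set_scope.
Local Open Scope ring_scope.

(** Coalgebra maps are handled by pullback: [cmap b F u v] is the value of an arbitrary F on the
    result of a cogenerated map of two arguments. The products of T^c(B) and T^c(B'), the map \hat
    mu (second argument empty) and the insertion of endomorphisms are all instances, so the
    coalgebra property [cmap_dec] is proved once and yields every recursion. Units are adjoined to
    make these recursions uniform. The axioms, however, speak of non-empty words, and T^c(W) has no
    counit; b_{0,0} = 0, mu_0 = 0 and [word [::] = 0] kill the extra terms. Projection to W suffices
    because an element of T^c(W) is determined by its cogenerator part and its reduced coproduct,
    whose factors are shorter: this is an induction on length. On T(W) it becomes induction along
    left multiplication by a letter. The Koszul signs of the module axioms are checked once, for a
    bilinear pairing [Lam] which is the tensor sign for coalgebras and the product for algebras.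
    Only the application of co-endomorphisms is not a [cmap]; there [application_cat] takes the
    place of [cmap_dec]. *)

Lemma signD (k : fieldType) (m n : int) : (-1 : k) ^ (m + n) = (-1) ^ m * (-1) ^ n.
Proof. by rewrite expfzDr // oppr_eq0 oner_eq0. Qed.

Lemma sign_even (k : fieldType) (m n q : int) : m = n + q + q -> (-1 : k) ^ m = (-1) ^ n.
Proof. by move->; rewrite !signD -mulrA -expfzMl mulrNN mulr1 exp1rz mulr1. Qed.

(** * Sums over the deconcatenations of a word *)

Section Dec.
Variables (T : Type) (M : nmodType).
Implicit Types (f g : seq T -> seq T -> M) (u : seq T).

(** Unlike in [deconc], the empty prefix and the empty suffix are included: this is the counital
    coproduct. *)
Definition dec f u : M := \sum_(0 <= i < (size u).+1) f (take i u) (drop i u).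

Lemma dec_nil f : dec f [::] = f [::] [::].
Proof. by rewrite /dec big_nat1. Qed.

Lemma dec_cons f x u : dec f (x :: u) = f [::] (x :: u) + dec (fun a => f (x :: a)) u.
Proof. by rewrite /dec big_nat_recl. Qed.

Lemma eq_dec f g u :
  (forall a c, a ++ c = u -> f a c = g a c) -> dec f u = dec g u.
Proof. by move=> h; apply: eq_bigr => i _; apply: h; rewrite cat_take_drop. Qed.

Lemma decD f g u : dec (fun a c => f a c + g a c) u = dec f u + dec g u.
Proof. exact: big_split. Qed.

Lemma dec0 u : dec (fun _ _ => 0 : M) u = 0.
Proof. exact: big1_eq. Qed.

Lemma dec_first f u : (forall x a c, f (x :: a) c = 0) -> dec f u = f [::] u.
Proof.
case: u => [|x u] h; first exact: dec_nil.
by rewrite dec_cons (eq_dec (g := fun _ _ => 0)) ?dec0 ?addr0.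
Qed.

Lemma dec_last f u : (forall a x c, f a (x :: c) = 0) -> dec f u = f u [::].
Proof.
elim: u f => [|x u IH] f h; first exact: dec_nil.
by rewrite dec_cons h add0r; apply: IH => a; exact: h.
Qed.

Lemma dec_mid f u x v : dec f (u ++ x :: v) =
  dec (fun a c => f a (c ++ x :: v)) u + dec (fun a => f (u ++ x :: a)) v.
Proof.
elim: u f => [|y u IH] f /=; first by rewrite dec_cons dec_nil.
by rewrite !dec_cons IH addrA.
Qed.

(** Coassociativity: both sides enumerate the splittings of u into three consecutive words. *)
Lemma dec_assoc (f : seq T -> seq T -> seq T -> M) u :
  dec (fun a c => dec (fun a1 a2 => f a1 a2 c) a) u =
  dec (fun a c => dec (f a) c) u.
Proof.
elim: u f => [|x u IH] f; first by rewrite !dec_nil.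
rewrite !dec_cons dec_nil -addrA; congr (_ + _).
rewrite -IH -decD; apply: eq_dec => a c _; exact: dec_cons.
Qed.
End Dec.

Lemma dec_exch (T S : Type) (M : nmodType) (f : seq T -> seq T -> seq S -> seq S -> M) u v :
  dec (fun a c => dec (f a c) v) u = dec (fun a' c' => dec (fun a c => f a c a' c') u) v.
Proof. exact: exchange_big. Qed.

Lemma dec_scale (T : Type) (k : fieldType) (M : lmodType k) z (f : seq T -> seq T -> M) u :
  z *: dec f u = dec (fun a c => z *: f a c) u.
Proof. exact: scaler_sumr. Qed.

Lemma dec_lin (T : Type) (k : fieldType) (M N : lmodType k) (g : M -> N)
    (f : seq T -> seq T -> M) u : linear g ->
  g (dec f u) = dec (fun a c => g (f a c)) u.
Proof. by move=> gL; rewrite /dec (lin_sum gL). Qed.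

(** * Coalgebra maps between cofree coalgebras *)

Section Cmap.
Variables (k : fieldType) (X Y Z : gspace k) (b : seq X -> seq Y -> Z).

Definition block (u : hword X) (v : hword Y) : int * Z :=
  (deg u + deg v, b (vals u) (vals v)).

(** n is fuel. The block taking no letter from either word is excluded, so each step shortens the
    remaining pair. The sign moves [v1] past [u2]. *)
Fixpoint cmapn n (M : lmodType k) (F : hword Z -> M) (u : hword X) (v : hword Y) : M :=
  (if nilp u && nilp v then F [::] else 0) +
  if n is n'.+1 then
    dec (fun u1 u2 => dec (fun v1 v2 =>
      if nilp u1 && nilp v1 then 0 else
        (-1) ^ (deg u2 * deg v1) *: cmapn n' (fun t => F (block u1 v1 :: t)) u2 v2) v) u
  else 0.

(* F(u . v), where . is the unital coalgebra map T^c(X) ⊗ T^c(Y) -> T^c(Z)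
   cogenerated by b; the number of tensor factors is at most size u + size v. *)
Definition cmap (M : lmodType k) (F : hword Z -> M) (u : hword X) (v : hword Y) : M :=
  cmapn (size u + size v) F u v.

Lemma cmapn_stable n m (M : lmodType k) (F : hword Z -> M) u v :
  (size u + size v <= n)%N -> (size u + size v <= m)%N -> cmapn n F u v = cmapn m F u v.
Proof.
elim: n m F u v => [|n IH] [|m] F u v //=.
- rewrite leqn0 addn_eq0 => /andP[/nilP-> /nilP->] _ /=.
  by rewrite !dec_nil addr0.
- move=> _; rewrite leqn0 addn_eq0 => /andP[/nilP-> /nilP->] /=.
  by rewrite !dec_nil addr0.
- move=> hn hm; congr (_ + _); apply: eq_dec => u1 u2 Eu; apply: eq_dec => v1 v2 Ev.
  case: ifPn => // h; congr (_ *: _).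
  have hs : (size u2 + size v2 < size u + size v)%N.
    rewrite -Eu -Ev !size_cat; move: h; rewrite /nilp; lia.
  by apply: IH; lia.
Qed.

Lemma cmap_rec (M : lmodType k) (F : hword Z -> M) u v : cmap F u v =
  (if nilp u && nilp v then F [::] else 0) +
  dec (fun u1 u2 => dec (fun v1 v2 =>
      if nilp u1 && nilp v1 then 0 else
        (-1) ^ (deg u2 * deg v1) *: cmap (fun t => F (block u1 v1 :: t)) u2 v2) v) u.
Proof.
rewrite /cmap (@cmapn_stable _ (size u + size v).+1) //=; congr (_ + _).
apply: eq_dec => u1 u2 Eu; apply: eq_dec => v1 v2 Ev.
case: ifPn => // h; congr (_ *: _).
have hs : (size u2 + size v2 < size u + size v)%N.
  rewrite -Eu -Ev !size_cat; move: h; rewrite /nilp; lia.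
by apply: cmapn_stable; lia.
Qed.

Definition homog2 := forall (u : hword X) (v : hword Y), hwf u -> hwf v ->
  ghom (deg u + deg v) (b (vals u) (vals v)).

(** The formal combination of words that u . v stands for, obtained before any F is chosen. The
    linearity of [cmap] in F, and the degree, emptiness and homogeneity of the words reaching F, are
    read off from it. *)
Lemma cmap_list u v : exists2 L : seq (k * hword Z),
  forall p, p \in L -> [/\ deg p.2 = deg u + deg v, nilp p.2 = nilp u && nilp v
     & homog2 -> hwf u -> hwf v -> hwf p.2] &
  forall (M : lmodType k) (F : hword Z -> M), cmap F u v = \sum_(p <- L) p.1 *: F p.2.
Proof.
have [n] := ubnP (size u + size v); elim: n u v => // n IH u v hn.
pose ok (p : k * hword Z) := [/\ deg p.2 = deg u + deg v, nilp p.2 = nilp u && nilp v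
     & homog2 -> hwf u -> hwf v -> hwf p.2].
(* One list has to serve all modules M at once; this is what later allows comparing F with its
   composite with a linear map into another module. *)
pose good (Phi : forall M : lmodType k, (hword Z -> M) -> M) :=
  exists2 L : seq (k * hword Z), forall p, p \in L -> ok p &
  forall (M : lmodType k) (F : hword Z -> M), Phi M F = \sum_(p <- L) p.1 *: F p.2.
have good0 : good (fun M F => 0) by exists [::] => // M F; rewrite big_nil.
have goodD P Q : good P -> good Q -> good (fun M F => P M F + Q M F).
  move=> [L hL EL] [K hK EK]; exists (L ++ K) => [p|M F].
    by rewrite mem_cat => /orP[/hL|/hK].
  by rewrite big_cat EL EK.
have good_sum (I : eqType) (r : seq I) (P : I -> forall M : lmodType k, (hword Z -> M) -> M) :
    (forall i, i \in r -> good (P i)) -> good (fun M F => \sum_(i <- r) P i M F).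
  elim: r => [|i r IHr] h.
    by case: good0 => L hL EL; exists L => // M F; rewrite big_nil; exact: EL.
  have [|L hL EL] := goodD _ _ (h i (mem_head _ _)) (IHr _).
    by move=> j jr; apply: h; rewrite inE jr orbT.
  by exists L => // M F; rewrite big_cons; exact: EL.
suff [L hL EL] : good (fun M F => (if nilp u && nilp v then F [::] else 0) +
  dec (fun u1 u2 => dec (fun v1 v2 =>
      if nilp u1 && nilp v1 then 0 else
        (-1) ^ (deg u2 * deg v1) *: cmap (fun t => F (block u1 v1 :: t)) u2 v2) v) u).
  by exists L => // M F; rewrite cmap_rec; exact: EL.
apply: goodD.
  case: (boolP (nilp u && nilp v)) => // /andP[/nilP Eu /nilP Ev]; exists [:: (1, [::])] => [p|M F].
    by rewrite inE /ok Eu Ev => /eqP->; split=> //=; rewrite /deg !big_nil.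
  by rewrite big_seq1 scale1r.
rewrite /dec; apply: (good_sum) => i _; apply: (good_sum) => j _.
set u1 := take i u; set u2 := drop i u; set v1 := take j v; set v2 := drop j v.
case: (boolP (nilp u1 && nilp v1)) => // h.
have Eu : u1 ++ u2 = u by rewrite cat_take_drop.
have Ev : v1 ++ v2 = v by rewrite cat_take_drop.
have hs : (size u2 + size v2 < n)%N.
  move: hn h; rewrite -Eu -Ev !size_cat /nilp; lia.
have [L hL EL] := IH _ _ hs.
exists [seq ((-1) ^ (deg u2 * deg v1) * p.1, block u1 v1 :: p.2) | p <- L] => [p|M F].
  case/mapP=> q /hL[dq _ hq] -> /=; split.
  - by rewrite deg_cons dq -Eu -Ev !deg_cat /=; ring.
  - rewrite -Eu -Ev /nilp !size_cat /=; move: h; rewrite /nilp; lia.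
  - rewrite -Eu -Ev => hb /hwf_cat[hu1 hu2] /hwf_cat[hv1 hv2].
    by apply/hwf_cons; split; [exact: hb|exact: hq].
by rewrite EL scaler_sumr big_map; apply: eq_bigr => p _; rewrite /= scalerA.
Qed.

Section CmapLin.
Variables (M : lmodType k).
Implicit Types (F G : hword Z -> M).

Lemma eq_cmap F G u v :
  (forall t, deg t = deg u + deg v -> nilp t = nilp u && nilp v ->
     (homog2 -> hwf u -> hwf v -> hwf t) -> F t = G t) ->
  cmap F u v = cmap G u v.
Proof.
move=> h; have [L hL EL] := cmap_list u v; rewrite !EL.
by apply: eq_big_seq => p /hL[*]; rewrite h.
Qed.

Lemma cmap_comb a F G u v :
  cmap (fun t => a *: F t + G t) u v = a *: cmap F u v + cmap G u v.
Proof.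
have [L _ EL] := cmap_list u v; rewrite !EL scaler_sumr -big_split.
by apply: eq_bigr => p _; rewrite scalerDr !scalerA mulrC.
Qed.

Lemma cmap0 u v : cmap (fun _ => 0 : M) u v = 0.
Proof. by have [L _ EL] := cmap_list u v; rewrite EL big1 // => p _; rewrite scaler0. Qed.

Lemma cmapD F G u v : cmap (fun t => F t + G t) u v = cmap F u v + cmap G u v.
Proof.
rewrite -[cmap F u v]scale1r -cmap_comb; apply: eq_cmap => t _ _ _; by rewrite scale1r.
Qed.

Lemma cmapZ a F u v : cmap (fun t => a *: F t) u v = a *: cmap F u v.
Proof.
rewrite -[RHS]addr0 -(cmap0 u v) -cmap_comb; apply: eq_cmap => t _ _ _; by rewrite addr0.
Qed.

Lemma cmap_sum (I : Type) (r : seq I) (F : I -> hword Z -> M) u v :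
  cmap (fun t => \sum_(i <- r) F i t) u v = \sum_(i <- r) cmap (F i) u v.
Proof.
have [L _ EL] := cmap_list u v; rewrite EL.
under eq_bigr do rewrite scaler_sumr.
by rewrite exchange_big /=; apply: eq_bigr => i _; rewrite EL.
Qed.

Lemma cmap_dec_out (T : Type) (F : hword Z -> seq T -> seq T -> M) (w : seq T) u v :
  cmap (fun t => dec (F t) w) u v = dec (fun a c => cmap (fun t => F t a c) u v) w.
Proof. exact: cmap_sum. Qed.

Lemma cmap_lin (N : lmodType k) (g : M -> N) F u v : linear g ->
  g (cmap F u v) = cmap (fun t => g (F t)) u v.
Proof.
move=> gL; have [L _ EL] := cmap_list u v; rewrite !EL (lin_sum gL).
by apply: eq_bigr => p _; rewrite (linZ gL).
Qed.

Lemma cmap_nil F : cmap F [::] [::] = F [::].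
Proof. by rewrite /cmap /= addr0. Qed.

Lemma cmap_eps (c : M) u v :
  cmap (fun t => if nilp t then c else 0) u v = if nilp u && nilp v then c else 0.
Proof.
have [L hL EL] := cmap_list u v; case: ifPn => h.
  by case/andP: h => /nilP-> /nilP->; rewrite cmap_nil.
by rewrite EL big_seq big1 // => p /hL[_ -> _]; rewrite (negPf h) scaler0.
Qed.

(** The projection to cogenerators gives back b: letters left over after the first block would
    produce a second letter of output. *)
Lemma cmap_cogen (X' : int * Z -> M) u v : ~~ (nilp u && nilp v) ->
  cmap (fun t => if t is [:: p] then X' p else 0) u v = X' (block u v).
Proof.
move=> h; rewrite cmap_rec (negPf h) add0r dec_last; last first.
  move=> a x c; rewrite -[RHS](dec0 _ v); apply: eq_dec => a1 c1 _; case: ifP => // _.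
  rewrite (eq_cmap (G := fun t => 0)) ?cmap0 ?scaler0 //.
  by move=> [|? ?] // _.
rewrite dec_last; last first.
  move=> a x c; case: ifP => // _.
  rewrite (eq_cmap (G := fun t => 0)) ?cmap0 ?scaler0 //.
  by move=> [|? ?] // _.
by rewrite (negPf h) cmap_nil [deg [::]]big_nil mul0r expr0z scale1r.
Qed.

End CmapLin.

(** The cogenerated map respects coproducts: a cut of the output falls between two blocks, hence
    cuts u and v simultaneously, and the sign brings the letters of [v1] in front of those of
    [u2]. *)
Lemma cmap_dec (M : lmodType k) (G : hword Z -> hword Z -> M) u v :
  cmap (fun t => dec G t) u v =
  dec (fun u1 u2 => dec (fun v1 v2 => (-1) ^ (deg u2 * deg v1) *:
    cmap (fun t1 => cmap (G t1) u2 v2) u1 v1) v) u.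
Proof.
have [n] := ubnP (size u + size v); elim: n G u v => // n IH G u v hn.
(* [R1] collects the cuts before the first block of the output, [R2] those after it; the first block
   is [(u1, v1)] and the cut of the rest comes from the induction hypothesis. *)
pose R1 := cmap (G [::]) u v.
pose R2 := dec (fun u1 u2 => dec (fun v1 v2 =>
  dec (fun a c => dec (fun a' c' => if nilp u1 && nilp v1 then 0 else
    (-1) ^ (deg u2 * deg v1) *: ((-1) ^ (deg c * deg a') *:
      cmap (fun t1 => cmap (G (block u1 v1 :: t1)) c c') a a')) v2) u2) v) u.
transitivity (R1 + R2).
  rewrite cmap_rec dec_nil /R1 cmap_rec -addrA; congr (_ + _).
  rewrite /R2 -decD; apply: eq_dec => u1 u2 Eu.
  rewrite -decD; apply: eq_dec => v1 v2 Ev.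
  case: (boolP (nilp u1 && nilp v1)) => h /=.
    by rewrite add0r (eq_dec (g := fun _ _ => 0)) ?dec0 ?addr0 // => a c _; rewrite dec0.
  have -> : cmap (fun t => dec G (block u1 v1 :: t)) u2 v2 =
     cmap (fun t => G [::] (block u1 v1 :: t)) u2 v2 +
     cmap (dec (fun t => G (block u1 v1 :: t))) u2 v2.
    by rewrite -cmapD; apply: eq_cmap => t _ _ _; exact: dec_cons.
  rewrite scalerDr; congr (_ + _); rewrite IH; last first.
    by move: hn h; rewrite -Eu -Ev !size_cat /nilp; lia.
  by rewrite dec_scale; apply: eq_dec => a c _; rewrite dec_scale.
(* Spread over all cuts of u and v, [R1] supplies exactly the empty-output term of the inner
   [cmap_rec] on the right-hand side. *)
have -> : R1 = dec (fun u1 u2 => dec (fun v1 v2 => (-1) ^ (deg u2 * deg v1) *: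
    if nilp u1 && nilp v1 then cmap (G [::]) u2 v2 else 0) v) u.
  rewrite dec_first => [|x a c]; last first.
    by rewrite -[RHS](dec0 _ v); apply: eq_dec => a' c' _; rewrite scaler0.
  rewrite dec_first => [|x a c]; last by rewrite scaler0.
  by rewrite [deg [::]]big_nil mulr0 expr0z scale1r.
(* Coassociativity in u and in v puts the final cut outermost and leaves the choice of the first
   block inside. *)
have -> : R2 = dec (fun a c => dec (fun u1 u2 => dec (fun a' c' => dec (fun v1 v2 =>
    if nilp u1 && nilp v1 then 0 else
    (-1) ^ (deg (u2 ++ c) * deg v1 + deg c * deg v2) *:
      cmap (fun t1 => cmap (G (block u1 v1 :: t1)) c c') u2 v2) a') v) a) u.
  rewrite (dec_assoc (fun u1 u2 c => dec (fun a' c' => dec (fun v1 v2 =>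
    if nilp u1 && nilp v1 then 0 else
    (-1) ^ (deg (u2 ++ c) * deg v1 + deg c * deg v2) *:
      cmap (fun t1 => cmap (G (block u1 v1 :: t1)) c c') u2 v2) a') v)).
  apply: eq_dec => u1 u' _; rewrite dec_exch; apply: eq_dec => a c Ea.
  rewrite (dec_assoc (fun v1 v2 c' =>
    if nilp u1 && nilp v1 then 0 else
    (-1) ^ (deg (a ++ c) * deg v1 + deg c * deg v2) *:
      cmap (fun t1 => cmap (G (block u1 v1 :: t1)) c c') a v2)).
  apply: eq_dec => v1 v' _; apply: eq_dec => a' c' _.
  by case: ifP => // _; rewrite scalerA -signD Ea.
rewrite -decD; apply: eq_dec => a c Ea.
rewrite dec_exch -decD; apply: eq_dec => a' c' Ea'.
rewrite [in RHS]cmap_rec scalerDr; congr (_ + _).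
rewrite dec_scale; apply: eq_dec => u1 u2 Eu; rewrite dec_scale.
apply: eq_dec => v1 v2 Ev; case: ifP => _; first by rewrite scaler0.
rewrite scalerA -signD; congr (_ *: _); congr (_ ^ _).
by rewrite -Ev !deg_cat; ring.
Qed.

End Cmap.

Lemma hml0 (k : fieldType) (X : gspace k) (M : lmodType k) (F : hword X -> M) w1 w2 i :
  hmultilinear F -> F (w1 ++ (i, 0) :: w2) = 0.
Proof. by move=> h; have := h w1 w2 i (-1) 0 0; rewrite !scaleN1r oppr0 addr0 addNr. Qed.

Lemma hml_cons_lin (k : fieldType) (X : gspace k) (M : lmodType k) (F : hword X -> M) w i :
  hmultilinear F -> linear (fun x => F ((i, x) :: w)).
Proof. by move=> h a x y; apply: (h [::]). Qed.

Lemma mlin0 (k : fieldType) (U M : lmodType k) (f : seq U -> M) s t :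
  multilinear f -> f (s ++ 0 :: t) = 0.
Proof. by move=> h; have := h s t (-1) 0 0; rewrite !scaleN1r oppr0 addr0 addNr. Qed.

Lemma dec_single (T : Type) (M : nmodType) (f : T -> seq T -> M) u :
  dec (fun a c => if a is [:: x] then f x c else 0) u = if u is x :: c then f x c else 0.
Proof.
case: u => [|x u]; first by rewrite dec_nil.
by rewrite dec_cons add0r dec_first.
Qed.

Section CmapMore.
Variables (k : fieldType) (X Y Z : gspace k) (b : seq X -> seq Y -> Z).
Variable M : lmodType k.
Implicit Types (F : hword Z -> M).

Lemma cmap_hml_l F v : (forall s, multilinear (b^~ s)) -> hmultilinear F ->
  hmultilinear (fun u => cmap b F u v).
Proof.
move=> bM FM w1 w2 i a x y; have [n] := ubnP (size w1 + size w2 + size v).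
elim: n F w1 w2 v FM => // n IH F w1 w2 v FM hn.
rewrite !cmap_rec !(_ : forall z, nilp (w1 ++ z :: w2) = false); try (by case: (w1)).
rewrite /= !add0r !dec_mid scalerDr addrACA !dec_scale -!decD.
congr (_ + _); apply: eq_dec => u1 u2 Eu; rewrite dec_scale -decD;
    apply: eq_dec => v1 v2 Ev.
  case: ifPn => h; first by rewrite scaler0 addr0.
  rewrite !(deg_cat, deg_cons) IH ?scalerDr ?scalerA 1?mulrC //; first exact: hml_cons.
  by move: hn h; rewrite -Eu -Ev !size_cat /nilp; lia.
rewrite !(_ : forall z, nilp (w1 ++ z :: u1) = false); try (by case: (w1)).
rewrite /= scalerA [a * _]mulrC -scalerA -scalerDr; congr (_ *: _).
rewrite -cmap_comb; apply: eq_cmap => t _ _ _.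
by rewrite /block !(deg_cat, deg_cons) !vals_cat /= bM (hml_cons_lin _ _ FM).
Qed.

End CmapMore.

(** The only blocks with a non-zero value consist of one letter of v, so v is rebuilt letter by
    letter. *)
Lemma cmap_unit_l (k : fieldType) (X Z : gspace k) (b : seq X -> seq Z -> Z)
    (M : lmodType k) (F : hword Z -> M) v : b [::] [::] = 0 -> (forall x, b [::] [:: x] = x) ->
  (forall s, size s != 1%N -> b [::] s = 0) -> hmultilinear F -> cmap b F [::] v = F v.
Proof.
move=> b0 b1 b2; elim: v F => [|x v IH] F FM; first exact: cmap_nil.
rewrite cmap_rec /= dec_nil add0r dec_cons add0r dec_first => [|y a c]; last first.
  rewrite /block b2 // (eq_cmap (G := fun _ => 0)) ?cmap0 ?scaler0 // => t _ _ _.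
  exact: (hml0 [::]).
rewrite /= [deg [::]]big_nil mul0r expr0z scale1r IH; last exact: hml_cons.
by rewrite /block /= b1 [deg [::]]big_nil deg_cons [deg [::]]big_nil add0r addr0; case: x.
Qed.

Lemma cmap_unit_r (k : fieldType) (Y Z : gspace k) (b : seq Z -> seq Y -> Z)
    (M : lmodType k) (F : hword Z -> M) u : b [::] [::] = 0 -> (forall x, b [:: x] [::] = x) ->
  (forall s, size s != 1%N -> b s [::] = 0) -> hmultilinear F -> cmap b F u [::] = F u.
Proof.
move=> b0 b1 b2; elim: u F => [|x u IH] F FM; first exact: cmap_nil.
rewrite cmap_rec /= dec_cons dec_nil !add0r dec_first => [|y a c]; last first.
  rewrite dec_nil /= /block b2 // (eq_cmap (G := fun _ => 0)) ?cmap0 ?scaler0 // => t _ _ _.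
  exact: (hml0 [::]).
rewrite dec_nil /= [deg [::]]big_nil mulr0 expr0z scale1r IH; last exact: hml_cons.
by rewrite /block /= b1 [deg [::]]big_nil deg_cons [deg [::]]big_nil !addr0; case: x.
Qed.

Lemma bprodp0 (k : fieldType) (B : gspace k) (b : seq B -> seq B -> B) (M : lmodType k) p u v :
  bprodp b p (fun _ => 0 : M) u v = 0.
Proof.
elim: p u v => [|p IH] u v /=; first by rewrite if_same.
by rewrite big1 // => i _; rewrite big1 // => j _; rewrite IH scaler0.
Qed.

Lemma cmap_exch (k : fieldType) (X Y Z X' Y' Z' : gspace k) (b : seq X -> seq Y -> Z)
    (b' : seq X' -> seq Y' -> Z') (M : lmodType k) (H : hword Z -> hword Z' -> M) u v u' v' :
  cmap b (fun s => cmap b' (H s) u' v') u v =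
  cmap b' (fun t => cmap b (H^~ t) u v) u' v'.
Proof.
have [L _ EL] := cmap_list b u v; rewrite EL.
rewrite (eq_cmap (G := fun t => \sum_(p <- L) p.1 *: H p.2 t)); last first.
  by move=> t _ _ _; rewrite EL.
by rewrite cmap_sum; apply: eq_bigr => p _; rewrite cmapZ.
Qed.

(** [bprod] sums over the number of blocks and lets blocks be empty. An empty block contributes the
    letter b_{0,0} = 0, which a multilinear F annihilates. *)
Lemma bprodE (k : fieldType) (B : gspace k) (b : seq B -> seq B -> B) (M : lmodType k)
    (F : hword B -> M) u v : b [::] [::] = 0 -> hmultilinear F ->
  ~~ (nilp u && nilp v) -> bprod b F u v = cmap b F u v.
Proof.
move=> b0 FM h.
(* The term p = 0 is added, which is zero for u, v not both empty but is needed in the induction,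
   where the remaining words may both be empty; a free upper bound N leaves room for the block taken
   off. *)
suff E N : (size u + size v <= N)%N ->
    \sum_(0 <= p < N.+1) bprodp b p F u v = cmap b F u v.
  by rewrite -(E _ (leqnn _)) /bprod [in RHS]big_ltn //= (negPf h) add0r.
elim: N F u v FM {h} => [|N IH] F u v FM hN.
  rewrite big_nat1; move: hN; rewrite leqn0 addn_eq0 => /andP[/nilP-> /nilP->].
  by rewrite cmap_nil.
rewrite big_nat_recl // cmap_rec /=; congr (_ + _).
rewrite exchange_big; apply: eq_big_nat => i /= hi.
rewrite exchange_big; apply: eq_big_nat => j /= hj.
rewrite -scaler_sumr; case: ifPn => [/andP[/nilP-> /nilP->]|h].
  rewrite big1 ?scaler0 // => p _; rewrite -[RHS](bprodp0 b M p (drop i u) (drop j v)).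
  congr bprodp; apply: funext => t; rewrite b0; exact: (hml0 [::]).
congr (_ *: _); apply: IH; first exact: hml_cons.
move: hN h; rewrite -{1}(cat_take_drop i u) -{1}(cat_take_drop j v) !size_cat /nilp; lia.
Qed.

(** * Coalgebra maps of one argument *)

Section Cmap1.
Variables (k : fieldType) (B B' : gspace k) (mu : seq B -> B').

(* Families of maps of one argument, fed to cmap with an empty second word. *)
Definition unary (u w : seq B) : B' := if nilp w then mu u else 0.

(* F(\hat mu(v)), for the counital coalgebra map cogenerated by mu *)
Definition cmap1 (M : lmodType k) (F : hword B' -> M) (v : hword B) : M :=
  cmap unary F v [::].

Variable M : lmodType k.
Implicit Types (F G : hword B' -> M).

Let blockE v : block unary v ([::] : hword B) = (deg v, mu (vals v)).
Proof. by rewrite /block [deg [::]]big_nil addr0. Qed.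

Lemma cmap1_rec F v : cmap1 F v = (if nilp v then F [::] else 0) +
  dec (fun v1 v2 => if nilp v1 then 0 else
    cmap1 (fun t => F ((deg v1, mu (vals v1)) :: t)) v2) v.
Proof.
rewrite /cmap1 cmap_rec andbT; congr (_ + _); apply: eq_dec => v1 v2 _.
by rewrite dec_nil /= andbT blockE [deg [::]]big_nil mulr0 expr0z scale1r.
Qed.

Lemma cmap1_dec (G : hword B' -> hword B' -> M) v :
  cmap1 (dec G) v = dec (fun v1 v2 => cmap1 (fun t1 => cmap1 (G t1) v2) v1) v.
Proof.
rewrite /cmap1 cmap_dec; apply: eq_dec => v1 v2 _.
by rewrite dec_nil [deg [::]]big_nil mulr0 expr0z scale1r.
Qed.

Lemma cmap1_cogen (f : int * B' -> M) v : v != [::] ->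
  cmap1 (fun t => if t is [:: p] then f p else 0) v = f (deg v, mu (vals v)).
Proof. by move=> h; rewrite /cmap1 cmap_cogen ?blockE // andbT; case: v h. Qed.

Lemma eq_cmap1 F G v :
  (forall t, deg t = deg v -> nilp t = nilp v ->
     (multilinear_deg 0 mu -> hwf v -> hwf t) -> F t = G t) ->
  cmap1 F v = cmap1 G v.
Proof.
move=> h; apply: eq_cmap => t dt nt ht; apply: h => [||[_ mD] hv].
- by rewrite dt [X in _ + X]big_nil addr0.
- by rewrite nt andbT.
- apply: ht => // u [|p w] hu hw; last exact: ghom0.
  by have := mD _ hu; rewrite [deg [::]]big_nil.
Qed.

End Cmap1.

Section Cmap1More.
Variables (k : fieldType) (B B' : gspace k) (mu : seq B -> B').
Hypotheses (muM : multilinear mu) (mu0 : mu [::] = 0).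
Variable M : lmodType k.
Implicit Types (F : hword B' -> M).

Lemma cmap1_nil F : cmap1 mu F [::] = F [::].
Proof. exact: cmap_nil. Qed.

Lemma cmap1_comb a F G v :
  cmap1 mu (fun t => a *: F t + G t) v = a *: cmap1 mu F v + cmap1 mu G v.
Proof. exact: cmap_comb. Qed.

Lemma cmap1_lin (N : lmodType k) (g : M -> N) F v : linear g ->
  g (cmap1 mu F v) = cmap1 mu (fun t => g (F t)) v.
Proof. exact: cmap_lin. Qed.

Lemma cmap1_0 v : cmap1 mu (fun _ => 0 : M) v = 0.
Proof. exact: cmap0. Qed.

Lemma cmap1_hml F : hmultilinear F -> hmultilinear (cmap1 mu F).
Proof.
move=> FM; apply: cmap_hml_l => // w s t a x y.
by rewrite /unary; case: ifP => _; [exact: muM|rewrite scaler0 addr0].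
Qed.

Lemma cmap1_recF F v : hmultilinear F -> cmap1 mu F v = (if nilp v then F [::] else 0) +
  dec (fun v1 => cmap1 mu (fun t => F ((deg v1, mu (vals v1)) :: t))) v.
Proof.
move=> FM; rewrite cmap1_rec; congr (_ + _); apply: eq_dec => v1 v2 _.
case: ifP => // /nilP->; rewrite /= mu0 -[LHS](cmap1_0 v2).
by apply: eq_cmap1 => t _ _ _; rewrite (hml0 [::]).
Qed.

Lemma cogenE F (v : hword B) : v != [::] -> cogen mu F v = cmap1 mu F v.
Proof.
move=> h; have nv : nilp v = false by case: v h.
suff E N : (size v <= N)%N -> \sum_(0 <= p < N.+1) cogenp mu p F v = cmap1 mu F v.
  by rewrite -(E _ (leqnn _)) /cogen [in RHS]big_ltn //= nv add0r.
elim: N F v {h nv} => [|N IH] F v hN.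
  by rewrite big_nat1; move: hN; rewrite leqn0 => /nilP->; rewrite cmap1_nil.
rewrite big_nat_recl // cmap1_rec /=; congr (_ + _).
rewrite exchange_big /dec /= [in RHS]big_ltn //= take0 /= add0r.
apply: eq_big_nat => i /andP[i0]; rewrite ltnS => hi.
have -> : nilp (take i v) = false by rewrite /nilp size_take_min; lia.
by apply: IH; rewrite size_drop; lia.
Qed.

End Cmap1More.

(** * Coderivations of the cofree coalgebra *)

Section Codiff.
Variables (k : fieldType) (B : gspace k) (d : seq B -> B).

(** The first letter either opens the block contracted by d or stays in front at the cost of a sign.
    This recursive form of [dhat] suits induction on words. *)
Fixpoint codiff (M : lmodType k) (F : hword B -> M) (v : hword B) : M :=
  if v is x :: v' then
    dec (fun a c => F ((deg (x :: a) + 1, d (vals (x :: a))) :: c)) v' +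
    (-1) ^ x.1 *: codiff (fun t => F (x :: t)) v'
  else 0.

Lemma dhatE (M : lmodType k) (F : hword B -> M) v : dhat d F v = codiff F v.
Proof.
elim: v F => [|x v IH] F; first by rewrite /dhat big_geq.
rewrite /= -IH /dhat /= big_nat_recl //=; congr (_ + _).
  rewrite big_add1 /=; apply: eq_bigr => i _.
  by rewrite [deg [::]]big_nil expr0z scale1r.
rewrite scaler_sumr; apply: eq_bigr => i _ /=.
by rewrite subSS scaler_sumr; apply: eq_bigr => p _; rewrite deg_cons signD scalerA.
Qed.

Lemma codiff_list v : exists2 L : seq (k * hword B),
  forall p, p \in L -> [/\ deg p.2 = deg v + 1, p.2 != [::]
     & multilinear_deg 1 d -> hwf v -> hwf p.2] &
  forall (M : lmodType k) (F : hword B -> M), codiff F v = \sum_(p <- L) p.1 *: F p.2.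
Proof.
elim: v => [|x v [L hL EL]]; first by exists [::] => // M F; rewrite big_nil.
exists ([seq (1, (deg (x :: take i v) + 1, d (vals (x :: take i v))) :: drop i v)
          | i <- index_iota 0 (size v).+1] ++
        [seq ((-1) ^ x.1 * p.1, x :: p.2) | p <- L]) => [p|M F].
  rewrite mem_cat => /orP[/mapP[i _ ->]|/mapP[q /hL[dq _ hq] ->]] /=; split=> //.
  - by rewrite !deg_cons -(deg_take_drop i v) /=; ring.
  - move=> dM /hwf_cons[hx hv]; apply/hwf_cons; split; last exact: drop_hwf.
    have := proj2 dM (x :: take i v); apply; apply/hwf_cons; split=> //.
    exact: take_hwf.
  - by rewrite !deg_cons dq /=; ring.
  - by move=> dM /hwf_cons[hx hv]; apply/hwf_cons; split=> //; exact: hq.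
rewrite big_cat !big_map /= EL scaler_sumr; congr (_ + _); apply: eq_bigr => i _.
  by rewrite scale1r.
by rewrite scalerA.
Qed.

Variable M : lmodType k.
Implicit Types (F G : hword B -> M).

Lemma eq_codiff F G v :
  (forall t, deg t = deg v + 1 -> t != [::] ->
     (multilinear_deg 1 d -> hwf v -> hwf t) -> F t = G t) ->
  codiff F v = codiff G v.
Proof.
move=> h; have [L hL EL] := codiff_list v; rewrite !EL.
by apply: eq_big_seq => p /hL[*]; rewrite h.
Qed.

Lemma codiff_lin (N : lmodType k) (g : M -> N) F v : linear g ->
  g (codiff F v) = codiff (fun t => g (F t)) v.
Proof.
move=> gL; have [L _ EL] := codiff_list v; rewrite !EL (lin_sum gL).
by apply: eq_bigr => p _; rewrite (linZ gL).
Qed.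

Lemma codiff_comb a F G v :
  codiff (fun t => a *: F t + G t) v = a *: codiff F v + codiff G v.
Proof.
have [L _ EL] := codiff_list v; rewrite !EL scaler_sumr -big_split.
by apply: eq_bigr => p _; rewrite scalerDr !scalerA mulrC.
Qed.

Lemma codiff0 v : codiff (fun _ => 0 : M) v = 0.
Proof. by have [L _ EL] := codiff_list v; rewrite EL big1 // => p _; rewrite scaler0. Qed.

Lemma codiffD F G v : codiff (fun t => F t + G t) v = codiff F v + codiff G v.
Proof.
rewrite -[codiff F v]scale1r -codiff_comb; apply: eq_codiff => t _ _ _; by rewrite scale1r.
Qed.

Lemma codiffZ a F v : codiff (fun t => a *: F t) v = a *: codiff F v.
Proof.
rewrite -[RHS]addr0 -(codiff0 v) -codiff_comb; apply: eq_codiff => t _ _ _; by rewrite addr0.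
Qed.

Lemma codiff_sum (I : Type) (r : seq I) (F : I -> hword B -> M) v :
  codiff (fun t => \sum_(i <- r) F i t) v = \sum_(i <- r) codiff (F i) v.
Proof.
elim: r => [|i r IH].
  by rewrite big_nil -[RHS](codiff0 v); apply: eq_codiff => t _ _ _; rewrite big_nil.
by rewrite big_cons -IH -codiffD; apply: eq_codiff => t _ _ _; rewrite big_cons.
Qed.

Lemma codiff_cogen (f : int * B -> M) v : v != [::] ->
  codiff (fun t => if t is [:: p] then f p else 0) v = f (deg v + 1, d (vals v)).
Proof.
case: v => [|x v] // _ /=; rewrite dec_last //.
rewrite (eq_codiff (G := fun _ => 0)) ?codiff0 ?scaler0 ?addr0 //.
by case.
Qed.

(** The coderivation property: the contracted letter of the output lies on one side of the cut, and
    passing to the right side means passing [v1]. *)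
Lemma codiff_dec (G : hword B -> hword B -> M) v :
  codiff (dec G) v =
  dec (fun v1 v2 => codiff (G^~ v2) v1 + (-1) ^ deg v1 *: codiff (G v1) v2) v.
Proof.
elim: v G => [|x v IH] G; first by rewrite dec_nil /= scaler0 addr0.
rewrite dec_cons /= add0r [deg [::]]big_nil expr0z scale1r.
rewrite (eq_dec (g := fun a c => G [::] ((deg (x :: a) + 1, d (vals (x :: a))) :: c) +
   dec (fun c1 => G ((deg (x :: a) + 1, d (vals (x :: a))) :: c1)) c)); last first.
  by move=> a c _; rewrite dec_cons.
rewrite decD -!addrA; congr (_ + _).
rewrite (eq_codiff (G := fun t => G [::] (x :: t) + dec (fun a => G (x :: a)) t)); last first.
  by move=> t _ _ _; rewrite dec_cons.
rewrite codiffD scalerDr addrCA; congr (_ + _).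
rewrite IH dec_scale.
rewrite -(dec_assoc (fun a c1 c =>
  G ((deg (x :: a) + 1, d (vals (x :: a))) :: c1) c)) -decD.
apply: eq_dec => a c _; rewrite scalerDr addrA; congr (_ + _).
by rewrite scalerA -signD deg_cons.
Qed.

Lemma codiff_rec (F : hword B -> M) v : d [::] = 0 -> hmultilinear F ->
  codiff F v = dec (fun v1 v2 => F ((deg v1 + 1, d (vals v1)) :: v2)) v +
    (if v is x :: v' then (-1) ^ x.1 *: codiff (fun t => F (x :: t)) v' else 0).
Proof.
move=> d0 FM; case: v => [|x v]; first by rewrite dec_nil /= d0 (hml0 [::]) ?addr0.
by rewrite dec_cons /= d0 (hml0 [::]) ?add0r.
Qed.

End Codiff.

(** * Morphisms are detected on cogenerators *)

Definition cletter (k : fieldType) (B : gspace k) (t : hword B) : B :=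
  if t is [:: p] then p.2 else 0.

Lemma wordh_hml (k : fieldType) (B : gspace k) : hmultilinear (@wordh k B).
Proof. exact: (hml_vals (@word_multilinear k B)). Qed.

Lemma cogenpart_wordh (k : fieldType) (B : gspace k) (t : hword B) :
  cogenpart (wordh t) = cletter t.
Proof. by rewrite /wordh cogenpart_word; case: t => [|p [|q t]]. Qed.

Section Morphism.
Variables (k : fieldType) (B B' : gspace k) (mu : seq B -> B').
Hypotheses (muM : multilinear mu) (mu0 : mu [::] = 0).
Local Notation hmu := (fun v : hword B => mu (vals v)).

Lemma cmap1_cletter v : cmap1 mu (@cletter k B') v = mu (vals v).
Proof.
case: (eqVneq v [::]) => [->|h]; first by rewrite cmap1_nil mu0.
by rewrite (cmap1_cogen mu (fun p => p.2)).
Qed.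

Lemma cogen_wordh : cogen mu (@wordh k B') = cmap1 mu (@wordh k B').
Proof.
apply: funext => v; case: (eqVneq v [::]) => [->|h]; last exact: cogenE.
by rewrite cmap1_nil /cogen big_geq // /wordh word0.
Qed.

Lemma cogenpart_cmap1 v : cogenpart (cmap1 mu (@wordh k B') v) = mu (vals v).
Proof.
rewrite (cmap1_lin _ _ _ (@cogenpart_linear k B')) -cmap1_cletter.
apply: eq_cmap1 => t _ _ _; exact: cogenpart_wordh.
Qed.

Section Differential.
Variables (d : seq B -> B) (d' : seq B' -> B').
Hypotheses (d'0 : d' [::] = 0).

(** This and [cmap1_codiff_rec] unfold the two composites of \hat mu with the coderivations along
    one and the same recursion. They differ only in the coefficient put in the first output letter,
    which is the projection to cogenerators. *)
Lemma codiff_cmap1_rec (M : lmodType k) (F : hword B' -> M) v : hmultilinear F ->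
  codiff d (cmap1 mu F) v = dec (fun v1 v2 =>
     cmap1 mu (fun r => F ((deg v1 + 1, codiff d hmu v1) :: r)) v2 +
     (-1) ^ deg v1 *: codiff d (cmap1 mu (fun r => F ((deg v1, mu (vals v1)) :: r))) v2) v.
Proof.
move=> FM; rewrite (eq_codiff (G := dec (fun t1 =>
    cmap1 mu (fun r => F ((deg t1, mu (vals t1)) :: r))))); last first.
  by move=> [|p t] // _ _ _; rewrite cmap1_recF // add0r.
rewrite codiff_dec; apply: eq_dec => v1 v2 _; congr (_ + _).
have gL n : linear (fun x => cmap1 mu (fun r => F ((n, x) :: r)) v2).
  move=> a x y; rewrite -cmap1_comb; apply: eq_cmap1 => t _ _ _; exact: hml_cons_lin.
rewrite (codiff_lin _ _ _ (gL _)); apply: eq_codiff => t dt _ _; by rewrite dt.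
Qed.

Lemma cmap1_codiff_rec (M : lmodType k) (F : hword B' -> M) v : hmultilinear F ->
  cmap1 mu (codiff d' F) v = dec (fun v1 v2 =>
     cmap1 mu (fun r => F ((deg v1 + 1, cmap1 mu (fun t => d' (vals t)) v1) :: r)) v2 +
     (-1) ^ deg v1 *: cmap1 mu (codiff d' (fun r => F ((deg v1, mu (vals v1)) :: r))) v2) v.
Proof.
move=> FM; rewrite (eq_cmap1 (G := dec (fun t1 t2 => F ((deg t1 + 1, d' (vals t1)) :: t2) +
   if t1 is [:: p] then (-1) ^ p.1 *: codiff d' (fun r => F (p :: r)) t2 else 0))); last first.
  by move=> t _ _ _; rewrite decD dec_single codiff_rec.
rewrite cmap1_dec; apply: eq_dec => v1 v2 _.
rewrite (eq_cmap1 (G := fun t1 => cmap1 mu (fun t2 => F ((deg t1 + 1, d' (vals t1)) :: t2)) v2 +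
   (if t1 is [:: p] then cmap1 mu
     (fun t2 => (-1) ^ p.1 *: codiff d' (fun r => F (p :: r)) t2) v2 else 0))); last first.
  move=> t1 _ _ _; rewrite /cmap1 cmapD; congr (_ + _).
  by case: t1 => [|p [|q t1]]; rewrite ?cmap0.
rewrite [LHS]cmapD -!/(cmap1 _ _ _); congr (_ + _).
  have gL n : linear (fun x => cmap1 mu (fun r => F ((n, x) :: r)) v2).
    move=> a x y; rewrite -cmap1_comb; apply: eq_cmap1 => t _ _ _; exact: hml_cons_lin.
  rewrite (cmap1_lin _ _ _ (gL _)); apply: eq_cmap1 => t dt _ _; by rewrite dt.
case: (eqVneq v1 [::]) => [->|h].
  rewrite cmap1_nil mu0 (eq_cmap1 (G := fun _ => 0)) ?cmap1_0 ?scaler0 // => t _ _ _.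
  by rewrite -[RHS](codiff0 d' M t); apply: eq_codiff => r _ _ _; rewrite (hml0 [::]).
rewrite (cmap1_cogen mu (fun p => cmap1 mu
     (fun t2 => (-1) ^ p.1 *: codiff d' (fun r => F (p :: r)) t2) v2)) //=.
exact: cmapZ.
Qed.

Lemma cmap1_codiff (M : lmodType k) (F : hword B' -> M) v : hmultilinear F -> hwf v ->
  (forall v, hwf v -> v != [::] -> codiff d hmu v = cmap1 mu (fun t => d' (vals t)) v) ->
  codiff d (cmap1 mu F) v = cmap1 mu (codiff d' F) v.
Proof.
move=> FM hv E; have [n] := ubnP (size v); elim: n F v FM hv => // n IH F v FM hv hn.
rewrite codiff_cmap1_rec // cmap1_codiff_rec //; apply: eq_dec => v1 v2 Ev.
case: (eqVneq v1 [::]) Ev => [->|h] Ev.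
  rewrite cmap1_nil d'0 mu0; congr (_ + _ *: _).
  have F0 r : F ((deg ([::] : hword B), 0) :: r) = 0 by exact: (hml0 [::]).
  rewrite (eq_codiff (G := fun _ => 0)) ?codiff0.
    rewrite (eq_cmap1 (G := fun _ => 0)) ?cmap1_0 // => t _ _ _.
    by rewrite -[RHS](codiff0 d' M t); apply: eq_codiff => r _ _ _; rewrite F0.
  by move=> t _ _ _; rewrite -[RHS](cmap1_0 mu M t); apply: eq_cmap1 => r _ _ _; rewrite F0.
have /hwf_cat[hv1 hv2] : hwf (v1 ++ v2) by rewrite Ev.
rewrite E // IH //; first exact: hml_cons.
by move: hn h; rewrite -Ev size_cat; case: (v1) => //= *; lia.
Qed.

Lemma bmor_diffP :
  (forall v, hwf v ->
    dhat d (cogen mu (@wordh k B')) v = cogen mu (dhat d' (@wordh k B')) v) <->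
  (forall v, hwf v -> v != [::] -> codiff d hmu v = cmap1 mu (fun t => d' (vals t)) v).
Proof.
have dE : dhat d' (@wordh k B') = codiff d' (@wordh k B').
  by apply: funext => t; rewrite dhatE.
split=> [h v hv v0|h v hv]; rewrite ?cogen_wordh ?dhatE ?dE.
  have := h v hv; rewrite cogen_wordh dhatE dE cogenE // => /(congr1 (@cogenpart k B')).
  rewrite (codiff_lin _ _ _ (@cogenpart_linear k B')).
  rewrite (cmap1_lin _ _ _ (@cogenpart_linear k B')).
  rewrite (eq_codiff (G := hmu)) => [->|t _ _ _]; last exact: cogenpart_cmap1.
  apply: eq_cmap1 => t _ nt _; rewrite (codiff_lin _ _ _ (@cogenpart_linear k B')).
  rewrite (eq_codiff (G := @cletter k B')) => [|r _ _ _]; last exact: cogenpart_wordh.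
  by rewrite (codiff_cogen d' (fun p => p.2)) //; case: (t) nt v0; case: (v).
case: (eqVneq v [::]) => [->|v0]; first by rewrite /cogen big_geq.
rewrite cogenE //; apply: cmap1_codiff => //; exact: wordh_hml.
Qed.

End Differential.

Section Product.
Variables (b : seq B -> seq B -> B) (b' : seq B' -> seq B' -> B').
Definition unital (X : gspace k) (c : seq X -> seq X -> X) :=
  [/\ c [::] [::] = 0, (forall x, c [::] [:: x] = x), (forall x, c [:: x] [::] = x),
      (forall s, size s != 1%N -> c [::] s = 0) & (forall s, size s != 1%N -> c s [::] = 0)].
Hypotheses (bU : unital b) (b'U : unital b').

(** The cogenerator component of the product of \hat mu(u) and \hat mu(v). *)
Definition cmap11 u v := cmap1 mu (fun s => cmap1 mu (fun t => b' (vals s) (vals t)) v) u.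

Lemma cmap_recF (X Y Z : gspace k) (c : seq X -> seq Y -> Z) (M : lmodType k)
    (F : hword Z -> M) u v :
  c [::] [::] = 0 -> hmultilinear F ->
  cmap c F u v = (if nilp u && nilp v then F [::] else 0) +
    dec (fun u1 u2 => dec (fun v1 v2 => (-1) ^ (deg u2 * deg v1) *:
        cmap c (fun t => F (block c u1 v1 :: t)) u2 v2) v) u.
Proof.
move=> c0 FM; rewrite cmap_rec; congr (_ + _).
apply: eq_dec => u1 u2 _; apply: eq_dec => v1 v2 _.
case: ifP => // /andP[/nilP-> /nilP->].
rewrite (eq_cmap (G := fun _ => 0)) ?cmap0 ?scaler0 // => t _ _ _.
by rewrite /block c0 (hml0 [::]).
Qed.

Lemma cmap_cmap1_rec (M : lmodType k) (F : hword B' -> M) u v : hmultilinear F ->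
  cmap b (cmap1 mu F) u v = (if nilp u && nilp v then F [::] else 0) +
    dec (fun u1 u2 => dec (fun v1 v2 => (-1) ^ (deg u2 * deg v1) *:
      cmap b (cmap1 mu (fun r => F ((deg u1 + deg v1, cmap b hmu u1 v1) :: r))) u2 v2) v) u.
Proof.
move=> FM; rewrite (eq_cmap (G := fun t => (if nilp t then F [::] else 0) + dec (fun t1 =>
    cmap1 mu (fun r => F ((deg t1, mu (vals t1)) :: r))) t)); last first.
  by move=> t _ _ _; exact: cmap1_recF.
rewrite cmapD cmap_eps cmap_dec; congr (_ + _).
apply: eq_dec => u1 u2 _; apply: eq_dec => v1 v2 _; congr (_ *: _).
have gL n : linear (fun x => cmap b (cmap1 mu (fun r => F ((n, x) :: r))) u2 v2).
  move=> a x y; rewrite -cmap_comb; apply: eq_cmap => t _ _ _.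
  by rewrite -cmap1_comb; apply: eq_cmap1 => r _ _ _; exact: hml_cons_lin.
rewrite (cmap_lin _ _ _ _ (gL _)); apply: eq_cmap => t dt _ _; by rewrite dt.
Qed.

(** The same recursion as in [cmap_cmap1_rec], with [cmap11] as coefficient: splitting off the first
    letter of the product of \hat mu(u) and \hat mu(v) cuts both factors, and \hat mu turns these
    cuts into cuts of u and v. *)
Lemma cmap1_cmap_rec (M : lmodType k) (F : hword B' -> M) u v : hmultilinear F ->
  cmap1 mu (fun s => cmap1 mu (cmap b' F s) v) u =
  (if nilp u && nilp v then F [::] else 0) +
    dec (fun u1 u2 => dec (fun v1 v2 => (-1) ^ (deg u2 * deg v1) *:
      cmap1 mu (fun s => cmap1 mu (cmap b'
        (fun r => F ((deg u1 + deg v1, cmap11 u1 v1) :: r)) s) v2) u2) v) u.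
Proof.
move=> FM; have [b'0 _ _ _ _] := b'U.
pose H u1 u2 v1 v2 := (-1) ^ (deg u2 * deg v1) *: cmap b' (fun t => F (block b' u1 v1 :: t)) u2 v2.
have E1 s : cmap1 mu (cmap b' F s) v = (if nilp s then if nilp v then F [::] else 0 else 0) +
    dec (fun s1 s2 => dec (fun v1 v2 => cmap1 mu (fun t1 => cmap1 mu (H s1 s2 t1) v2) v1) v) s.
  rewrite (eq_cmap1 (G := fun t => (if nilp t then if nilp s then F [::] else 0 else 0) +
     dec (fun s1 s2 => dec (H s1 s2) t) s)); last first.
    by move=> t _ _ _; rewrite (cmap_recF _ _ b'0 FM); congr (_ + _); case: nilp; case: nilp.
  rewrite [LHS]cmapD [X in X + _]cmap_eps [X in _ + X]cmap_dec_out andbT.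
  congr (_ + _); first by case: nilp; case: nilp.
  by apply: eq_dec => s1 s2 _; rewrite -/(cmap1 _ _ _) cmap1_dec.
rewrite (eq_cmap1 (G := fun s => (if nilp s then if nilp v then F [::] else 0 else 0) +
    dec (fun s1 s2 => dec (fun v1 v2 => cmap1 mu (fun t1 => cmap1 mu (H s1 s2 t1) v2) v1) v) s)).
  2: by move=> s _ _ _; exact: E1.
rewrite [LHS]cmapD [X in X + _]cmap_eps andbT; congr (_ + _).
  by case: nilp; case: nilp.
rewrite -/(cmap1 _ _ _) cmap1_dec; apply: eq_dec => u1 u2 _.
rewrite (eq_cmap1 (G := fun s1 => dec (fun v1 v2 =>
  cmap1 mu (fun s2 => cmap1 mu (fun t1 => cmap1 mu (H s1 s2 t1) v2) v1) u2) v)); last first.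
  by move=> s1 _ _ _; rewrite [LHS]cmap_dec_out.
rewrite [LHS]cmap_dec_out; apply: eq_dec => v1 v2 _; rewrite -/(cmap1 _ _ _).
pose g n x := cmap1 mu (fun s2 => cmap1 mu
   (cmap b' (fun r => F ((n, x) :: r)) s2) v2) u2.
have gL n : linear (g n).
  move=> a x y; rewrite -cmap1_comb; apply: eq_cmap1 => s _ _ _.
  rewrite -cmap1_comb; apply: eq_cmap1 => t _ _ _.
  by rewrite -cmap_comb; apply: eq_cmap => r _ _ _; exact: hml_cons_lin.
rewrite -/(g _ _) /cmap11 (cmap1_lin _ _ _ (gL _)) -[RHS]cmapZ; apply: eq_cmap1 => s ds _ _.
rewrite (cmap1_lin _ _ _ (gL _)) -[RHS]cmapZ.
(* The expansions of [v1] and of [u2] are independent; exchanging them brings together the two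
   ingredients of the first letter. *)
rewrite [LHS]cmap_exch; apply: eq_cmap1 => t dt _ _.
rewrite -[RHS]cmapZ; apply: eq_cmap1 => s2 ds2 _ _.
rewrite -[RHS]cmapZ; apply: eq_cmap1 => t2 dt2 _ _.
by rewrite /H /block ds2 ds dt.
Qed.

Lemma cmap1_cmap (M : lmodType k) (F : hword B' -> M) u v : hmultilinear F -> hwf u -> hwf v ->
  (forall u v, hwf u -> hwf v -> u != [::] -> v != [::] -> cmap b hmu u v = cmap11 u v) ->
  cmap b (cmap1 mu F) u v = cmap1 mu (fun s => cmap1 mu (cmap b' F s) v) u.
Proof.
move=> FM hu hv E0.
have [b0 b1 b1' b2 b2'] := bU; have [b'0 b'1 b'1' b'2 b'2'] := b'U.
(* The recursion produces empty words as well; for these the identity follows from the unit laws of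
   b and b'. *)
have E x y : hwf x -> hwf y -> cmap b hmu x y = cmap11 x y.
  move=> hx hy; case: (eqVneq x [::]) => [->|x0].
    rewrite cmap_unit_l //; last exact: hml_vals.
    rewrite /cmap11 cmap1_nil -cmap1_cletter; apply: eq_cmap1 => t _ _ _.
    by case: t => [|p [|q t]] //=; rewrite b'2.
  case: (eqVneq y [::]) => [->|y0]; last exact: E0.
  rewrite cmap_unit_r //; last exact: hml_vals.
  rewrite /cmap11 -cmap1_cletter; apply: eq_cmap1 => t _ _ _; rewrite cmap1_nil.
  by case: t => [|p [|q t]] //=; rewrite b'2'.
have [n] := ubnP (size u + size v); elim: n F u v FM hu hv => // n IH F u v FM hu hv hn.
rewrite cmap_cmap1_rec // cmap1_cmap_rec //; congr (_ + _).
apply: eq_dec => u1 u2 Eu; apply: eq_dec => v1 v2 Ev; congr (_ *: _).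
have /hwf_cat[hu1 hu2] : hwf (u1 ++ u2) by rewrite Eu.
have /hwf_cat[hv1 hv2] : hwf (v1 ++ v2) by rewrite Ev.
(* With both first parts empty the remaining pair is not smaller; there the first letter is b'_{0,0}
   = 0. *)
rewrite E //; case: (boolP (nilp u1 && nilp v1)) => h; last first.
  apply: IH => //; first exact: hml_cons.
  by move: hn h; rewrite -Eu -Ev !size_cat /nilp; lia.
have F0 r : F ((deg u1 + deg v1, cmap11 u1 v1) :: r) = 0.
  case/andP: h => /nilP-> /nilP->; rewrite /cmap11 !cmap1_nil b'0; exact: (hml0 [::]).
rewrite (eq_cmap (G := fun _ => 0)) => [|t _ _ _]; last first.
  by rewrite -[RHS](cmap1_0 mu M t); apply: eq_cmap1 => r _ _ _.
rewrite cmap0 -[LHS](cmap1_0 mu M u2); apply: eq_cmap1 => s _ _ _.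
rewrite -[LHS](cmap1_0 mu M v2); apply: eq_cmap1 => t _ _ _.
by rewrite -[LHS](cmap0 b' M s t); apply: eq_cmap => r _ _ _.
Qed.

Lemma bmor_mulP :
  (forall u v, hwf u -> hwf v -> u != [::] -> v != [::] ->
    bprod b (cogen mu (@wordh k B')) u v =
    cogen mu (fun s => cogen mu (fun t => bprod b' (@wordh k B') s t) v) u) <->
  (forall u v, hwf u -> hwf v -> u != [::] -> v != [::] -> cmap b hmu u v = cmap11 u v).
Proof.
have [b0 _ _ _ _] := bU; have [b'0 _ _ _ _] := b'U.
have wM := @wordh_hml k B'; have nn (X : gspace k) (w : hword X) : w != [::] -> ~~ nilp w by case: w.
have EL u v : u != [::] -> bprod b (cogen mu (@wordh k B')) u v = cmap b (cmap1 mu (@wordh k B')) u v.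
  move=> u0; rewrite cogen_wordh bprodE //; last exact/nandP/or_introl/nn.
  exact: cmap1_hml.
have ER u v : u != [::] -> v != [::] ->
    cogen mu (fun s => cogen mu (fun t => bprod b' (@wordh k B') s t) v) u =
    cmap1 mu (fun s => cmap1 mu (cmap b' (@wordh k B') s) v) u.
  move=> u0 v0; rewrite cogenE //; apply: eq_cmap1 => s _ ns _; rewrite cogenE //.
  apply: eq_cmap1 => t _ nt _; rewrite bprodE // ns nt; exact/nandP/or_introl/nn.
split=> h u v hu hv u0 v0; last by rewrite EL // ER //; exact: cmap1_cmap.
have := h u v hu hv u0 v0; rewrite EL // ER // => /(congr1 (@cogenpart k B')).
rewrite (cmap_lin _ _ _ _ (@cogenpart_linear k B')).
rewrite (cmap1_lin _ _ _ (@cogenpart_linear k B')).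
rewrite (eq_cmap (G := hmu)) => [->|t _ _ _]; last exact: cogenpart_cmap1.
apply: eq_cmap1 => s _ ns _; rewrite (cmap1_lin _ _ _ (@cogenpart_linear k B')).
apply: eq_cmap1 => t _ nt _; rewrite (cmap_lin _ _ _ _ (@cogenpart_linear k B')).
rewrite (eq_cmap (G := @cletter k B')) => [|r _ _ _]; last exact: cogenpart_wordh.
by rewrite (cmap_cogen b' (fun p => p.2)) // ns nt; exact/nandP/or_introl/nn.
Qed.

End Product.
End Morphism.

(** * Actions on a bilinear pairing through the coproduct *)

Section Bilinear.
Variables (k : fieldType) (B T : gspace k) (N : lmodType k).
Variables (Lam : T -> T -> N) (beta : seq B -> T -> T).
Hypotheses (LamL : forall y, linear (Lam^~ y)) (LamR : forall x, linear (Lam x)).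
Hypothesis betaL : forall s, linear (beta s).

(* beta(v) applied to a1 ⊗ a2 through the coproduct of T^c(B), with i = |a1|,
   followed by the bilinear map Lam *)
Definition act2 (v : hword B) (i : int) (a1 a2 : T) : N :=
  dec (fun v1 v2 => (-1) ^ (i * deg v2) *: Lam (beta (vals v1) a1) (beta (vals v2) a2)) v.

Lemma act2_linl v i a2 : linear (fun a1 => act2 v i a1 a2).
Proof.
move=> a x y; rewrite /act2 dec_scale -decD; apply: eq_dec => v1 v2 _.
by rewrite betaL LamL scalerDr !scalerA mulrC.
Qed.

Lemma act2_linr v i a1 : linear (act2 v i a1).
Proof.
move=> a x y; rewrite /act2 dec_scale -decD; apply: eq_dec => v1 v2 _.
by rewrite betaL LamR scalerDr !scalerA mulrC.
Qed.

(** The product of T^c(B) respects coproducts by [cmap_dec], so associativity of the action on [a1]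
    and on [a2] passes to their pairing. With [Lam] the tensor sign or the product this is the
    inductive step of both associativity proofs. *)
Lemma act2_assoc (b : seq B -> seq B -> B) u v i a1 a2 : hwf u -> hwf v ->
  (forall u v, hwf u -> hwf v ->
     cmap b (fun t => beta (vals t) a1) u v = beta (vals u) (beta (vals v) a1)) ->
  (forall u v, hwf u -> hwf v ->
     cmap b (fun t => beta (vals t) a2) u v = beta (vals u) (beta (vals v) a2)) ->
  cmap b (fun t => act2 t i a1 a2) u v =
  dec (fun v1 v2 => (-1) ^ (i * deg v2) *:
    act2 u (deg v1 + i) (beta (vals v1) a1) (beta (vals v2) a2)) v.
Proof.
move=> hu hv h1 h2; rewrite cmap_dec dec_exch; apply: eq_dec => v1 v2 Ev.
rewrite dec_scale; apply: eq_dec => u1 u2 Eu.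
have /hwf_cat[hu1 hu2] : hwf (u1 ++ u2) by rewrite Eu.
have /hwf_cat[hv1 hv2] : hwf (v1 ++ v2) by rewrite Ev.
rewrite -h1 // -h2 // (cmap_lin _ _ _ _ (LamL _)) !scalerA -signD -!cmapZ.
apply: eq_cmap => t1 _ _ _; rewrite (cmap_lin _ _ _ _ (LamR _)) -!cmapZ.
apply: eq_cmap => t2 dt2 _ _; rewrite scalerA -signD dt2; congr (_ *: _).
by congr (_ ^ _); ring.
Qed.

(** The analogue for differentials: [codiff_dec] distributes the coderivation over the two parts of
    v, matching the Leibniz rule of [dT] on the pairing. *)
Lemma act2_diff (d : seq B -> B) (dT : T -> T) v i a1 a2 : hwf v ->
  (forall v, hwf v -> dT (beta (vals v) a1) =
    codiff d (fun t => beta (vals t) a1) v + (-1) ^ deg v *: beta (vals v) (dT a1)) ->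
  (forall v, hwf v -> dT (beta (vals v) a2) =
    codiff d (fun t => beta (vals t) a2) v + (-1) ^ deg v *: beta (vals v) (dT a2)) ->
  dec (fun v1 v2 => (-1) ^ (i * deg v2) *:
    (Lam (dT (beta (vals v1) a1)) (beta (vals v2) a2) +
     (-1) ^ (deg v1 + i) *: Lam (beta (vals v1) a1) (dT (beta (vals v2) a2)))) v =
  codiff d (fun t => act2 t i a1 a2) v +
  (-1) ^ deg v *: (act2 v (i + 1) (dT a1) a2 + (-1) ^ i *: act2 v i a1 (dT a2)).
Proof.
move=> hv h1 h2; rewrite codiff_dec /act2 dec_scale -decD dec_scale -decD.
apply: eq_dec => v1 v2 Ev; have /hwf_cat[hv1 hv2] : hwf (v1 ++ v2) by rewrite Ev.
rewrite h1 // h2 // (linD (LamL _)) (linD (LamR _)) (linZ (LamL _)) (linZ (LamR _)).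
rewrite (codiff_lin _ _ _ (LamL _)) (codiff_lin _ _ _ (LamR _)).
rewrite codiffZ (eq_codiff (F := fun t2 => _ *: Lam _ _)
  (G := fun t2 => (-1) ^ (i * (deg v2 + 1)) *: Lam (beta (vals v1) a1) (beta (vals t2) a2))); last first.
  by move=> t dt _ _; rewrite dt.
rewrite codiffZ !scalerDr !scalerA -!signD -!addrA; congr (_ + _).
rewrite [LHS]addrCA; congr (_ + _).
  by congr (_ *: _); congr (_ ^ _); ring.
congr (_ *: _ + _ *: _).
  (* The exponents differ by [2 deg v2]: one [deg v2] comes from [deg v], the other from [v2]
     passing [dT a1], whose degree is i + 1. *)
  by rewrite -Ev deg_cat; apply: (@sign_even _ _ _ (- deg v2)); ring.
by rewrite -Ev deg_cat; congr (_ ^ _); ring.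
Qed.
End Bilinear.

(** * Extending a family of maps to an action *)

Section Extension.
Variables (k : fieldType) (B E T : gspace k) (A : hword E -> T -> T).
Hypotheses (AL : forall es, linear (A es)) (AM : forall x, hmultilinear (A^~ x)).
Hypotheses (A0 : forall x, A [::] x = x).
Hypothesis AD : forall es i x, hwf es -> ghom i x -> ghom (deg es + i) (A es x).
Variables (mu : seq B -> E).
Hypotheses (muD : multilinear_deg 0 mu).

(** The action A of words of E is kept abstract so as to serve both insertions into T^c(W) and
    applications to T(W). *)
Definition ext (s : seq B) (x : T) : T := hsum (cmap1 mu (A^~ x)) s.

Lemma extE v x : hwf v -> ext (vals v) x = cmap1 mu (A^~ x) v.
Proof. by move=> hv; rewrite /ext hsum_vals //; apply: cmap1_hml => //; case: muD. Qed.

Lemma ext_nil x : ext [::] x = x.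
Proof. by rewrite /ext /= cmap1_nil. Qed.

Lemma ext_lin s : linear (ext s).
Proof.
move=> a x y; rewrite /ext -hsum_comb; apply: eq_hsum => v.
by rewrite -cmap1_comb; apply: eq_cmap1 => t _ _ _; exact: AL.
Qed.

Lemma ext_mlin x : multilinear (ext^~ x).
Proof. by apply/hsum_multilinear/cmap1_hml => //; case: muD. Qed.

Lemma ext_deg v i x : hwf v -> ghom i x -> ghom (deg v + i) (ext (vals v) x).
Proof.
move=> hv hx; rewrite extE // /cmap1; have [L hL ->] := cmap_list (unary mu) v [::].
rewrite big_seq; apply: ghom_sum => p /hL[dp _ hp]; apply: ghomZ.
have -> : deg v = deg p.2 by rewrite dp [deg [::]]big_nil addr0.
apply: AD => //; apply: hp => // u [|q w] hu hw; last exact: ghom0.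
by have := proj2 muD _ hu; rewrite [deg [::]]big_nil.
Qed.

(** As \hat mu respects coproducts, compatibility of A with a pairing passes to [ext]. The index
    list r is the list of cuts of a word, with g the coproduct, in the coalgebra case; it has one
    entry, with g the identity, in the algebra case. *)
Lemma ext_act2 (N : lmodType k) (Lam : T -> T -> N) (g : T -> N) v x
    (J : Type) (r : seq J) (i : J -> int) (a1 a2 : J -> T) :
  (forall y, linear (Lam^~ y)) -> (forall x, linear (Lam x)) -> linear g -> hwf v ->
  (forall es, hwf es -> g (A es x) = \sum_(j <- r) dec (fun es1 es2 =>
     (-1) ^ (i j * deg es2) *: Lam (A es1 (a1 j)) (A es2 (a2 j))) es) ->
  g (ext (vals v) x) = \sum_(j <- r) act2 Lam ext v (i j) (a1 j) (a2 j).
Proof.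
move=> LamL LamR gL hv h; rewrite extE // (cmap1_lin _ _ _ gL).
rewrite (eq_cmap1 (G := fun es => \sum_(j <- r) dec (fun es1 es2 =>
     (-1) ^ (i j * deg es2) *: Lam (A es1 (a1 j)) (A es2 (a2 j))) es)); last first.
  by move=> es _ _ hes; apply/h/hes.
rewrite [LHS]cmap_sum; apply: eq_bigr => j _.
rewrite -/(cmap1 _ _ _) cmap1_dec; apply: eq_dec => v1 v2 Ev.
have /hwf_cat[hv1 hv2] : hwf (v1 ++ v2) by rewrite Ev.
rewrite !extE // (cmap1_lin _ _ _ (LamL _)) -[RHS]cmapZ; apply: eq_cmap1 => t1 _ _ _.
rewrite (cmap1_lin _ _ _ (LamR _)) -[RHS]cmapZ; apply: eq_cmap1 => t2 dt2 _ _.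
by rewrite dt2.
Qed.
End Extension.

Lemma tens_words (k : fieldType) (V : gspace k) (x : tens V) : exists2 ws : seq (hword V),
  (forall w, w \in ws -> hwf w /\ w != [::]) & x = \sum_(w <- ws) word (vals w).
Proof.
have [r hr ->] := thom_span x.
elim: r hr => [|[n y] r IH] hr; first by exists [::]; rewrite ?big_nil.
have [|ws hws E] := IH; first by move=> p pr; apply: hr; rewrite inE pr orbT.
have [us hus Ey] := hr _ (mem_head _ _).
exists ([seq w <- us | w != [::]] ++ ws).
  by move=> w; rewrite mem_cat mem_filter => /orP[/andP[w0 /hus[]]|/hws].
rewrite big_cons big_cat E /= in Ey *; rewrite Ey big_filter [X in _ = X + _]big_mkcond /=.
by congr (_ + _); apply: eq_bigr => w _; case: eqVneq => // ->; rewrite word0.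
Qed.

Lemma tens_lin_eq (k : fieldType) (V : gspace k) (M : lmodType k) (f g : tens V -> M) :
  linear f -> linear g ->
  (forall w : hword V, hwf w -> w != [::] -> f (wordh w) = g (wordh w)) -> f =1 g.
Proof.
move=> fL gL h x; have [ws hws ->] := tens_words x.
by rewrite (lin_sum fL) (lin_sum gL); apply: eq_big_seq => w /hws[hw w0]; exact: h.
Qed.

Lemma wordh_hom (k : fieldType) (V : gspace k) (w : hword V) :
  hwf w -> ghom (deg w) (wordh w : tensor V).
Proof. exact: thom_word. Qed.

(** * Actions on the cofree coalgebra *)

Section Deconcatenation.
Variables (k : fieldType) (V : lmodType k).

(** The two cuts missing from [deconc] contribute a tensor with the factor [word [::] = 0]. *)
Lemma deconc_dec (s : seq V) :
  deconc (word s) = dec (fun a c => word [:: word a; word c]) s.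
Proof.
have w0r (x : tens V) : word [:: x; 0] = 0 by exact: (mlin0 [:: x] [::] (@word_multilinear k _)).
have w0l (x : tens V) : word [:: 0; x] = 0 by exact: (mlin0 [::] [:: x] (@word_multilinear k _)).
rewrite deconc_word /dec; case: s => [|x s]; first by rewrite big_geq // big_nat1 word0 w0r.
rewrite [RHS]big_ltn // take0 word0 w0l add0r [in RHS]big_nat_recr //=.
by rewrite drop_size word0 w0r addr0.
Qed.

(* a ⊗ c |-> (first letter of a) c, a one-sided inverse of the coproduct up to
   cogenerators *)
Definition reconc : tens (tens V) -> tens V :=
  tlift (fun s => if s is [:: a; c] then tmul (word [:: cogenpart a]) c else 0).

Lemma reconc_mlin : multilinear (fun s : seq (tens V) =>
  if s is [:: a; c] then tmul (word [:: cogenpart a]) c else 0).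
Proof.
move=> [|p [|q s]] [|p' [|q' t]] a x y //=; rewrite ?scaler0 ?addr0 //.
- rewrite cogenpart_linear -tmul_linear_l; congr tmul.
  exact: (@word_multilinear k V [::] [::]).
- exact: tmul_linear_r.
- by case: s => [|? ?]; rewrite /= scaler0 addr0.
- by case: s => [|? ?]; rewrite /= scaler0 addr0.
- by case: s => [|? ?]; rewrite /= scaler0 addr0.
Qed.

(** Among the cuts of a word, [reconc] keeps only the one after the first letter and glues it back,
    so it restores every word of length at least two; one-letter words are what [cogenpart] sees. *)
Lemma reconcK x : x = word [:: cogenpart x] + reconc (deconc x).
Proof.
have rL : linear reconc := tlift_linear reconc_mlin; have cL := @cogenpart_linear k V.
have w1 a (y z : V) : word [:: a *: y + z] = a *: word [:: y] + word [:: z].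
  exact: (@word_multilinear k V [::] [::]).
elim/tens_ind: x => [|a s x s0 IH].
  rewrite (lin0 (@deconc_linear k V)) (lin0 rL) (lin0 cL) addr0.
  by rewrite (mlin0 [::] [::] (@word_multilinear k V)).
rewrite (deconc_linear a) rL cL w1 addrACA -IH -scalerDr; congr (_ *: _ + _).
rewrite deconc_word cogenpart_word (lin_sum rL).
case: s s0 => [|y [|z s]] // _; first by rewrite big_geq // addr0.
rewrite (mlin0 [::] [::] (@word_multilinear k V)) add0r big_ltn //= /reconc tlift_word //; last exact: reconc_mlin.
rewrite cogenpart_word tmul_word // big_nat_cond big1 ?addr0 // => i.
rewrite andbT => /andP[i1 i2]; rewrite tlift_word //; last exact: reconc_mlin.
case: i i1 i2 => [|[|i]] // _ i2; rewrite cogenpart_word /=.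
by rewrite (mlin0 [::] [::] (@word_multilinear k V)) (lin0 (@tmul_linear_l k V _)).
Qed.

(** The form of cofreeness behind uniqueness: an identity in T^c(W) reduces to its projection to W
    and to its coproduct, where induction on length applies. *)
Lemma cogen_deconc_inj (x y : tens V) : cogenpart x = cogenpart y -> deconc x = deconc y -> x = y.
Proof. by move=> e1 e2; rewrite [x]reconcK e1 e2 -reconcK. Qed.

End Deconcatenation.

Definition tpair (k : fieldType) (V : lmodType k) (x y : V) : tens V := word [:: x; y].

Lemma tpair_linl (k : fieldType) (V : lmodType k) (y : V) : linear ((@tpair k V)^~ y).
Proof. by move=> a x z; exact: (@word_multilinear k V [::] [:: y]). Qed.

Lemma tpair_linr (k : fieldType) (V : lmodType k) (x : V) : linear (@tpair k V x).
Proof. by move=> a y z; exact: (@word_multilinear k V [:: x] [::]). Qed.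

Section Pair2.
Variables (k : fieldType) (T : gspace k) (N : lmodType k) (G : int -> T -> T -> N).
Hypotheses (Gl : forall i y, linear (fun x => G i x y)) (Gr : forall i x, linear (G i x)).

(** G receives the degree of the first factor, on which Koszul signs depend. As a linear map on the
    tensor square, [pair2] does not depend on a Sweedler presentation. *)
Definition pair2 : tens T -> N :=
  tlin (fun t : hword T => if t is [:: p; q] then G p.1 p.2 q.2 else 0).

Let GM : hmultilinear (fun t : hword T => if t is [:: p; q] then G p.1 p.2 q.2 else 0).
Proof.
move=> [|p [|q s]] [|p' [|q' t]] i a x y //=; rewrite ?scaler0 ?addr0 ?Gl ?Gr //;
by case: s => [|? ?]; rewrite /= scaler0 addr0.
Qed.

Lemma pair2_linear : linear pair2.
Proof. exact: tlin_linear. Qed.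

Lemma pair2_word i j x y : ghom i x -> ghom j y -> pair2 (tpair x y) = G i x y.
Proof.
move=> hx hy; rewrite /pair2 (@tlin_word _ _ _ _ [:: (i, x); (j, y)]) //.
by apply/hwf_cons; split=> //; apply/hwf_cons.
Qed.
End Pair2.

Section CoalgebraAction.
Variables (k : fieldType) (B W : gspace k).
Local Notation T := (tensor W).
Variable beta : seq B -> T -> T.
Hypothesis betaL : forall s, linear (beta s).

Local Notation coact := (act2 (@tpair k T) beta).

Let cL v i y : linear (fun x => coact v i x y).
Proof. exact: act2_linl (@tpair_linl k T) betaL v i y. Qed.
Let cR v i x : linear (coact v i x).
Proof. exact: act2_linr (@tpair_linr k T) betaL v i x. Qed.

Definition coaction_on_words := forall (v : hword B) (w : hword W), hwf v -> hwf w ->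
  deconc (beta (vals v) (wordh w)) =
  dec (fun w1 w2 => coact v (deg w1) (wordh w1) (wordh w2)) w.

Lemma deconc_wordh (w : hword W) :
  deconc (wordh w) = dec (fun w1 w2 => tpair (wordh w1) (wordh w2)) w.
Proof.
rewrite /wordh deconc_dec /dec size_map; apply: eq_bigr => i _.
by rewrite /vals map_take map_drop.
Qed.

Lemma coaction_pair2 (v : hword B) y : coaction_on_words -> hwf v ->
  deconc (beta (vals v) y) = pair2 (coact v) (deconc y).
Proof.
move=> h hv; have pL := pair2_linear (cL v) (cR v).
apply: (tens_lin_eq (f := fun y => deconc (beta (vals v) y))
  (g := fun y => pair2 (coact v) (deconc y))) y.
- by move=> a x y; rewrite betaL deconc_linear.
- by move=> a x y; rewrite deconc_linear pL.
move=> w hw w0; rewrite h // deconc_wordh (dec_lin _ _ pL); apply: eq_dec => w1 w2 Ew.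
have /hwf_cat[hw1 hw2] : hwf (w1 ++ w2) by rewrite Ew.
by rewrite (pair2_word (cL v) (cR v) (wordh_hom hw1) (wordh_hom hw2)).
Qed.

(** The axiom quantifies over all Sweedler presentations. One presentation of each word is enough,
    since the right-hand side is the value of the linear map [pair2] on the coproduct. *)
Lemma coactionP :
  (forall (v : hword B) c s, hwf v -> sweedler (C := T) (@deconc k W) c s ->
    deconc (beta (vals v) c) =
    \sum_(p <- s) \sum_(0 <= j < (size v).+1) (-1) ^ (p.1.1 * deg (drop j v)) *:
       word [:: beta (vals (take j v)) p.1.2; beta (vals (drop j v)) p.2.2]) <->
  coaction_on_words.
Proof.
split=> [h v w hv hw|h v c s hv [hs E]].
  pose s := [seq ((deg (take i w), wordh (take i w)), (deg (drop i w), wordh (drop i w)))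
              | i <- index_iota 0 (size w).+1] : seq ((int * T) * (int * T)).
  rewrite (h v _ s hv); first by rewrite big_map.
  split; last by rewrite deconc_wordh big_map.
  move=> p /mapP[i _ ->] /=; split; [exact/wordh_hom/take_hwf|exact/wordh_hom/drop_hwf].
rewrite coaction_pair2 // E (lin_sum (pair2_linear (cL v) (cR v))).
apply: eq_big_seq => p /hs[h1 h2]; exact: (pair2_word (cL v) (cR v) h1 h2).
Qed.

Lemma coact_0l v i y : coact v i 0 y = 0.
Proof. exact: lin0 (cL v i y). Qed.
Lemma coact_0r v i x : coact v i x 0 = 0.
Proof. exact: lin0 (cR v i x). Qed.

Hypotheses (betaM : forall x, multilinear (beta^~ x)) (beta0 : forall x, beta [::] x = x).
Hypothesis betaD : forall (v : hword B) i x, hwf v -> ghom i x ->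
  ghom (deg v + i) (beta (vals v) x).
Hypothesis coact_words : coaction_on_words.

Lemma coaction_uniq (beta' : seq B -> T -> T) :
  (forall s, linear (beta' s)) -> (forall x, multilinear (beta'^~ x)) ->
  (forall (v : hword B) (w : hword W), hwf v -> hwf w ->
    deconc (beta' (vals v) (wordh w)) =
    dec (fun w1 w2 => act2 (@tpair k T) beta' v (deg w1) (wordh w1) (wordh w2)) w) ->
  (forall (v : hword B) (w : hword W), hwf v -> hwf w ->
    cogenpart (beta (vals v) (wordh w)) = cogenpart (beta' (vals v) (wordh w))) ->
  beta = beta'.
Proof.
move=> bL' bM' co' E.
suff h (v : hword B) (w : hword W) : hwf v -> hwf w ->
    beta (vals v) (wordh w) = beta' (vals v) (wordh w).
  apply: funext => s; apply: funext => x; apply/eqP; rewrite -subr_eq0; apply/eqP.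
  apply: (mlin_vals0 (f := fun s => beta s x - beta' s x)) => [s1 s2 a y z|v hv].
    by rewrite betaM bM' opprD addrACA scalerBr.
  apply/eqP; rewrite subr_eq0; apply/eqP.
  by apply: (tens_lin_eq (betaL _) (bL' _)) => w hw _; exact: h.
have [n] := ubnP (size w); elim: n v w => // n IH v w hn hv hw.
apply: cogen_deconc_inj; first exact: E.
rewrite coact_words // co' //; apply: eq_dec => w1 w2 Ew; apply: eq_dec => v1 v2 Ev.
have /hwf_cat[hw1 hw2] : hwf (w1 ++ w2) by rewrite Ew.
have /hwf_cat[hv1 hv2] : hwf (v1 ++ v2) by rewrite Ev.
(* An empty part of w is zero in T^c(W); otherwise both parts are strictly shorter than w and the
   induction hypothesis applies. *)
congr (_ *: _); case: (eqVneq w1 [::]) => [->|w10].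
  rewrite /wordh word0 (lin0 (betaL _)) (lin0 (bL' _)).
  by rewrite !(lin0 (tpair_linl (V := T) _)).
case: (eqVneq w2 [::]) => [->|w20].
  rewrite /wordh word0 (lin0 (betaL _)) (lin0 (bL' _)).
  by rewrite !(lin0 (tpair_linr (V := T) _)).
have sw : (size w1 + size w2 < n.+1)%N by rewrite -size_cat Ew.
have s1 : (0 < size w1)%N by case: (w1) w10.
have s2 : (0 < size w2)%N by case: (w2) w20.
by rewrite !IH //; lia.
Qed.

Lemma coaction_assoc (b : seq B -> seq B -> B) (u v : hword B) x :
  (forall u v : hword B, hwf u -> hwf v -> ghom (deg u + deg v) (b (vals u) (vals v))) ->
  unital b ->
  (forall (u v : hword B) (w : hword W), hwf u -> hwf v -> hwf w ->
     u != [::] -> v != [::] ->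
     cogenpart (cmap b (fun t => beta (vals t) (wordh w)) u v) =
     cogenpart (beta (vals u) (beta (vals v) (wordh w)))) ->
  hwf u -> hwf v ->
  cmap b (fun t => beta (vals t) x) u v = beta (vals u) (beta (vals v) x).
Proof.
move=> bD bU E hu hv; have bM y : hmultilinear (fun t => beta (vals t) y).
  exact: hml_vals (betaM y).
apply: (tens_lin_eq (f := fun x => cmap b (fun t => beta (vals t) x) u v)
  (g := fun x => beta (vals u) (beta (vals v) x))) x => [a y z|a y z|w hw _].
- by rewrite -cmap_comb; apply: eq_cmap => t _ _ _; exact: betaL.
- by rewrite !betaL.
have [b0 b1 b1' b2 b2'] := bU.
have [n] := ubnP (size w); elim: n u v w hu hv hw => // n IH u v w hu hv hw hn.
(* Empty words arise from the cuts of u and v in the inductive step, while [E] speaks of non-empty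
   ones; the unit laws settle them. *)
case: (eqVneq u [::]) => [->|u0]; first by rewrite cmap_unit_l // beta0.
case: (eqVneq v [::]) => [->|v0]; first by rewrite cmap_unit_r // beta0.
apply: cogen_deconc_inj; first exact: E.
rewrite coaction_pair2 // coact_words // (cmap_lin _ _ _ _ (@deconc_linear k W)).
rewrite (eq_cmap (G := fun t => dec (fun w1 w2 => coact t (deg w1) (wordh w1) (wordh w2)) w));
  last by move=> t _ _ ht; rewrite coact_words //; exact: ht.
have pL := pair2_linear (cL u) (cR u).
rewrite cmap_dec_out (dec_lin _ _ pL); apply: eq_dec => w1 w2 Ew.
have /hwf_cat[hw1 hw2] : hwf (w1 ++ w2) by rewrite Ew.
transitivity (dec (fun v1 v2 => (-1) ^ (deg w1 * deg v2) *:
    coact u (deg v1 + deg w1) (beta (vals v1) (wordh w1)) (beta (vals v2) (wordh w2))) v);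
  last first.
  rewrite (dec_lin _ _ pL); apply: eq_dec => v1 v2 Ev.
  have /hwf_cat[hv1 hv2] : hwf (v1 ++ v2) by rewrite Ev.
  rewrite (linZ pL); congr (_ *: _).
  by rewrite (pair2_word (cL u) (cR u) (betaD hv1 (wordh_hom hw1)) (betaD hv2 (wordh_hom hw2))).
case: (eqVneq w1 [::]) => [->|w10].
  rewrite (eq_cmap (G := fun _ => 0)) ?cmap0.
    rewrite -[LHS](dec0 _ v); apply: eq_dec => v1 v2 _.
    by rewrite /wordh word0 (lin0 (betaL _)) coact_0l scaler0.
  by move=> t _ _ _; rewrite /wordh word0 coact_0l.
case: (eqVneq w2 [::]) => [->|w20].
  rewrite (eq_cmap (G := fun _ => 0)) ?cmap0.
    rewrite -[LHS](dec0 _ v); apply: eq_dec => v1 v2 _.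
    by rewrite /wordh word0 (lin0 (betaL _)) coact_0r scaler0.
  by move=> t _ _ _; rewrite /wordh word0 coact_0r.
have sw : (size w1 + size w2 < n.+1)%N by rewrite -size_cat Ew.
have s1 : (0 < size w1)%N by case: (w1) w10.
have s2 : (0 < size w2)%N by case: (w2) w20.
apply: (act2_assoc (@tpair_linl k T) (@tpair_linr k T)) => // u' v' hu' hv'; apply: IH => //; lia.
Qed.

Lemma coaction_diff (d : seq B -> B) (dC : T -> T) (v : hword B) x :
  dg_coalgebra (C := T) (@deconc k W) dC -> multilinear_deg 1 d ->
  (forall (v : hword B) (w : hword W), hwf v -> hwf w -> v != [::] ->
     cogenpart (dC (beta (vals v) (wordh w))) =
     cogenpart (codiff d (fun t => beta (vals t) (wordh w)) v +
                (-1) ^ deg v *: beta (vals v) (dC (wordh w)))) ->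
  hwf v ->
  dC (beta (vals v) x) =
    codiff d (fun t => beta (vals t) x) v + (-1) ^ deg v *: beta (vals v) (dC x).
Proof.
move=> hC dD E hv; have [[dL dCD] _] := dgc_diff hC.
pose G i (y z : T) : tens T := tpair (dC y) z + (-1) ^ i *: tpair y (dC z).
have Gl i y : linear (fun x => G i x y).
  move=> a z z'; rewrite /G dL !tpair_linl !scalerDr !scalerA addrACA.
  by rewrite [_ * a]mulrC.
have Gr i y : linear (G i y).
  move=> a z z'; rewrite /G dL !tpair_linr !scalerDr !scalerA addrACA.
  by rewrite [_ * a]mulrC.
(* The co-Leibniz rule without a chosen presentation, so that it applies to elements such as
   [beta (vals v) (wordh w)], which are not words. *)
have dCE y : deconc (dC y) = pair2 G (deconc y).
  have [s hs] := dgc_sweedler hC y; rewrite (dgc_leibniz hC hs); case: hs => hs ->.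
  rewrite (lin_sum (pair2_linear Gl Gr)); apply: eq_big_seq => p /hs[h1 h2].
  by rewrite -[X in pair2 G X]/(tpair p.1.2 p.2.2) (pair2_word Gl Gr h1 h2).
apply: (tens_lin_eq (f := fun x => dC (beta (vals v) x))
  (g := fun x => codiff d (fun t => beta (vals t) x) v +
     (-1) ^ deg v *: beta (vals v) (dC x))) x => [a y z|a y z|w hw _].
- by rewrite betaL dL.
- rewrite dL betaL (eq_codiff (G := fun t => a *: beta (vals t) y + beta (vals t) z)).
    by rewrite codiff_comb !scalerDr !scalerA addrACA [_ * a]mulrC.
  by move=> t _ _ _; exact: betaL.
have [n] := ubnP (size w); elim: n v w hv hw => // n IH v w hv hw hn.
case: (eqVneq v [::]) => [->|v0].
  by rewrite /= !beta0 add0r [deg [::]]big_nil expr0z scale1r.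
apply: cogen_deconc_inj; first exact: E.
have pLG := pair2_linear Gl Gr; have pL := pair2_linear (cL v) (cR v).
rewrite (linD (@deconc_linear k W)) (linZ (@deconc_linear k W)) dCE.
rewrite coact_words // coaction_pair2 // dCE deconc_wordh.
rewrite (codiff_lin _ _ _ (@deconc_linear k W)).
rewrite (eq_codiff (G := fun t => dec (fun w1 w2 => coact t (deg w1) (wordh w1) (wordh w2)) w));
  last by move=> t _ _ ht; rewrite coact_words //; exact: ht.
rewrite [X in X + _]codiff_sum -/(dec (fun w1 w2 => codiff d (fun t => coact t (deg w1) (wordh w1) (wordh w2)) v) w).
rewrite !(dec_lin _ _ pLG) (dec_lin _ _ pL) dec_scale -decD; apply: eq_dec => w1 w2 Ew.
have /hwf_cat[hw1 hw2] : hwf (w1 ++ w2) by rewrite Ew.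
rewrite (pair2_word Gl Gr (wordh_hom hw1) (wordh_hom hw2)) {2}/G (linD pL) (linZ pL).
rewrite (pair2_word (cL v) (cR v) (dCD _ _ (wordh_hom hw1)) (wordh_hom hw2)).
rewrite (pair2_word (cL v) (cR v) (wordh_hom hw1) (dCD _ _ (wordh_hom hw2))).
transitivity (dec (fun v1 v2 => (-1) ^ (deg w1 * deg v2) *:
    G (deg v1 + deg w1) (beta (vals v1) (wordh w1)) (beta (vals v2) (wordh w2))) v).
  rewrite (dec_lin _ _ pLG); apply: eq_dec => v1 v2 Ev.
  have /hwf_cat[hv1 hv2] : hwf (v1 ++ v2) by rewrite Ev.
  rewrite (linZ pLG); congr (_ *: _).
  by rewrite (pair2_word Gl Gr (betaD hv1 (wordh_hom hw1)) (betaD hv2 (wordh_hom hw2))).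
have dC0 := lin0 dL.
case: (eqVneq w1 [::]) => [->|w10].
  rewrite (eq_codiff (G := fun _ => 0)) ?codiff0.
    rewrite /wordh word0 dC0 !coact_0l !(scaler0, addr0) -[RHS](dec0 _ v); apply: eq_dec => v1 v2 _.
    by rewrite (lin0 (betaL _)) (lin0 (Gl _ _)) scaler0.
  by move=> t _ _ _; rewrite /wordh word0 coact_0l.
case: (eqVneq w2 [::]) => [->|w20].
  rewrite (eq_codiff (G := fun _ => 0)) ?codiff0.
    rewrite /wordh word0 dC0 !coact_0r !(scaler0, addr0) -[RHS](dec0 _ v); apply: eq_dec => v1 v2 _.
    by rewrite (lin0 (betaL _)) (lin0 (Gr _ _)) scaler0.
  by move=> t _ _ _; rewrite /wordh word0 coact_0r.
have sw : (size w1 + size w2 < n.+1)%N by rewrite -size_cat Ew.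
have s1 : (0 < size w1)%N by case: (w1) w10.
have s2 : (0 < size w2)%N by case: (w2) w20.
apply: (act2_diff (@tpair_linl k T) (@tpair_linr k T)) => // v' hv'; apply: IH => //; lia.
Qed.

End CoalgebraAction.

(** * Insertion of endomorphisms as a coalgebra map *)

Section Insertion.
Variables (k : fieldType) (W : gspace k).
Local Notation E := (endo W).
Local Notation T := (tensor W).

(** The cogenerators of the insertion action: a single output letter is an untouched letter or the
    value of one endomorphism, never of several. *)
Definition eval_endo (es : seq E) (ws : seq W) : W :=
  match es with
  | [::] => if ws is [:: x] then x else 0
  | [:: e] => endo_fun e ws
  | _ => 0
  end.

(** Either x stays in front and all of [e :: es] passes it, or x opens the place where e is
    inserted. *)
Lemma insertion_cons (M : lmodType k) (F : hword W -> M) e es x ws :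
  insertion F (e :: es) (x :: ws) =
  (-1) ^ (deg (e :: es) * x.1) *: insertion (fun t => F (x :: t)) (e :: es) ws +
  dec (fun a c => (-1) ^ (deg es * deg (x :: a)) *:
    insertion (fun t => F ((e.1 + deg (x :: a), endo_fun e.2 (vals (x :: a))) :: t)) es c) ws.
Proof.
rewrite /= big_nat_recl //= addrC; congr (_ + _).
  rewrite scaler_sumr; apply: eq_bigr => i _; rewrite subSS scaler_sumr.
  apply: eq_bigr => p _; rewrite scalerA -signD !deg_cons; congr (_ *: _).
  by congr (_ ^ _); ring.
rewrite big_add1 /=; apply: eq_bigr => p _.
by rewrite [deg [::]]big_nil mulr0 add0r.
Qed.

(** The blocks with non-zero [eval_endo] are a lone letter and one endomorphism with its inputs,
    which are the two alternatives of [insertion_cons]. Compatibility with coproducts thus becomes a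
    case of [cmap_dec]. *)
Lemma insertionE (M : lmodType k) (F : hword W -> M) es ws : hmultilinear F ->
  insertion F es ws = cmap eval_endo F es ws.
Proof.
have [n] := ubnP (size ws); elim: n F es ws => // n IH F [|e es] ws hn FM.
  by rewrite cmap_unit_l // => -[|x [|y s]].
have Z (u : hword E) (v : hword W) u' v' : eval_endo (vals u) (vals v) = 0 ->
    cmap eval_endo (fun t => F (block eval_endo u v :: t)) u' v' = 0.
  move=> h; rewrite (eq_cmap (G := fun _ => 0)) ?cmap0 // => t _ _ _.
  by rewrite /block h (hml0 [::]).
case: ws hn => [|x ws] hn.
  rewrite /= big_geq // cmap_recF //= add0r -[LHS](dec0 M (e :: es)); apply: eq_dec => u1 u2 _.
  rewrite dec_nil Z ?scaler0 //.
  by case: u1 => [|e1 [|e2 u1]] //=; exact: endo_fun_nil.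
rewrite insertion_cons cmap_recF //.
have -> : (if nilp (e :: es) && nilp (x :: ws) then F [::] else 0) = 0 by [].
rewrite add0r dec_cons; congr (_ + _).
  rewrite dec_cons Z ?scaler0 // add0r dec_first => [|y a c]; last by rewrite Z ?scaler0.
  rewrite IH //; last exact: hml_cons.
  rewrite [deg [:: x]]deg_cons [deg [::]]big_nil addr0; congr (_ *: _).
  apply: eq_cmap => t _ _ _; congr (F (_ :: t)).
  by rewrite /block /= [deg [::]]big_nil deg_cons [deg [::]]big_nil add0r addr0; case: (x).
rewrite [in RHS]dec_first => [|y a c]; last first.
  by rewrite -[RHS](dec0 M (x :: ws)); apply: eq_dec => v1 v2 _; rewrite Z ?scaler0.
rewrite dec_cons Z ?scaler0 ?add0r; last exact: endo_fun_nil.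
apply: eq_dec => a c Ea; rewrite IH; last exact: hml_cons.
  congr (_ *: _); apply: eq_cmap => t _ _ _; congr (F (_ :: t)).
  by rewrite /block /= !deg_cons [deg [::]]big_nil addr0.
by move: hn; rewrite -Ea /= size_cat; lia.
Qed.

Definition ins (es : hword E) : T -> T := tlin (insertion (@wordh k W) es).

Let wM := @wordh_hml k W.

Lemma ins_linear es : linear (ins es).
Proof. exact/tlin_linear/insertion_hml. Qed.

Lemma ins_word es w : hwf w -> ins es (wordh w) = insertion (@wordh k W) es w.
Proof.
move=> hw; case: (eqVneq w [::]) => [->|w0].
  rewrite /wordh word0 (lin0 (ins_linear es)); case: es => [|e es] /=; first by rewrite word0.
  by rewrite big_geq.
by rewrite /ins tlin_word //; exact: insertion_hml.
Qed.

Lemma ins_hml x : hmultilinear (ins^~ x).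
Proof.
have [ws hws ->] := tens_words x => w1 w2 i a y z.
rewrite !(lin_sum (ins_linear _)) scaler_sumr -big_split; apply: eq_big_seq => w /hws[hw _].
by rewrite !ins_word //=; apply: (insertion_hml_es w wM).
Qed.

Lemma ins_nil x : ins [::] x = x.
Proof.
apply: (tens_lin_eq (ins_linear [::])) => [a y z|w hw _] //.
by rewrite ins_word.
Qed.

Lemma ins_deg es i x : hwf es -> ghom i x -> ghom (deg es + i) (ins es x).
Proof.
move=> hes hx; rewrite addrC; apply: (@tlin_deg _ _ T) hx; first exact: insertion_hml.
move=> w hw; rewrite addrC -[_ + _]addr0; apply: insertion_deg => // v hv.
by rewrite addr0; exact: wordh_hom.
Qed.

Lemma deconc_ins es w : hwf w -> deconc (ins es (wordh w)) =
  dec (fun w1 w2 => dec (fun es1 es2 =>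
    (-1) ^ (deg w1 * deg es2) *: tpair (ins es1 (wordh w1)) (ins es2 (wordh w2))) es) w.
Proof.
move=> hw; rewrite ins_word // insertionE // (cmap_lin _ _ _ _ (@deconc_linear k W)).
rewrite (eq_cmap (G := dec (fun w1 w2 => tpair (wordh w1) (wordh w2)))); last first.
  by move=> t _ _ _; exact: deconc_wordh.
rewrite cmap_dec dec_exch; apply: eq_dec => w1 w2 Ew; apply: eq_dec => es1 es2 _.
have /hwf_cat[hw1 hw2] : hwf (w1 ++ w2) by rewrite Ew.
rewrite !ins_word // !insertionE // (cmap_lin _ _ _ _ (@tpair_linl k T _)) mulrC.
congr (_ *: _); apply: eq_cmap => t _ _ _.
by rewrite (cmap_lin _ _ _ _ (@tpair_linr k T _)).
Qed.

Lemma cogenpart_ins e w : hwf w -> cogenpart (ins [:: e] (wordh w)) = endo_fun e.2 (vals w).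
Proof.
move=> hw; rewrite ins_word // insertionE // (cmap_lin _ _ _ _ (@cogenpart_linear k W)).
rewrite (eq_cmap (G := @cletter k W)) => [|t _ _ _]; last exact: cogenpart_wordh.
by rewrite (cmap_cogen eval_endo (fun p => p.2)).
Qed.

Lemma cogenpart_ins2 es w : (1 < size es)%N -> hwf w -> cogenpart (ins es (wordh w)) = 0.
Proof.
case: es => [|e [|e' es]] // _ hw.
rewrite ins_word // insertionE // (cmap_lin _ _ _ _ (@cogenpart_linear k W)).
rewrite (eq_cmap (G := @cletter k W)) => [|t _ _ _]; last exact: cogenpart_wordh.
by rewrite (cmap_cogen eval_endo (fun p => p.2)).
Qed.

(** Used with f an endomorphism: its brace with es is f, viewed on T^c(W), after the insertion of
    es. *)
Lemma insertion_ins (M : lmodType k) (f : seq W -> M) es w : multilinear f -> f [::] = 0 ->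
  hwf w -> insertion (fun t => f (vals t)) es w = tlift f (ins es (wordh w)).
Proof.
move=> fM f0 hw; rewrite ins_word // !insertionE //; last exact: hml_vals.
rewrite (cmap_lin _ _ _ _ (tlift_linear fM)); apply: eq_cmap => t _ _ _.
case: (eqVneq t [::]) => [->|t0]; first by rewrite /wordh word0 (lin0 (tlift_linear fM)).
by rewrite /wordh tlift_word //; case: (t) t0.
Qed.

Lemma tlift_cogen (g : T -> T) e : linear g ->
  (forall w : hword W, hwf w -> cogenpart (g (wordh w)) = endo_fun e (vals w)) ->
  forall x, tlift (endo_fun e) x = cogenpart (g x).
Proof.
move=> gL h x; have eM := endo_fun_mlin e.
apply: (tens_lin_eq (f := tlift (endo_fun e)) (g := fun x => cogenpart (g x))) x => [|a y z|w hw w0].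
  exact: tlift_linear.
  by rewrite gL cogenpart_linear.
by rewrite h // /wordh tlift_word //; case: (w) w0.
Qed.

(** A coderivation is determined by its cogenerator part. The two cuts of the word [[:: (1, e0)]]
    reproduce the two terms of the co-Leibniz rule. *)
Lemma dC_ins (dC : T -> T) (e0 : E) : dg_coalgebra (C := T) (@deconc k W) dC ->
  cogenerates e0 dC -> forall x, dC x = ins [:: (1, e0)] x.
Proof.
move=> hC he; have [[dL dCD] _] := dgc_diff hC.
pose G i (y z : T) : tens T := tpair (dC y) z + (-1) ^ i *: tpair y (dC z).
apply: tens_lin_eq => //; first exact: ins_linear.
move=> w hw _; have [n] := ubnP (size w); elim: n w hw => // n IH w hw hn.
apply: cogen_deconc_inj; first by rewrite cogenpart_ins // he.
rewrite deconc_ins //.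
pose s := [seq ((deg (take i w), wordh (take i w)), (deg (drop i w), wordh (drop i w)))
              | i <- index_iota 0 (size w).+1] : seq ((int * T) * (int * T)).
have hs : sweedler (C := T) (@deconc k W) (wordh w) s.
  split; last by rewrite deconc_wordh big_map.
  by move=> p /mapP[i _ ->] /=; split; [exact/wordh_hom/take_hwf|exact/wordh_hom/drop_hwf].
rewrite (dgc_leibniz hC hs) big_map -/(dec (fun w1 w2 => tpair (dC (wordh w1)) (wordh w2) +
    (-1) ^ deg w1 *: tpair (wordh w1) (dC (wordh w2))) w).
apply: eq_dec => w1 w2 Ew; have /hwf_cat[hw1 hw2] : hwf (w1 ++ w2) by rewrite Ew.
rewrite dec_cons dec_nil !ins_nil addrC.
rewrite !deg_cons ![deg [::]]big_nil /= addr0 mulr1 mulr0 expr0z scale1r.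
have l0 : linear (ins [:: (1, e0)]) by exact: ins_linear.
case: (eqVneq w1 [::]) => [->|w10].
  rewrite /wordh word0 (lin0 dL) (lin0 l0).
  by rewrite !(lin0 (@tpair_linl k T _)) !scaler0.
case: (eqVneq w2 [::]) => [->|w20].
  rewrite /wordh word0 (lin0 dL) (lin0 l0).
  by rewrite !(lin0 (@tpair_linr k T _)) !scaler0.
have sw : (size w1 + size w2 < n.+1)%N by rewrite -size_cat Ew.
have s1 : (0 < size w1)%N by case: (w1) w10.
have s2 : (0 < size w2)%N by case: (w2) w20.
by rewrite !IH //; lia.
Qed.

End Insertion.

(** * Morphisms into the endomorphism algebra *)

Section EndoMorphism.
Variables (k : fieldType) (W : gspace k).
Local Notation E := (endo W).
Local Notation T := (tensor W).

Lemma endo_eqP (e e' : E) :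
  (forall w : hword W, hwf w -> endo_fun e (vals w) = endo_fun e' (vals w)) -> e = e'.
Proof.
move=> h; apply: val_inj; apply: funext => s; apply/eqP; rewrite -subr_eq0; apply/eqP.
apply: (mlin_vals0 (f := fun s => endo_fun e s - endo_fun e' s)) => [s1 s2 a y z|w hw].
  by rewrite !endo_fun_mlin opprD addrACA scalerBr.
by rewrite h // subrr.
Qed.

Lemma endo_fun_linear s : linear (fun e : E => endo_fun e s).
Proof. by []. Qed.

Lemma endo_b_unital : unital (@endo_b k W).
Proof. by split=> // -[|x [|y s]]. Qed.

Lemma endo_brace_mlin e : multilinear (@endo_brace k W e).
Proof.
move=> s t a x y; apply: val_inj; apply: funext => ws.
pose H eh := hsum (fun wh => insertion (fun t => endo_fun e (vals t)) eh wh) ws.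
suff hH : hmultilinear H by exact: (hsum_multilinear hH).
move=> w1 w2 i b p q; rewrite /H -hsum_comb; apply: eq_hsum => wh.
exact: (insertion_hml_es wh (hml_vals (endo_fun_mlin e))).
Qed.

Lemma endo_brace_linear es : linear (fun e => @endo_brace k W e es).
Proof.
move=> a e e'; apply: val_inj; apply: funext => ws.
rewrite -[RHS]/(a *: endo_brace_fun e es ws + endo_brace_fun e' es ws).
rewrite -[LHS]/(endo_brace_fun _ es ws) /endo_brace_fun -hsum_comb; apply: eq_hsum => eh.
rewrite -hsum_comb; apply: eq_hsum => wh; rewrite -insertion_comb.
by apply: eq_insertion.
Qed.

(** b_{m,1} vanishes on E(W) for m > 1, so the second correction term survives on one-letter words
    only. *)
Lemma endo_deform (e0 : E) (t : hword E) : hwf t -> t != [::] ->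
  deform (@endo_b k W) (fun=> 0) e0 (vals t) = endo_brace e0 (vals t) +
    if t is [:: p] then (-1) ^ (p.1 + 1) *: endo_brace p.2 [:: e0] else 0.
Proof.
move=> ht t0; rewrite /deform hsum_vals //.
  case: t t0 {ht} => [|p [|q t]] //= _; rewrite add0r ?scaler0 //.
  by rewrite deg_cons [deg [::]]big_nil addr0.
move=> w1 w2 i a x y; rewrite !add0r !(deg_cat, deg_cons) !vals_cat.
have vE z : vals ((i, z) :: w2) = z :: vals w2 by [].
rewrite !vE {vE}.
have vB z : endo_b [:: e0] (vals w1 ++ z :: vals w2) = endo_brace e0 (vals w1 ++ z :: vals w2).
  by case: (w1) => [|p v1]; case: (w2).
rewrite !vB {vB} endo_brace_mlin scalerDr addrACA; congr (_ + _).
case: w1 w2 => [|p [|q w1]] [|p' w2] /=; rewrite ?scaler0 ?addr0 //.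
by rewrite endo_brace_linear !scalerDr !scalerA mulrC.
Qed.

(** The unit terms b_{1,0} and b_{0,1} give [e0 - e0]: the deformation creates no operation without
    inputs. *)
Lemma endo_deform0 (e0 : E) : deform (@endo_b k W) (fun=> 0) e0 [::] = 0.
Proof. by rewrite /deform /= [deg [::]]big_nil !add0r expr1z scaleN1r subrr. Qed.

Lemma cogenpart_hom i (x : T) : ghom i x -> ghom i (cogenpart x : W).
Proof.
have cL := @cogenpart_linear k W.
move: x; apply: tens_homog_ind => [|x y hx hy|w hw _ <-].
- by rewrite (lin0 cL); exact: ghom0.
- by rewrite (linD cL); exact: ghomD.
rewrite cogenpart_word; case: w hw => [|p [|q w]] /= hw; try exact: ghom0.
by rewrite deg_cons [deg [::]]big_nil addr0; case/hwf_cons: hw.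
Qed.

Section Ext.
Variables (B : gspace k) (mu : seq B -> E).
Hypotheses (muD : multilinear_deg 0 mu) (mu0 : mu [::] = 0).
Local Notation beta := (ext (@ins k W) mu).

Let iL := @ins_linear k W.
Let iM := @ins_hml k W.
Let i0 := @ins_nil k W.
Let betaE := extE iM muD.
Let betaL s : linear (beta s) := @ext_lin _ _ _ _ _ iL mu s.

Lemma ext_coaction : coaction_on_words beta.
Proof.
move=> v w hv hw; rewrite (ext_act2 iM muD (i := fun j => deg (take j w))
  (a1 := fun j => wordh (take j w)) (a2 := fun j => wordh (drop j w))
  (r := index_iota 0 (size w).+1) (@tpair_linl k T) (@tpair_linr k T)
  (@deconc_linear k W)) //.
by move=> es _; rewrite deconc_ins.
Qed.

(** Only the one-letter component [mu (vals v)] of \hat mu(v) is seen: inserting two or more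
    endomorphisms leaves at least two letters. *)
Lemma cogenpart_ext (v : hword B) (w : hword W) : hwf v -> hwf w -> v != [::] ->
  cogenpart (beta (vals v) (wordh w)) = endo_fun (mu (vals v)) (vals w).
Proof.
move=> hv hw v0; rewrite betaE // (cmap1_lin _ _ _ (@cogenpart_linear k W)).
rewrite (eq_cmap1 (G := fun t => if t is [:: p] then endo_fun p.2 (vals w) else 0)).
  by rewrite (cmap1_cogen mu (fun p => endo_fun p.2 (vals w))).
move=> [|p [|q t]] _ nt _; first by case: (v) nt v0.
  exact: cogenpart_ins.
exact: cogenpart_ins2.
Qed.

Lemma tlift_mu (v : hword B) x : hwf v -> v != [::] ->
  tlift (endo_fun (mu (vals v))) x = cogenpart (beta (vals v) x).
Proof. by move=> hv v0; apply: tlift_cogen => // w hw; exact: cogenpart_ext. Qed.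

Lemma endo_brace_ext (e : E) (v : hword B) (w : hword W) : hwf v -> hwf w ->
  endo_fun (cmap1 mu (fun t => endo_brace e (vals t)) v) (vals w) =
  tlift (endo_fun e) (beta (vals v) (wordh w)).
Proof.
move=> hv hw; have eM := endo_fun_mlin e.
rewrite betaE // (cmap1_lin _ _ _ (@endo_fun_linear (vals w))).
rewrite (cmap1_lin _ _ _ (tlift_linear eM)); apply: eq_cmap1 => t _ _ ht.
rewrite endo_braceE //; last exact: ht.
by apply: insertion_ins => //; exact: endo_fun_nil.
Qed.

(** Evaluation on w. On the right, b_{m,n} vanishes for m > 1, n >= 1, so \hat mu(u) enters through
    its one-letter component; its brace with \hat mu(v) is the cogenerator part of u acting after
    v. *)
Lemma endo_mulP (b : seq B -> seq B -> B) :
  (forall u v : hword B, hwf u -> hwf v -> ghom (deg u + deg v) (b (vals u) (vals v))) ->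
  (forall u v : hword B, hwf u -> hwf v -> u != [::] -> v != [::] ->
     cmap b (fun t => mu (vals t)) u v = cmap11 mu (@endo_b k W) u v) <->
  (forall (u v : hword B) (w : hword W), hwf u -> hwf v -> hwf w -> u != [::] -> v != [::] ->
     cogenpart (cmap b (fun t => beta (vals t) (wordh w)) u v) =
     cogenpart (beta (vals u) (beta (vals v) (wordh w)))).
Proof.
move=> bD.
have EL u v w : hwf u -> hwf v -> hwf w -> u != [::] -> v != [::] ->
    endo_fun (cmap b (fun t => mu (vals t)) u v) (vals w) =
    cogenpart (cmap b (fun t => beta (vals t) (wordh w)) u v).
  move=> hu hv hw u0 v0; rewrite (cmap_lin _ _ _ _ (@endo_fun_linear (vals w))).
  rewrite (cmap_lin _ _ _ _ (@cogenpart_linear k W)); apply: eq_cmap => t _ nt ht.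
  rewrite cogenpart_ext //; first exact: ht.
  by case: (t) nt; case: (u) u0.
have ER u v w : hwf u -> hwf v -> hwf w -> u != [::] -> v != [::] ->
    endo_fun (cmap11 mu (@endo_b k W) u v) (vals w) =
    cogenpart (beta (vals u) (beta (vals v) (wordh w))).
  move=> hu hv hw u0 v0; rewrite -tlift_mu // -endo_brace_ext //; congr (endo_fun _ _).
  rewrite /cmap11 (eq_cmap1 (G := fun s => if s is [:: p] then
     cmap1 mu (fun t => endo_brace p.2 (vals t)) v else 0)).
    by rewrite (cmap1_cogen mu (fun p => cmap1 mu (fun t => endo_brace p.2 (vals t)) v)).
  move=> [|p [|q s]] _ ns _; first by case: (u) ns u0.
    by apply: eq_cmap1 => t _ nt _; case: t nt; case: (v) v0.
  rewrite -[RHS](cmap1_0 mu _ v); apply: eq_cmap1 => t _ nt _.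
  by case: t nt => [|x [|y t]]; case: (v) v0.
split=> h u v; first by move=> w hu hv hw u0 v0; rewrite -EL // h // ER.
move=> hu hv u0 v0; apply: endo_eqP => w hw; rewrite EL // ER //; exact: h.
Qed.

(** Since [dC] is the insertion of [e0], the term b_{1,n} of the deformation evaluates to [dC] after
    the action of v, and b_{1,1} to the action of v after [dC]; the deformation sign is that of the
    module axiom. *)
Lemma endo_diffP (d : seq B -> B) (dC : T -> T) (e0 : E) : multilinear_deg 1 d ->
  dg_coalgebra (C := T) (@deconc k W) dC -> cogenerates e0 dC ->
  (forall v : hword B, hwf v -> v != [::] -> codiff d (fun t => mu (vals t)) v =
     cmap1 mu (fun t => deform (@endo_b k W) (fun=> 0) e0 (vals t)) v) <->
  (forall (v : hword B) (w : hword W), hwf v -> hwf w -> v != [::] ->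
     cogenpart (dC (beta (vals v) (wordh w))) =
     cogenpart (codiff d (fun t => beta (vals t) (wordh w)) v +
                (-1) ^ deg v *: beta (vals v) (dC (wordh w)))).
Proof.
move=> dD hC he; have [[dL dCD] _] := dgc_diff hC; have cL := @cogenpart_linear k W.
have EL v w : hwf v -> hwf w -> v != [::] ->
    endo_fun (codiff d (fun t => mu (vals t)) v) (vals w) =
    cogenpart (codiff d (fun t => beta (vals t) (wordh w)) v).
  move=> hv hw v0; rewrite (codiff_lin _ _ _ (@endo_fun_linear (vals w))).
  rewrite (codiff_lin _ _ _ cL); apply: eq_codiff => t _ nt ht.
  by rewrite cogenpart_ext //; exact: ht.
(* [cogenerates] is only an equation; [e0] inherits degree 1 from [dC]. *)
have he1 : ghom 1 (e0 : E).
  split; last exact: endo_fun_nil.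
  split=> [|w hw]; first exact: endo_fun_mlin.
  rewrite -[X in ghom _ X]/(endo_fun e0 (vals w)) he; apply/cogenpart_hom/dCD.
  exact: wordh_hom.
have ER v w : hwf v -> hwf w -> v != [::] ->
    endo_fun (cmap1 mu (fun t => deform (@endo_b k W) (fun=> 0) e0 (vals t)) v) (vals w) =
    cogenpart (dC (beta (vals v) (wordh w))) -
    (-1) ^ deg v *: cogenpart (beta (vals v) (dC (wordh w))).
  move=> hv hw v0.
  rewrite (eq_cmap1 (G := fun t => endo_brace e0 (vals t) +
    if t is [:: p] then (-1) ^ (p.1 + 1) *: endo_brace p.2 [:: e0] else 0)); last first.
    move=> t _ nt ht; apply: endo_deform; first exact: ht.
    by case: (t) nt; case: (v) v0.
  rewrite [cmap1 _ _ _]cmapD -!/(cmap1 _ _ _) (linD (@endo_fun_linear (vals w))).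
  rewrite endo_brace_ext // (tlift_cogen (g := dC)) //.
  rewrite (cmap1_cogen mu (fun p => (-1) ^ (p.1 + 1) *: endo_brace p.2 [:: e0])) //.
  rewrite (linZ (@endo_fun_linear (vals w))) signD expr1z mulrN1 scaleNr.
  congr (_ - _ *: _).
  rewrite -[[:: e0]]/(vals [:: (1, e0)]) endo_braceE //; last by apply/hwf_cons.
  rewrite (insertion_ins _ (endo_fun_mlin _) (endo_fun_nil _)) //.
  by rewrite -(dC_ins hC he) tlift_mu.
split=> h v => [w hv hw v0|hv v0].
  by rewrite (linD cL) (linZ cL) -EL // h // ER // subrK.
by apply: endo_eqP => w hw; rewrite EL // ER // h // (linD cL) (linZ cL) addrK.
Qed.

End Ext.
End EndoMorphism.

(** * The bijection for the cofree coalgebra *)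

Section CoalgebraBijection.
Variables (k : fieldType) (W B : gspace k).
Local Notation E := (endo W).
Local Notation T := (tensor W).

(** The default 0 is taken when the map is not a finite sum of homogeneous ones; [endo_of_fun]
    excludes this for the maps coming from an action. *)
Definition endo_of (f : T -> T) : E := insubd (0 : E) (fun ws => cogenpart (f (word ws))).

(** The empty word is sent to 0, as [bmor_0] demands, although the action has [beta [::]] equal to
    the identity. *)
Definition endo_family (beta : seq B -> T -> T) (s : seq B) : E :=
  if s is [::] then 0 else endo_of (beta s).

Section Family.
Variable beta : seq B -> T -> T.
Hypothesis betaL : forall s, linear (beta s).
Hypothesis betaM : forall x, multilinear (beta^~ x).
Hypothesis betaD : forall (v : hword B) i x, hwf v -> ghom i x ->
  ghom (deg v + i) (beta (vals v) x).

Lemma endo_of_gr (v : hword B) : hwf v ->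
  endo_gr (deg v) (fun ws => cogenpart (beta (vals v) (word ws))).
Proof.
move=> hv; split; last by rewrite word0 (lin0 (betaL _)) (lin0 (@cogenpart_linear k W)).
split=> [s t a x y|w hw]; first by rewrite word_multilinear betaL cogenpart_linear.
by rewrite addrC; apply/cogenpart_hom/betaD => //; exact: wordh_hom.
Qed.

(** Splitting the letters of s into homogeneous components writes the map as a finite sum of
    homogeneous ones, so it lies in E(W). *)
Lemma endo_of_fun s ws : endo_fun (endo_of (beta s)) ws = cogenpart (beta s (word ws)).
Proof.
rewrite /endo_fun /endo_of -[sval]/val insubdK //.
have [vs hvs EL] := hsum_list W s.
have -> : (fun ws => cogenpart (beta s (word ws))) =
    \sum_(v <- vs) (fun ws => cogenpart (beta (vals v) (word ws))).
  apply: funext => u; rewrite fct_sumE -EL.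
  rewrite (hsum_valsE s (f := fun s => cogenpart (beta s (word u)))) //.
  by move=> s1 s2 a x y; rewrite betaM cogenpart_linear.
rewrite big_seq rpred_sum // => v /hvs hv.
exact: (gsum_homog (G := Grading (@endo_gr_comb k W) (@endo_gr0 k W) (@endo_gr_direct k W))
  (endo_of_gr hv)).
Qed.

Lemma endo_family_mlin : multilinear (endo_family beta).
Proof.
move=> s t a x y; have c0 z : endo_family beta (s ++ z :: t) = endo_of (beta (s ++ z :: t)).
  by case: s.
rewrite !c0; apply: endo_eqP => w _.
by rewrite (@endo_fun_linear k W (vals w)) !endo_of_fun betaM cogenpart_linear.
Qed.

Lemma endo_family_deg : multilinear_deg 0 (endo_family beta).
Proof.
split=> [|v hv]; first exact: endo_family_mlin.
rewrite addr0; case: v hv => [|p v] hv; first exact: ghom0.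
have /= := endo_of_gr hv; congr (endo_gr _ _); apply: funext => ws.
by rewrite -endo_of_fun.
Qed.

End Family.

Variables (b : seq B -> seq B -> B) (d : seq B -> B) (hB : binf_algebra b d).
Variables (dC : T -> T) (hC : dg_coalgebra (C := T) (@deconc k W) dC).
Variables (e0 : E) (he0 : cogenerates e0 dC).

Let bU : unital b.
Proof. by case: hB => *; split=> //; auto. Qed.

Lemma endo_family_ext beta :
  action_on_coalgebra b d (C := T) (@deconc k W) dC beta ->
  beta = ext (@ins k W) (endo_family beta).
Proof.
case=> -[bL bM bD b1 _ _] /(coactionP bL) co.
have muD := endo_family_deg bL bM bD.
apply: coaction_uniq => //.
- by move=> s; exact/ext_lin/ins_linear.
- by move=> x; exact/ext_mlin/muD/ins_hml.
- exact: ext_coaction.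
move=> v w hv hw; case: (eqVneq v [::]) => [->|v0]; first by rewrite b1 ext_nil //; exact: ins_nil.
by rewrite cogenpart_ext //; case: v hv v0 => // p v hv _; rewrite endo_of_fun.
Qed.

Lemma ext_endo_family (mu : seq B -> E) : multilinear_deg 0 mu -> mu [::] = 0 ->
  endo_family (ext (@ins k W) mu) = mu.
Proof.
move=> muD mu0; set beta := ext _ _.
have bL s : linear (beta s) by exact/ext_lin/ins_linear.
have bM x : multilinear (beta^~ x) by exact/ext_mlin/muD/ins_hml.
have bD := ext_deg (@ins_hml k W) (@ins_deg k W) muD.
have fM := endo_family_mlin bL bM bD.
apply: funext => s; apply/eqP; rewrite -subr_eq0; apply/eqP.
apply: (mlin_vals0 (f := fun s => endo_family beta s - mu s)) => [s1 s2 a y z|v hv].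
  by rewrite fM (proj1 muD) opprD addrACA scalerBr.
apply/eqP; rewrite subr_eq0; apply/eqP.
case: (eqVneq v [::]) => [->|v0]; first by rewrite mu0.
apply: endo_eqP => w hw; rewrite -(cogenpart_ext muD) //.
by case: v hv v0 => // p v hv _; rewrite endo_of_fun.
Qed.

Lemma ext_action (mu : seq B -> E) :
  multilinear_deg 0 mu -> mu [::] = 0 ->
  action_on_coalgebra b d (C := T) (@deconc k W) dC (ext (@ins k W) mu) <->
  binf_morphism b d (@endo_b k W) (deform (@endo_b k W) (fun=> 0) e0) mu.
Proof.
move=> muD mu0; set beta := ext _ _; have [muM _] := muD.
have bL s : linear (beta s) by exact/ext_lin/ins_linear.
have bM x : multilinear (beta^~ x) by exact/ext_mlin/muD/ins_hml.
have bh x : hmultilinear (fun t => beta (vals t) x) by exact: (hml_vals (bM x)).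
have bD := ext_deg (@ins_hml k W) (@ins_deg k W) muD.
have b1 := ext_nil (@ins_nil k W) mu.
have co := ext_coaction muD; have b00 : b [::] [::] = 0 by case: bU.
have mulP := iff_trans (bmor_mulP muM mu0 bU (endo_b_unital W)) (endo_mulP muD (binf_deg hB)).
have diffP := iff_trans (bmor_diffP mu0 d (endo_deform0 e0))
  (endo_diffP muD (binf_d hB) hC he0).
split=> [[[_ _ _ _ bA bDi] _]|[_ _ Di Mu]].
  split=> //.
    apply/diffP => v w hv hw v0; have := bDi v (wordh w) hv v0.
    by rewrite dhatE => <-.
  apply/mulP => u v w hu hv hw u0 v0; rewrite -/beta -bA // bprodE //.
  by case: (u) u0.
split; last by apply/(coactionP bL).
split=> // [u v x hu hv u0 v0|v x hv v0].
  rewrite bprodE //; last by case: (u) u0.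
  apply: coaction_assoc => //; [exact: binf_deg hB|exact/mulP].
rewrite dhatE; apply: coaction_diff => //; [exact: binf_d hB|exact/diffP].
Qed.

Lemma coalgebra_bij : set_bij
  [set beta | action_on_coalgebra b d (C := T) (@deconc k W) dC beta]
  [set mu | binf_morphism b d (@endo_b k W) (deform (@endo_b k W) (fun=> 0) e0) mu]
  endo_family.
Proof.
split=> [beta /= hbeta|beta beta' /set_mem h /set_mem h' E'|mu /= hmu].
- have [[bL bM bD _ _ _] _] := hbeta.
  by apply/ext_action; rewrite -?endo_family_ext //; exact: endo_family_deg.
- by rewrite (endo_family_ext h) (endo_family_ext h') E'.
- have [muD mu0 _ _] := hmu.
  by exists (ext (@ins k W) mu); [exact/ext_action|exact: ext_endo_family].
Qed.

End CoalgebraBijection.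

Lemma word_cons (k : fieldType) (V : gspace k) (p : int * V) (w : hword V) :
  w != [::] -> wordh (p :: w) = tmul (wordh [:: p]) (wordh w).
Proof. by move=> w0; rewrite tmul_word //; case: (w) w0. Qed.

Lemma letter_word_hom (k : fieldType) (V : gspace k) i (x : V) :
  ghom i x -> ghom i (word [:: x] : tensor V).
Proof.
move=> hx; have /wordh_hom : hwf [:: (i, x)] by apply/hwf_cons.
by rewrite deg_cons [deg [::]]big_nil addr0.
Qed.

(** T(W) is generated by W, so products with a letter on the left replace the coproduct induction
    used for T^c(W). *)
Lemma word_ind (k : fieldType) (V : gspace k) (P : tens V -> Prop) :
  P 0 ->
  (forall i (x : V), ghom i x -> P (word [:: x])) ->
  (forall i (x : V) y, ghom i x -> P (word [:: x]) -> P y -> P (tmul (word [:: x]) y)) ->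
  forall w : hword V, hwf w -> P (wordh w).
Proof.
move=> P0 P1 PM; elim=> [|p w IH]; first by rewrite /wordh word0.
case/hwf_cons=> hp hw; case: (eqVneq w [::]) => [->|w0]; first exact: P1 hp.
by rewrite word_cons //; exact: (PM _ _ _ hp (P1 _ _ hp) (IH hw)).
Qed.

(** * Actions on the free algebra *)

Section AlgebraAction.
Variables (k : fieldType) (B W : gspace k).
Local Notation T := (tensor W).
Variable beta : seq B -> T -> T.
Hypothesis betaL : forall s, linear (beta s).
Local Notation mact := (act2 (T := T) (N := T) (@tmul k W) beta).

Let mL (y : T) : linear ((@tmul k W : T -> T -> T)^~ y).
Proof. exact: (@tmul_linear_l k W). Qed.
Let mR (x : T) : linear ((@tmul k W : T -> T -> T) x).
Proof. exact: (@tmul_linear_r k W). Qed.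

Definition acts_on_products (beta : seq B -> T -> T) :=
  forall (v : hword B) i (a1 a2 : T), hwf v -> ghom i a1 ->
    beta (vals v) (tmul a1 a2) = act2 (T := T) (N := T) (@tmul k W) beta v i a1 a2.

Hypotheses (betaM : forall x, multilinear (beta^~ x)) (beta0 : forall x, beta [::] x = x).
Hypothesis betaD : forall (v : hword B) i x, hwf v -> ghom i x ->
  ghom (deg v + i) (beta (vals v) x).
Hypothesis betaA : acts_on_products beta.

Lemma action_uniq (beta' : seq B -> T -> T) :
  (forall s, linear (beta' s)) -> (forall x, multilinear (beta'^~ x)) ->
  acts_on_products beta' ->
  (forall (v : hword B) i (x : W), hwf v -> ghom i x ->
    beta (vals v) (word [:: x]) = beta' (vals v) (word [:: x])) ->
  beta = beta'.
Proof.
move=> bL' bM' bA' E.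
suff h (w : hword W) : hwf w -> forall v : hword B, hwf v ->
    beta (vals v) (wordh w) = beta' (vals v) (wordh w).
  apply: funext => s; apply: funext => x; apply/eqP; rewrite -subr_eq0; apply/eqP.
  apply: (mlin_vals0 (f := fun s => beta s x - beta' s x)) => [s1 s2 a y z|v hv].
    by rewrite betaM bM' opprD addrACA scalerBr.
  apply/eqP; rewrite subr_eq0; apply/eqP.
  apply: (tens_lin_eq (f := beta (vals v)) (g := beta' (vals v))) x => // w hw _; exact: h.
move: w; apply: (@word_ind _ W (fun y => forall v : hword B, hwf v ->
  beta (vals v) y = beta' (vals v) y)) => [v hv|i x hx v hv|i x y hx h1 h2 v hv].
- by rewrite (lin0 (betaL _)) (lin0 (bL' _)).
- exact: E hx.
rewrite (betaA _ hv (letter_word_hom hx)) (bA' _ _ _ _ hv (letter_word_hom hx)).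
apply: eq_dec => v1 v2 Ev; have /hwf_cat[hv1 hv2] : hwf (v1 ++ v2) by rewrite Ev.
by rewrite h1 // h2.
Qed.

(** Both composites satisfy the same rule on products, by the action axiom and [act2_assoc]; hence
    letters suffice. *)
Lemma action_assoc (b : seq B -> seq B -> B) (u v : hword B) x :
  (forall u v : hword B, hwf u -> hwf v -> ghom (deg u + deg v) (b (vals u) (vals v))) ->
  unital b ->
  (forall (u v : hword B) i (x : W), hwf u -> hwf v -> u != [::] -> v != [::] -> ghom i x ->
     cmap b (fun t => beta (vals t) (word [:: x])) u v =
     beta (vals u) (beta (vals v) (word [:: x]))) ->
  hwf u -> hwf v ->
  cmap b (fun t => beta (vals t) x) u v = beta (vals u) (beta (vals v) x).
Proof.
move=> bD [b0 b1 b1' b2 b2'] E hu hv.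
have bM y : hmultilinear (fun t => beta (vals t) y) by exact: hml_vals (betaM y).
apply: (tens_lin_eq (f := fun x => cmap b (fun t => beta (vals t) x) u v)
  (g := fun x => beta (vals u) (beta (vals v) x))) x => [a y z|a y z|w hw _].
- by rewrite -cmap_comb; apply: eq_cmap => t _ _ _; exact: betaL.
- by rewrite !betaL.
move: w hw u v hu hv.
apply: (@word_ind _ W (fun y => forall u v : hword B, hwf u -> hwf v ->
  cmap b (fun t => beta (vals t) y) u v = beta (vals u) (beta (vals v) y))) => [u v hu hv|i x hx u v hu hv|i x y hx h1 h2 u v hu hv].
- rewrite !(lin0 (betaL _)) -[RHS](cmap0 b T u v); apply: eq_cmap => t _ _ _.
  exact: lin0 (betaL _).
- case: (eqVneq u [::]) => [->|u0]; first by rewrite cmap_unit_l // beta0.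
  case: (eqVneq v [::]) => [->|v0]; first by rewrite cmap_unit_r // beta0.
  exact: E hx.
have hx' := letter_word_hom hx.
rewrite (eq_cmap (G := fun t => mact t i (word [:: x]) y)); last first.
  by move=> t _ _ ht; rewrite (betaA _ _ hx') //; exact: ht.
rewrite (act2_assoc mL mR) // (betaA _ hv hx').
rewrite (dec_lin _ _ (betaL _)); apply: eq_dec => v1 v2 Ev.
have /hwf_cat[hv1 hv2] : hwf (v1 ++ v2) by rewrite Ev.
by rewrite (linZ (betaL _)) (betaA _ hu (betaD hv1 hx')).
Qed.

Lemma action_diff (d : seq B -> B) (dA : T -> T) (v : hword B) x :
  dg_algebra (A := T) (@tmul k W) dA -> multilinear_deg 1 d ->
  (forall (v : hword B) i (x : W), hwf v -> v != [::] -> ghom i x ->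
     dA (beta (vals v) (word [:: x])) =
     codiff d (fun t => beta (vals t) (word [:: x])) v +
     (-1) ^ deg v *: beta (vals v) (dA (word [:: x]))) ->
  hwf v ->
  dA (beta (vals v) x) =
    codiff d (fun t => beta (vals t) x) v + (-1) ^ deg v *: beta (vals v) (dA x).
Proof.
move=> hA dD E hv; have [[dL dAD] _] := dga_diff hA.
apply: (tens_lin_eq (f := fun x => dA (beta (vals v) x))
  (g := fun x => codiff d (fun t => beta (vals t) x) v +
     (-1) ^ deg v *: beta (vals v) (dA x))) x => [a y z|a y z|w hw _].
- by rewrite betaL dL.
- rewrite dL betaL (eq_codiff (G := fun t => a *: beta (vals t) y + beta (vals t) z)).
    by rewrite codiff_comb !scalerDr !scalerA addrACA [_ * a]mulrC.
  by move=> t _ _ _; exact: betaL.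
move: w hw v hv.
apply: (@word_ind _ W (fun y => forall v : hword B, hwf v -> dA (beta (vals v) y) =
  codiff d (fun t => beta (vals t) y) v + (-1) ^ deg v *: beta (vals v) (dA y))) => [v hv|i x hx v hv|i x y hx h1 h2 v hv].
- rewrite !(lin0 (betaL _)) (lin0 dL) (lin0 (betaL _)) scaler0 addr0.
  rewrite -[LHS](codiff0 d T v); apply: eq_codiff => t _ _ _.
  by rewrite (lin0 (betaL _)).
- case: (eqVneq v [::]) => [->|v0]; last exact: E hx.
  by rewrite /= !beta0 add0r [deg [::]]big_nil expr0z scale1r.
have hx' := letter_word_hom hx.
rewrite (eq_codiff (G := fun t => mact t i (word [:: x]) y)); last first.
  by move=> t _ _ ht; rewrite (betaA _ _ hx') //; exact: ht.
rewrite (betaA _ hv hx') (dga_leibniz hA _ hx') (linD (betaL _)) (linZ (betaL _)).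
rewrite (betaA _ hv hx') (betaA _ hv (dAD _ _ hx')).
rewrite -(act2_diff mL mR) //.
rewrite (dec_lin _ _ dL); apply: eq_dec => v1 v2 Ev.
have /hwf_cat[hv1 hv2] : hwf (v1 ++ v2) by rewrite Ev.
by rewrite (linZ dL) (dga_leibniz hA _ (betaD hv1 hx')).
Qed.

End AlgebraAction.

(** * Application of co-endomorphisms to the letters of a word *)

Section Application.
Variables (k : fieldType) (W : gspace k).
Local Notation E := (coendo W).
Local Notation T := (tensor W).

Lemma application_cons (M : lmodType k) (F : hword T -> M) e es x ws :
  application F (e :: es) (x :: ws) =
  (-1) ^ (deg (e :: es) * x.1) *: application (fun t => F (letter x :: t)) (e :: es) ws +
  (-1) ^ (deg es * x.1) *:
    application (fun t => F ((e.1 + x.1, coendo_fun e.2 x.2) :: t)) es ws.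
Proof.
rewrite /= big_nat_recl //= take0 addrC; congr (_ + _).
  rewrite scaler_sumr; apply: eq_bigr => j _; case: drop => [|y r]; first by rewrite scaler0.
  rewrite scalerA -signD !deg_cons; congr (_ *: _).
  by congr (_ ^ _); ring.
by rewrite deg_cons [deg [::]]big_nil mulr0 add0r addr0.
Qed.

(** Application preserves the number of entries. This guarantees non-empty factors where [tprod_cat]
    is used, T(W) having no unit. *)
Lemma eq_application_size (M : lmodType k) (F G : hword T -> M) (es : hword E) ws :
  (forall t, size t = size ws -> F t = G t) -> application F es ws = application G es ws.
Proof.
elim: ws es F G => [|x ws IH] [|e es] F G h.
- exact: h.
- by rewrite /= !big_geq.
- by apply: h; rewrite /= size_map.
rewrite !application_cons.
by congr (_ *: _ + _ *: _); apply: IH => t ht; apply: h; rewrite /= ht.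
Qed.

Lemma application_lin (M N : lmodType k) (g : M -> N) (F : hword T -> M) (es : hword E) ws :
  linear g -> g (application F es ws) = application (fun t => g (F t)) es ws.
Proof.
move=> gL; elim: ws es F => [|x ws IH] [|e es] F //.
  by rewrite /= !big_geq // (lin0 gL).
by rewrite !application_cons (linD gL) !(linZ gL) !IH.
Qed.

(** As the order of es is kept, those acting on [ws1] form an initial segment; the others pass
    [ws1], whence the sign. *)
Lemma application_cat (M : lmodType k) (F : hword T -> M) (es : hword E) ws1 ws2 :
  application F es (ws1 ++ ws2) = dec (fun es1 es2 => (-1) ^ (deg ws1 * deg es2) *:
    application (fun s => application (fun t => F (s ++ t)) es2 ws2) es1 ws1) es.
Proof.
elim: ws1 es F => [|x ws1 IH] es F.
  rewrite dec_first => [|e a c]; first by rewrite /= [deg [::]]big_nil mul0r expr0z scale1r.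
  by rewrite /= big_geq // scaler0.
case: es => [|e es].
  by rewrite dec_nil /= map_cat [deg [::]]big_nil mulr0 expr0z scale1r.
rewrite cat_cons application_cons !IH !dec_cons scalerDr -addrA; congr (_ + _).
  by rewrite scalerA -signD deg_cons [in RHS]deg_cons; congr (_ *: _); congr (_ ^ _); ring.
rewrite !dec_scale -decD; apply: eq_dec => a c Ea.
rewrite application_cons scalerDr !scalerA -!signD -Ea.
by congr (_ ^ _ *: _ + _ ^ _ *: _); rewrite !deg_cons ?deg_cat; ring.
Qed.

Lemma tprod_cat (s t : seq T) : s != [::] -> t != [::] ->
  tprod (s ++ t) = tmul (tprod s) (tprod t).
Proof.
have tA (x y z : tens W) : tmul (tmul x y) z = tmul x (tmul y z).
  have [ws hws ->] := tens_words z; rewrite !(lin_sum (@tmul_linear_r k W _)).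
  apply: eq_big_seq => w3 /hws[_ n3].
  have [{}ws {}hws ->] := tens_words y.
  rewrite (lin_sum (@tmul_linear_r k W x)) !(lin_sum (@tmul_linear_l k W _)).
  rewrite (lin_sum (@tmul_linear_r k W x)).
  apply: eq_big_seq => w2 /hws[_ n2].
  have [{}ws {}hws ->] := tens_words x.
  rewrite !(lin_sum (@tmul_linear_l k W _)); apply: eq_big_seq => w1 /hws[_ n1].
  have n (w : hword W) : w != [::] -> vals w != [::] by case: w.
  by rewrite !tmul_word ?catA ?n //; case: (w1) (w2) n1 n2 => [|p u1] [|q u2].
case: s => [|x s] // _; case: t => [|y t] // _ /=.
rewrite foldl_cat /=; elim: t y (foldl _ x s) => [|z t IH] y r //=.
by rewrite tA IH.
Qed.

End Application.

(** * Morphisms into the co-endomorphism algebra *)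

Section AppMap.
Variables (k : fieldType) (W : gspace k).
Local Notation E := (coendo W).
Local Notation T := (tensor W).
Local Notation tprodh := (fun t : hword T => tprod (vals t)).

Let pM : hmultilinear tprodh := @hml_vals _ T _ _ (@tprod_mlin k W).
Definition appT (es : hword E) (x : T) : T := app_map es x.

Lemma appT_linear es : linear (appT es).
Proof. exact: app_map_linear. Qed.

Let aL := appT_linear.

Lemma app_word es (w : hword W) : hwf w -> appT es (wordh w) = application tprodh es w.
Proof.
move=> hw; case: (eqVneq w [::]) => [->|w0].
  rewrite /wordh word0 (lin0 (aL es)); case: es => [|e es] //=.
  by rewrite big_geq.
by rewrite /appT /app_map tlin_word //; exact: application_hml.
Qed.

Lemma app_hml (x : T) : hmultilinear (appT^~ x).
Proof.
have [ws hws ->] := tens_words x => w1 w2 i a y z.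
rewrite !(lin_sum (aL _)) scaler_sumr -big_split; apply: eq_big_seq => w /hws[hw _].
by rewrite !app_word //=; apply: (application_hml_es w pM).
Qed.

Lemma app_deg es i (x : T) : hwf es -> ghom i x -> ghom (deg es + i) (appT es x : T).
Proof.
move=> hes hx; rewrite addrC; apply: (@tlin_deg _ _ T) hx; first exact: application_hml.
move=> w hw; rewrite addrC -[_ + _]addr0; apply: application_deg => // v hv.
by rewrite addr0; exact: tprod_deg.
Qed.

Lemma app_tmul es i (a1 a2 : T) : ghom i a1 -> appT es (tmul a1 a2) =
  dec (fun es1 es2 => (-1) ^ (i * deg es2) *: tmul (appT es1 a1) (appT es2 a2)) es.
Proof.
pose R a1 a2 : T := dec (fun es1 es2 =>
  (-1) ^ (i * deg es2) *: tmul (appT es1 a1) (appT es2 a2)) es.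
have Rl y : linear (R^~ y).
  move=> a x z; rewrite /R dec_scale -decD; apply: eq_dec => e1 e2 _.
  by rewrite aL tmul_linear_l scalerDr !scalerA mulrC.
have Rr x : linear (R x).
  move=> a y z; rewrite /R dec_scale -decD; apply: eq_dec => e1 e2 _.
  by rewrite aL tmul_linear_r scalerDr !scalerA mulrC.
move: a1; apply: tens_homog_ind => [|x y hx hy|w1 hw1 w10 dw1].
- by rewrite (lin0 (@tmul_linear_l k W _)) (lin0 (aL _)) -/(R 0 a2) (lin0 (Rl a2)).
- by rewrite (linD (@tmul_linear_l k W _)) (linD (aL _)) hx hy -(linD (Rl a2)).
rewrite -/(R _ a2).
apply: (tens_lin_eq (f := fun a2 => appT es (tmul (word (vals w1)) a2))
  (g := R (word (vals w1)))) a2 => // [a y z|w2 hw2 w20].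
  by rewrite tmul_linear_r aL.
have nn (w : hword W) : w != [::] -> vals w != [::] by case: w.
rewrite /R tmul_word ?nn // -vals_cat app_word; last exact/hwf_cat.
rewrite application_cat; apply: eq_dec => e1 e2 _; rewrite dw1; congr (_ *: _).
rewrite -[word (vals w1)]/(wordh w1) !app_word //.
rewrite (application_lin _ _ _ (@tmul_linear_l k W _)); apply: eq_application_size => s ss.
rewrite (application_lin _ _ _ (@tmul_linear_r k W _)); apply: eq_application_size => t st.
rewrite vals_cat tprod_cat //.
  by case: (s) ss w10 => //; case: (w1).
by case: (t) st w20 => //; case: (w2).
Qed.

(** Distinct co-endomorphisms need distinct letters, so one letter admits at most one of them. *)
Lemma app_letter (es : hword E) i (x : W) : ghom i x -> appT es (word [:: x]) =
  match es with [::] => word [:: x] | [:: e] => coendo_fun e.2 x | _ => 0 end.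
Proof.
move=> hx; have hw : hwf [:: (i, x)] by apply/hwf_cons.
rewrite -[word _]/(wordh [:: (i, x)]) app_word //; case: es => [|e [|e' es]] //.
  by rewrite application_cons /= big_geq // scaler0 add0r [deg [::]]big_nil mul0r expr0z scale1r.
by rewrite application_cons /= !big_geq // !scaler0 addr0.
Qed.

Lemma app_nil (x : T) : appT [::] x = x.
Proof.
apply: (tens_lin_eq (f := appT [::]) (g := id)) x => [|a y z|w hw _] //.
apply: (@word_ind _ W (fun y => appT [::] y = y)) => // [|i x hx|i x y hx h1 h2].
- exact: lin0 (aL _).
- by rewrite (app_letter _ hx).
by rewrite (app_tmul _ _ (letter_word_hom hx)) dec_nil [deg [::]]big_nil mulr0 expr0z scale1r h1 h2.
Qed.

Lemma dA_app (dA : T -> T) (e0 : E) : dg_algebra (A := T) (@tmul k W) dA ->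
  generates e0 dA -> forall x, dA x = appT [:: (1, e0)] x.
Proof.
move=> hA he; have [[dL dAD] _] := dga_diff hA.
apply: tens_lin_eq => // w hw _.
apply: (@word_ind _ W (fun y => dA y = appT [:: (1, e0)] y)) => // [|i x hx|i x y hx h1 h2].
- by rewrite (lin0 dL) (lin0 (aL _)).
- by rewrite (app_letter _ hx) he.
rewrite (dga_leibniz hA _ (letter_word_hom hx)) (app_tmul _ _ (letter_word_hom hx)).
rewrite dec_cons dec_nil !app_nil h1 h2 addrC.
by rewrite !deg_cons ![deg [::]]big_nil /= addr0 mulr1 mulr0 expr0z scale1r.
Qed.

Lemma coendo_eqP (e e' : E) :
  (forall i (x : W), ghom i x -> coendo_fun e x = coendo_fun e' x) -> e = e'.
Proof.
move=> h; apply: val_inj; apply: funext => x; apply/eqP; rewrite -subr_eq0; apply/eqP.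
apply: (linear_vals0 (f := fun x => coendo_fun e x - coendo_fun e' x)) => [a y z|i y hy].
  by rewrite !coendo_fun_linear opprD addrACA scalerBr.
by rewrite (h _ _ hy) subrr.
Qed.

Lemma coendo_eval_linear x : linear (fun e : E => coendo_fun e x).
Proof. by []. Qed.

Lemma coendo_b_unital : unital (@coendo_b k W).
Proof. by split=> // -[|x [|y s]]. Qed.

Lemma coendo_brace_mlin e : multilinear ((@coendo_brace k W)^~ e).
Proof.
move=> s t a x y; apply: val_inj; apply: funext => z.
exact: (hsum_multilinear (app_hml (coendo_fun e z))).
Qed.

Lemma coendo_brace_linear es : linear (@coendo_brace k W es).
Proof.
move=> a e e'; apply: val_inj; apply: funext => z.
rewrite -[RHS]/(a *: coendo_brace_fun es e z + coendo_brace_fun es e' z).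
rewrite -[LHS]/(coendo_brace_fun es _ z) /coendo_brace_fun -hsum_comb.
by apply: eq_hsum => eh; rewrite -aL.
Qed.

Lemma coendo_brace_app (es : hword E) e x : hwf es ->
  coendo_fun (coendo_brace (vals es) e) x = appT es (coendo_fun e x).
Proof.
by move=> hes; exact: (hsum_vals (F := appT^~ (coendo_fun e x)) (app_hml _) hes).
Qed.

Lemma coendo_deform (e0 : E) (t : hword E) : hwf t -> t != [::] ->
  deform (@coendo_b k W) (fun=> 0) e0 (vals t) =
    (if t is [:: p] then coendo_brace [:: e0] p.2 else 0) +
    (-1) ^ (deg t + 1) *: coendo_brace (vals t) e0.
Proof.
move=> ht t0; rewrite /deform hsum_vals //.
  by case: t t0 {ht} => [|p [|q t]] //= _; rewrite add0r.
move=> w1 w2 i a x y; rewrite !add0r !(deg_cat, deg_cons) !vals_cat.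
have vE z : vals ((i, z) :: w2) = z :: vals w2 by [].
rewrite !vE {vE}.
have vB z : coendo_b (vals w1 ++ z :: vals w2) [:: e0] = coendo_brace (vals w1 ++ z :: vals w2) e0.
  by case: (w1) => [|p [|q v1]]; case: (w2).
rewrite !vB {vB} coendo_brace_mlin [a *: (_ + _)]scalerDr addrACA; congr (_ + _); last first.
  by rewrite scalerDr !scalerA mulrC.
case: w1 w2 => [|p [|q w1]] [|p' w2] /=; rewrite ?scaler0 ?addr0 //.
by rewrite coendo_brace_linear.
Qed.

Lemma coendo_deform0 (e0 : E) : deform (@coendo_b k W) (fun=> 0) e0 [::] = 0.
Proof. by rewrite /deform /= [deg [::]]big_nil !add0r expr1z scaleN1r subrr. Qed.

Section Ext.
Variables (B : gspace k) (mu : seq B -> E).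
Hypotheses (muD : multilinear_deg 0 mu) (mu0 : mu [::] = 0).
Local Notation beta := (ext appT mu).

Let betaE := extE app_hml muD.
Let betaL s : linear (beta s) := @ext_lin _ _ _ _ _ aL mu s.

Lemma ext_acts_on_products : acts_on_products beta.
Proof.
move=> v i a1 a2 hv h1.
rewrite (ext_act2 (g := id) app_hml muD (i := fun=> i)
  (a1 := fun=> a1) (a2 := fun=> a2) (r := [:: tt]) (Lam := @tmul k W : T -> T -> T)) //.
- by rewrite big_seq1.
- exact: (@tmul_linear_l k W).
- exact: (@tmul_linear_r k W).
- by move=> es _; rewrite big_seq1; exact: app_tmul.
Qed.

Lemma ext_letter (v : hword B) i (x : W) : hwf v -> v != [::] -> ghom i x ->
  beta (vals v) (word [:: x]) = coendo_fun (mu (vals v)) x.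
Proof.
move=> hv v0 hx; rewrite betaE //.
rewrite (eq_cmap1 (G := fun t => if t is [:: p] then coendo_fun p.2 x else 0)).
  by rewrite (cmap1_cogen mu (fun p => coendo_fun p.2 x : T)).
move=> t _ nt _; rewrite (app_letter _ hx).
by case: t nt => [|p [|q t]] //; case: (v) v0.
Qed.

Lemma coendo_brace_ext (e : E) (v : hword B) (x : W) : hwf v ->
  coendo_fun (cmap1 mu (fun t => coendo_brace (vals t) e) v) x =
  beta (vals v) (coendo_fun e x).
Proof.
move=> hv; rewrite betaE // (cmap1_lin _ _ _ (@coendo_eval_linear x)).
by apply: eq_cmap1 => t _ _ ht; apply/coendo_brace_app/ht.
Qed.

(** Here b_{m,n} vanishes for n > 1, m >= 1, so it is \hat mu(v) that enters through its one-letter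
    component: v acts on the letter first, then all of \hat mu(u) on the result. *)
Lemma coendo_mulP (b : seq B -> seq B -> B) :
  (forall u v : hword B, hwf u -> hwf v -> ghom (deg u + deg v) (b (vals u) (vals v))) ->
  (forall u v : hword B, hwf u -> hwf v -> u != [::] -> v != [::] ->
     cmap b (fun t => mu (vals t)) u v = cmap11 mu (@coendo_b k W) u v) <->
  (forall (u v : hword B) i (x : W), hwf u -> hwf v -> u != [::] -> v != [::] -> ghom i x ->
     cmap b (fun t => beta (vals t) (word [:: x])) u v =
     beta (vals u) (beta (vals v) (word [:: x]))).
Proof.
move=> bD.
have EL u v i x : hwf u -> hwf v -> u != [::] -> v != [::] -> ghom i x ->
    coendo_fun (cmap b (fun t => mu (vals t)) u v) x =
    cmap b (fun t => beta (vals t) (word [:: x])) u v.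
  move=> hu hv u0 v0 hx; rewrite (cmap_lin _ _ _ _ (@coendo_eval_linear x)).
  apply: eq_cmap => t _ nt ht; rewrite (ext_letter _ _ hx) //; first exact: ht.
  by case: (t) nt; case: (u) u0.
have ER u v i x : hwf u -> hwf v -> u != [::] -> v != [::] -> ghom i x ->
    coendo_fun (cmap11 mu (@coendo_b k W) u v) x =
    beta (vals u) (beta (vals v) (word [:: x])).
  move=> hu hv u0 v0 hx; rewrite (ext_letter hv v0 hx) -coendo_brace_ext //.
  congr (coendo_fun _ _); apply: eq_cmap1 => s _ ns _.
  rewrite (eq_cmap1 (G := fun t => if t is [:: p] then coendo_brace (vals s) p.2 else 0)).
    by rewrite (cmap1_cogen mu (fun p => coendo_brace (vals s) p.2)).
  move=> t _ nt _; case: s ns => [|p [|q s]]; first by case: (u) u0.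
    by case: t nt => [|p' [|q t]] //; case: (v) v0.
  by case: t nt => [|p' [|q' t]] //; case: (v) v0.
split=> h u v; first by move=> i x hu hv u0 v0 hx; rewrite -(EL _ _ _ _ hu hv u0 v0 hx) h // (ER _ _ _ _ hu hv u0 v0 hx).
move=> hu hv u0 v0; apply: coendo_eqP => i x hx.
by rewrite (EL _ _ _ _ hu hv u0 v0 hx) (ER _ _ _ _ hu hv u0 v0 hx); exact: (h _ _ i).
Qed.

(** The roles of the two correction terms are exchanged: b_{1,1} with [e0] on the left gives [dA]
    after the action of v, and b_{m,1} with [e0] on the right gives the action of v on [dA] of the
    letter. *)
Lemma coendo_diffP (d : seq B -> B) (dA : T -> T) (e0 : E) : multilinear_deg 1 d ->
  dg_algebra (A := T) (@tmul k W) dA -> generates e0 dA ->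
  (forall v : hword B, hwf v -> v != [::] -> codiff d (fun t => mu (vals t)) v =
     cmap1 mu (fun t => deform (@coendo_b k W) (fun=> 0) e0 (vals t)) v) <->
  (forall (v : hword B) i (x : W), hwf v -> v != [::] -> ghom i x ->
     dA (beta (vals v) (word [:: x])) =
     codiff d (fun t => beta (vals t) (word [:: x])) v +
     (-1) ^ deg v *: beta (vals v) (dA (word [:: x]))).
Proof.
move=> dD hA he; have [[dL dAD] _] := dga_diff hA.
have EL v i x : hwf v -> v != [::] -> ghom i x ->
    coendo_fun (codiff d (fun t => mu (vals t)) v) x =
    codiff d (fun t => beta (vals t) (word [:: x])) v.
  move=> hv v0 hx; rewrite (codiff_lin _ _ _ (@coendo_eval_linear x)).
  apply: eq_codiff => t _ nt ht.
  by rewrite (ext_letter _ _ hx) //; exact: ht.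
have he1 : ghom 1 (e0 : E).
  split=> [|i x hx]; first exact: coendo_fun_linear.
  rewrite -[X in ghom _ X]/(coendo_fun e0 x) he; exact/dAD/letter_word_hom.
have ER v i x : hwf v -> v != [::] -> ghom i x ->
    coendo_fun (cmap1 mu (fun t => deform (@coendo_b k W) (fun=> 0) e0 (vals t)) v) x =
    dA (beta (vals v) (word [:: x])) - (-1) ^ deg v *: beta (vals v) (dA (word [:: x])).
  move=> hv v0 hx.
  rewrite (eq_cmap1 (G := fun t =>
    (if t is [:: p] then coendo_brace [:: e0] p.2 else 0) +
    (-1) ^ (deg v + 1) *: coendo_brace (vals t) e0)); last first.
    move=> t dt nt ht; rewrite -dt; apply: coendo_deform; first exact: ht.
    by case: (t) nt; case: (v) v0.
  rewrite [cmap1 _ _ _]cmapD (linD (@coendo_eval_linear x)) [X in _ + coendo_fun X _]cmapZ.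
  rewrite -!/(cmap1 _ _ _) (linZ (@coendo_eval_linear x)) coendo_brace_ext // he.
  rewrite (cmap1_cogen mu (fun p => coendo_brace [:: e0] p.2)) //.
  rewrite signD expr1z mulrN1 scaleNr; congr (_ - _).
  rewrite -[[:: e0]]/(vals [:: (1, e0)]) coendo_brace_app; last by apply/hwf_cons.
  by rewrite -(dA_app hA he) (ext_letter hv v0 hx).
split=> h v => [i x hv v0 hx|hv v0].
  by rewrite -(EL _ _ _ hv v0 hx) h // (ER _ _ _ hv v0 hx) subrK.
apply: coendo_eqP => i x hx; rewrite (EL _ _ _ hv v0 hx) (ER _ _ _ hv v0 hx).
by rewrite (h _ _ _ hv v0 hx) addrK.
Qed.

End Ext.
End AppMap.

(** * The bijection for the free algebra *)

Section AlgebraBijection.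
Variables (k : fieldType) (W B : gspace k).
Local Notation E := (coendo W).
Local Notation T := (tensor W).

Definition coendo_of (f : T -> T) : E := insubd (0 : E) (fun x => f (word [:: x])).

Definition coendo_family (beta : seq B -> T -> T) (s : seq B) : E :=
  if s is [::] then 0 else coendo_of (beta s).

Section Family.
Variable beta : seq B -> T -> T.
Hypothesis betaL : forall s, linear (beta s).
Hypothesis betaM : forall x, multilinear (beta^~ x).
Hypothesis betaD : forall (v : hword B) i x, hwf v -> ghom i x ->
  ghom (deg v + i) (beta (vals v) x).

Lemma coendo_of_gr (v : hword B) : hwf v ->
  coendo_gr (deg v) (fun x : W => beta (vals v) (word [:: x]) : tensor W).
Proof.
move=> hv; split=> [a x y|i x hx].
  by rewrite -betaL; congr (beta _ _); exact: (@word_multilinear k W [::] [::]).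
by rewrite addrC; apply/betaD => //; exact: letter_word_hom.
Qed.

Lemma coendo_of_fun s x : coendo_fun (coendo_of (beta s)) x = beta s (word [:: x]).
Proof.
rewrite /coendo_fun /coendo_of -[sval]/val insubdK //.
have [vs hvs EL] := hsum_list T s.
have -> : (fun x : W => beta s (word [:: x]) : tensor W) =
    \sum_(v <- vs) (fun x : W => beta (vals v) (word [:: x])).
  apply: funext => u; rewrite fct_sumE -EL.
  by rewrite (hsum_valsE s (f := fun s => beta s (word [:: u]))).
rewrite big_seq rpred_sum // => v /hvs hv.
exact: (gsum_homog (G := Grading (@coendo_gr_comb k W) (@coendo_gr0 k W) (@coendo_gr_direct k W))
  (coendo_of_gr hv)).
Qed.

Lemma coendo_family_mlin : multilinear (coendo_family beta).
Proof.
move=> s t a x y; have c0 z : coendo_family beta (s ++ z :: t) = coendo_of (beta (s ++ z :: t)).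
  by case: s.
rewrite !c0; apply: coendo_eqP => i z _.
by rewrite (@coendo_eval_linear k W z) !coendo_of_fun betaM.
Qed.

Lemma coendo_family_deg : multilinear_deg 0 (coendo_family beta).
Proof.
split=> [|v hv]; first exact: coendo_family_mlin.
rewrite addr0; case: v hv => [|p v] hv; first exact: ghom0.
have /= := coendo_of_gr hv; congr (coendo_gr _ _); apply: funext => x.
by rewrite -coendo_of_fun.
Qed.

End Family.

Variables (b : seq B -> seq B -> B) (d : seq B -> B) (hB : binf_algebra b d).
Variables (dA : T -> T) (hA : dg_algebra (A := T) (@tmul k W) dA).
Variables (e0 : E) (he0 : generates e0 dA).

Let bU : unital b.
Proof. by case: hB => *; split=> //; auto. Qed.

Lemma coendo_family_ext beta :
  action_on_algebra b d (A := T) (@tmul k W) dA beta -> beta = ext (@appT k W) (coendo_family beta).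
Proof.
case=> -[bL bM bD b1 _ _] bA.
have muD := coendo_family_deg bL bM bD.
apply: action_uniq => //.
- by move=> s; exact/ext_lin/appT_linear.
- by move=> x; exact/ext_mlin/muD/app_hml.
- exact: ext_acts_on_products.
move=> v i x hv hx; case: (eqVneq v [::]) => [->|v0]; first by rewrite b1 ext_nil //; exact: app_nil.
by rewrite (ext_letter muD hv v0 hx); case: v hv v0 => // p v hv _; rewrite coendo_of_fun.
Qed.

Lemma ext_coendo_family (mu : seq B -> E) : multilinear_deg 0 mu -> mu [::] = 0 ->
  coendo_family (ext (@appT k W) mu) = mu.
Proof.
move=> muD mu0; set beta := ext _ _.
have bL s : linear (beta s) by exact/ext_lin/appT_linear.
have bM x : multilinear (beta^~ x) by exact/ext_mlin/muD/app_hml.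
have bD := ext_deg (@app_hml k W) (@app_deg k W) muD.
have fM := coendo_family_mlin bL bM bD.
apply: funext => s; apply/eqP; rewrite -subr_eq0; apply/eqP.
apply: (mlin_vals0 (f := fun s => coendo_family beta s - mu s)) => [s1 s2 a y z|v hv].
  by rewrite fM (proj1 muD) opprD addrACA scalerBr.
apply/eqP; rewrite subr_eq0; apply/eqP.
case: (eqVneq v [::]) => [->|v0]; first by rewrite mu0.
apply: coendo_eqP => i x hx; rewrite -(ext_letter muD hv v0 hx).
by case: v hv v0 => // p v hv _; rewrite coendo_of_fun.
Qed.

Lemma ext_algebra_action (mu : seq B -> E) :
  multilinear_deg 0 mu -> mu [::] = 0 ->
  action_on_algebra b d (A := T) (@tmul k W) dA (ext (@appT k W) mu) <->
  binf_morphism b d (@coendo_b k W) (deform (@coendo_b k W) (fun=> 0) e0) mu.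
Proof.
move=> muD mu0; set beta := ext _ _; have [muM _] := muD.
have bL s : linear (beta s) by exact/ext_lin/appT_linear.
have bM x : multilinear (beta^~ x) by exact/ext_mlin/muD/app_hml.
have bh x : hmultilinear (fun t => beta (vals t) x) by exact: (hml_vals (bM x)).
have bD := ext_deg (@app_hml k W) (@app_deg k W) muD.
have b1 := ext_nil (@app_nil k W) mu.
have co := ext_acts_on_products muD; have b00 : b [::] [::] = 0 by case: bU.
have mulP := iff_trans (bmor_mulP muM mu0 bU (coendo_b_unital W)) (coendo_mulP muD (binf_deg hB)).
have diffP := iff_trans (bmor_diffP mu0 d (coendo_deform0 e0))
  (coendo_diffP muD (binf_d hB) hA he0).
split=> [[[_ _ _ _ bA bDi] _]|[_ _ Di Mu]].
  split=> //.
    apply/diffP => v i x hv v0 hx; have := bDi v (word [:: x]) hv v0.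
    by rewrite dhatE => <-.
  apply/mulP => u v i x hu hv u0 v0 hx; rewrite -/beta -bA // bprodE //.
  by case: (u) u0.
split; last exact: co.
split=> // [u v x hu hv u0 v0|v x hv v0].
  rewrite bprodE //; last by case: (u) u0.
  apply: action_assoc => //; [exact: binf_deg hB|exact/mulP].
rewrite dhatE; apply: action_diff => //; [exact: binf_d hB|exact/diffP].
Qed.

Lemma algebra_bij : set_bij
  [set beta | action_on_algebra b d (A := T) (@tmul k W) dA beta]
  [set mu | binf_morphism b d (@coendo_b k W) (deform (@coendo_b k W) (fun=> 0) e0) mu]
  coendo_family.
Proof.
split=> [beta /= hbeta|beta beta' /set_mem h /set_mem h' E'|mu /= hmu].
- have [[bL bM bD _ _ _] _] := hbeta.
  by apply/ext_algebra_action; rewrite -?coendo_family_ext //; exact: coendo_family_deg.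
- by rewrite (coendo_family_ext h) (coendo_family_ext h') E'.
- have [muD mu0 _ _] := hmu.
  by exists (ext (@appT k W) mu); [exact/ext_algebra_action|exact: ext_coendo_family].
Qed.

End AlgebraBijection.

Theorem lemma2 (k : fieldType) (char0 : [pchar k] =i pred0) (W : gspace k)
    (dC : tensor W -> tensor W) (hC : dg_coalgebra (C := tensor W) (@deconc k W) dC)
    (dA : tensor W -> tensor W) (hA : dg_algebra (A := tensor W) (@tmul k W) dA)
    (e0 : endo W) (he0 : cogenerates e0 dC)
    (e0' : coendo W) (he0' : generates e0' dA)
    (B : gspace k) (b : seq B -> seq B -> B) (d : seq B -> B)
    (hB : binf_algebra b d) :
  (exists Phi : (seq B -> tensor W -> tensor W) -> (seq B -> endo W),
     set_bij
       [set beta | action_on_coalgebra b d (C := tensor W) (@deconc k W) dC beta]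
       [set mu | binf_morphism b d (@endo_b k W) (deform (@endo_b k W) (fun=> 0) e0) mu]
       Phi) /\
  (exists Phi : (seq B -> tensor W -> tensor W) -> (seq B -> coendo W),
     set_bij
       [set beta | action_on_algebra b d (A := tensor W) (@tmul k W) dA beta]
       [set mu | binf_morphism b d (@coendo_b k W) (deform (@coendo_b k W) (fun=> 0) e0') mu]
       Phi).
Proof.
split.
- by exists (@endo_family k W B); apply: coalgebra_bij.
- by exists (@coendo_family k W B); apply: algebra_bij.
Qed.
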